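(* Let $q\in\mathbb{C}^\times$ be not a root of unity and $Q\in\mathbb{C}^\times$. The assignment $\varphi\mapsto L(\mathbf{u}^{\langle Q\rangle}(\varphi))$ gives a bijection between $\mathbb{C}[x]^{\langle Q\rangle}$ and the set of isomorphism classes of finite dimensional simple $U_q(\mathfrak{sl}_2^{\langle Q\rangle}[x])$-modules.
   Context: $[k]=(q^k-q^{-k})/(q-q^{-1})$, $[x,y]=xy-yx$. $U_q(\mathfrak{sl}_2^{\langle Q\rangle}[x])$ is the $\mathbb{C}$-algebra with generators $X^\pm_t,J_t$ ($t\ge0$), $K^\pm$ and relations: $K^+$ and all $J_t$ pairwise commute; $K^+K^-=1=K^-K^+$; $(K^-)^2=1-(q-q^{-1})J_0$; $X^\pm_{t+1}X^\pm_s-q^{\pm2}X^\pm_sX^\pm_{t+1}=q^{\pm2}X^\pm_tX^\pm_{s+1}-X^\pm_{s+1}X^\pm_t$; $K^+X^\pm_tK^-=q^{\pm2}X^\pm_t$; $q^{\pm2}J_0X^\pm_t-q^{\mp2}X^\pm_tJ_0=\pm[2]X^\pm_t$; $[J_{s+1},X^\pm_t]=q^{\pm2}J_sX^\pm_{t+1}-q^{\mp2}X^\pm_{t+1}J_s$; $[X^+_t,X^-_s]=K^+(J_{s+t}-QJ_{s+t+1})$. For $\mathbf{u}=(\lambda,(u_t)_{t>0})\in\mathbb{C}^\times\times\prod_{t>0}\mathbb{C}$, $L(\mathbf{u})$ is the simple module generated by a vector $v_0$ with $X^+_tv_0=0$ ($t\ge0$), $K^+v_0=\lambda v_0$, $J_tv_0=u_tv_0$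 ($t>0$) (unique simple quotient of the corresponding Verma module). For $t,k>0$: $p_t(q)(x_1,\dots,x_k)=\sum_{\lambda\vdash t,\ell(\lambda)\le k}q^{-\ell(\lambda)}(q-q^{-1})^{\ell(\lambda)-1}m_\lambda(x_1,\dots,x_k)$ ($m_\lambda$ monomial symmetric polynomial). For $\beta\in\mathbb{C}^\times$, $\tilde\beta=(q-q^{-1})^{-1}(1-\beta^{-2})$, and $p^{\langle Q\rangle}_t(q;\beta)=p_t(q)+\tilde\beta Q^{-t}+(q-q^{-1})\sum_{z=1}^{t-1}\tilde\beta Q^{-t+z}p_z(q)$ (same variables). For nonzero $\varphi=\beta_\varphi(x-\gamma_1)\cdots(x-\gamma_k)$, $\mathbf{u}^{\langle Q\rangle}(\varphi)=(\beta_\varphi,(\tilde\beta_\varphi Q^{-t})_{t>0})$ if $k=0$ and $(\beta_\varphi q^k,(p^{\langle Q\rangle}_t(q;\beta_\varphi)(\gamma_1,\dots,\gamma_k))_{t>0})$ if $k>0$, where $\tilde\beta_\varphi=(q-q^{-1})^{-1}(1-\beta_\varphi^{-2})$. $\mathbb{C}[x]^{\langle Q\rangle}=\{\varphi\ne0:\beta_\varphi^{-2}Q^{-1}\text{ is not a root of }\varphi\}$. *)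

(* Defs.v *)
From mathcomp Require Import all_boot all_algebra.
From mathcomp Require Export complex reals.

Set Implicit Arguments.
Unset Strict Implicit.
Unset Printing Implicit Defensive.

Import GRing.Theory.
Local Open Scope ring_scope.

Section Defs.
Variable C : closedFieldType.

Definition qint (q : C) (k : nat) : C := (q ^+ k - q ^- k) / (q - q^-1).

Definition not_root_of_unity (q : C) : Prop := forall n : nat, (0 < n)%N -> q ^+ n != 1.

(* Finite-dimensional modules over U_q(sl_2^<Q>[x]): a finite-dimensional
   C-vector space (realised as column vectors C^n) together with matrices
   for every generator X^+_t, X^-_t, J_t (t >= 0), K^+, K^- satisfying the
   defining relations.  The generator a acts on v by (matrix of a) *m v. *)

Section Rels.
Variables (q Q : C) (n : nat).
Implicit Types (X J : nat -> 'M[C]_n) (Kp Km : 'M[C]_n).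

Definition X_rels (e e' sg : C) X J Kp Km : Prop :=
  [/\ forall t s : nat,
        X t.+1 *m X s - e *: (X s *m X t.+1) = e *: (X t *m X s.+1) - X s.+1 *m X t,
      forall t : nat, Kp *m X t *m Km = e *: X t,
      forall t : nat, e *: (J 0%N *m X t) - e' *: (X t *m J 0%N) = (sg * qint q 2) *: X t
    & forall s t : nat,
        J s.+1 *m X t - X t *m J s.+1 = e *: (J s *m X t.+1) - e' *: (X t.+1 *m J s)].

Definition is_rep (Xp Xm J : nat -> 'M[C]_n) (Kp Km : 'M[C]_n) : Prop :=
  [/\ [/\ forall t, Kp *m J t = J t *m Kp, forall s t, J s *m J t = J t *m J s,
          Kp *m Km = 1%:M, Km *m Kp = 1%:M
        & Km *m Km = 1%:M - (q - q^-1) *: J 0%N],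
      X_rels (q ^+ 2) (q ^- 2) 1 Xp J Kp Km,
      X_rels (q ^- 2) (q ^+ 2) (-1) Xm J Kp Km
    & forall t s : nat,
        Xp t *m Xm s - Xm s *m Xp t = Kp *m (J (s + t)%N - Q *: J (s + t).+1)].
End Rels.

Record fdmod (q Q : C) := FDMod {
  fd_dim : nat;
  fd_Xp : nat -> 'M[C]_fd_dim;
  fd_Xm : nat -> 'M[C]_fd_dim;
  fd_J  : nat -> 'M[C]_fd_dim;
  fd_Kp : 'M[C]_fd_dim;
  fd_Km : 'M[C]_fd_dim;
  fd_ax : is_rep q Q fd_Xp fd_Xm fd_J fd_Kp fd_Km }.

Section ModuleNotions.
Variables (q Q : C).

(* U (row space, rows = transposed column vectors) is stable under A *)
Definition stable_by n (U A : 'M[C]_n) : bool := (U *m A^T <= U)%MS.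

Definition submodule (M : fdmod q Q) (U : 'M[C]_(fd_dim M)) : Prop :=
  [/\ forall t, stable_by U (fd_Xp M t), forall t, stable_by U (fd_Xm M t),
      forall t, stable_by U (fd_J M t), stable_by U (fd_Kp M)
    & stable_by U (fd_Km M)].
Arguments submodule : clear implicits.

Definition simple (M : fdmod q Q) : Prop :=
  (0 < fd_dim M)%N /\
  forall U : 'M[C]_(fd_dim M), submodule M U -> (U == 0) || row_full U.

Definition iso (M N : fdmod q Q) : Prop :=
  exists P : 'M[C]_(fd_dim N, fd_dim M),
    [/\ row_free P && row_full P,
        (forall t, P *m fd_Xp M t = fd_Xp N t *m P) /\
        (forall t, P *m fd_Xm M t = fd_Xm N t *m P),
        forall t, P *m fd_J M t = fd_J N t *m P,
        P *m fd_Kp M = fd_Kp N *m P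
      & P *m fd_Km M = fd_Km N *m P].

(* highest weights u = (lambda, (u_t)_{t>0}); the value u.2 0 is irrelevant *)
Definition hw_vector (M : fdmod q Q) (u : C * (nat -> C)) (v : 'cV[C]_(fd_dim M)) : Prop :=
  [/\ v != 0,
      forall t, fd_Xp M t *m v = 0,
      fd_Kp M *m v = u.1 *: v
    & forall t, (0 < t)%N -> fd_J M t *m v = u.2 t *: v].
Arguments hw_vector : clear implicits.

(* M is (a realisation of) L(u): the simple module generated by a vector v0
   with X^+_t v0 = 0, K^+ v0 = lambda v0, J_t v0 = u_t v0 (t > 0).
   Since M is simple, any nonzero vector generates it. *)
Definition is_L (M : fdmod q Q) (u : C * (nat -> C)) : Prop :=
  simple M /\ exists v0, hw_vector M u v0.

End ModuleNotions.

(* p_t(q)(x_1..x_k) = sum_{lambda |- t, l(lambda) <= k}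
      q^{-l(lambda)} (q-q^{-1})^{l(lambda)-1} m_lambda(x_1..x_k).
   Summing m_lambda over lambda amounts to summing the monomials x^alpha over
   all exponent vectors alpha in N^k with |alpha| = t, l(alpha) = number of
   nonzero entries of alpha (= l(lambda) for the partition lambda sorting alpha). *)
Definition ell k t (a : {ffun 'I_k -> 'I_t.+1}) : nat := #|[set i | val (a i) != 0%N]|.

Definition p_poly (q : C) (t : nat) (xs : seq C) : C :=
  \sum_(a : {ffun 'I_(size xs) -> 'I_t.+1} | (\sum_(i < size xs) val (a i) == t)%N)
     q ^- ell a * (q - q^-1) ^+ (ell a).-1 * \prod_(i < size xs) xs`_i ^+ val (a i).

Definition beta_tilde (q beta : C) : C := (q - q^-1)^-1 * (1 - beta ^- 2).

Definition pQ_poly (q Q beta : C) (t : nat) (xs : seq C) : C :=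
  p_poly q t xs + beta_tilde q beta * Q ^- t
  + (q - q^-1) * \sum_(1 <= z < t) beta_tilde q beta * Q ^- (t - z) * p_poly q z xs.

(* the roots gamma_1..gamma_k of phi, with multiplicity (phi splits over C) *)
Definition roots_of (phi : {poly C}) : seq C := sval (closed_field_poly_normal phi).

Definition uQ (q Q : C) (phi : {poly C}) : C * (nat -> C) :=
  let beta := lead_coef phi in
  let k := (size phi).-1 in
  if k == 0%N then (beta, fun t => beta_tilde q beta * Q ^- t)
  else (beta * q ^+ k, fun t => pQ_poly q Q beta t (roots_of phi)).

Definition CxQ (Q : C) : pred {poly C} :=
  fun phi => (phi != 0) && ~~ root phi ((lead_coef phi) ^- 2 * Q^-1).

End Defs.

(* Main.v *)
(* Put Psi_0 = 1 and Psi_t = (q - q^-1) J_t for t > 0.  On a highest weight vector of weight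
   u(phi), with phi = beta (x - g_1)..(x - g_k) and b = beta^-2/Q, the series Psi(z) acts by
     A(q^-2 z)/A(z) * (1 - b z)/(1 - z/Q),   A(z) = prod_i (1 - g_i z),   and K^+ by beta q^k;
   phi is recovered from this series and this scalar as soon as b is not one of the g_i.
   Uniqueness of L(u): in L x L' the submodule generated by (v_0, v_0') is the graph of an
   isomorphism, because its part of weight lambda is a line.
   Existence: when the g_i are distinct and nonzero there is a module with basis the subsets of
   the roots, whose relations reduce to a partial fraction identity; the other phi follow by
   specialising the roots g_i + q^i tau at tau = 0.
   Surjectivity: the power series A attached to a finite dimensional simple M (with k = dim M - 1)
   always exists.  If its coefficient of order r > k were nonzero, a truncation of it would give
   a weight phi of degree r that agrees with that of M up to order r, on whose module
   (X^+_0)^r (X^-_0)^r v_0 is a nonzero multiple of prod_i (b - g_i); but this multiple depends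
   only on the weight up to order r, and (X^-_0)^r v_0 = 0 in M.  So A is a polynomial, and
   a common root of A and 1 - b z can be removed, raising beta to q beta and lowering k. *)
Require Import Defs.
From HB Require Import structures.
From mathcomp Require Import all_boot all_algebra.
From mathcomp Require Import generic_quotient boolp ring.
From mathcomp Require Import complex reals.
Set Implicit Arguments.
Unset Strict Implicit.
Unset Printing Implicit Defensive.
Import GRing.Theory.
Local Open Scope ring_scope.
Local Open Scope complex_scope.

(** * Words on a highest weight vector *)

Section AbstractModules.
Variables (K : fieldType) (q Q : K) (V : lmodType K).

(** No Verma module is built. A highest weight vector is taken in whatever module is at hand (a
    product of two modules, a function space over C(tau)), and only the span of the words in the
    X^-_s applied to it is used; K^+ separates words of different lengths because q is not a root of
    unity. Words carry a bound on the sum of their indices, since [X^+_t, X^-_s] involves J up to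
    order s + t + 1: this bound is why E^r F^r v_0 sees the weight only up to order r. Their
    coefficient ring is left free: it is C for finite dimensional modules and C[tau] for the
    specialisation. The weights are governed by the q-difference equation A(z) (1 - z/Q) Psi(z) =
    A(q^-2 z) (1 - b z). Its coefficient of order r > 0 fixes that of A because 1 - q^(-2r) is
    nonzero. The degree k is not visible in Psi: with beta q^k fixed, replacing k by k + 1
    multiplies b by q^2 and A by 1 - q^2 b z. Excluding b from the roots removes exactly this
    ambiguity, and the same change of k gives the truncation of A the degree r that it needs. *)

Definition cur_rels (e e' sg : K) (X J : nat -> {linear V -> V}) (Kp Km : {linear V -> V}) :=
  [/\ forall t s v, X t.+1 (X s v) - e *: X s (X t.+1 v) = e *: X t (X s.+1 v) - X s.+1 (X t v),
      forall t v, Kp (X t (Km v)) = e *: X t v,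
      forall t v, e *: J 0%N (X t v) - e' *: X t (J 0%N v)
        = (sg * ((q ^+ 2 - q ^- 2) / (q - q^-1))) *: X t v
    & forall s t v,
        J s.+1 (X t v) - X t (J s.+1 v) = e *: J s (X t.+1 v) - e' *: X t.+1 (J s v)].

(** Modules on an arbitrary space instead of matrices: the same facts are needed on column vectors,
    on products of two modules and on functions with values in C(tau). *)
Record amod := AMod {
  aXp : nat -> {linear V -> V};
  aXm : nat -> {linear V -> V};
  aJ : nat -> {linear V -> V};
  aKp : {linear V -> V};
  aKm : {linear V -> V};
  aKJ : forall t v, aKp (aJ t v) = aJ t (aKp v);
  aJJ : forall s t v, aJ s (aJ t v) = aJ t (aJ s v);
  aKpm : forall v, aKp (aKm v) = v;
  aKmp : forall v, aKm (aKp v) = v;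
  aKK : forall v, aKm (aKm v) = v - (q - q^-1) *: aJ 0%N v;
  aXpR : cur_rels (q ^+ 2) (q ^- 2) 1 aXp aJ aKp aKm;
  aXmR : cur_rels (q ^- 2) (q ^+ 2) (-1) aXm aJ aKp aKm;
  aXX : forall t s v, aXp t (aXm s v) - aXm s (aXp t v)
          = aKp (aJ (s + t)%N v - Q *: aJ (s + t).+1 v) }.

(** The weight is prescribed to order [r] only, so that a pair (v, w) qualifies when the weights of
    v and w agree just that far. J_0 is left out because (K^-)^2 determines it. *)
Definition hw_upto (A : amod) (r : nat) (l : K) (u : nat -> K) (v : V) : Prop :=
  [/\ forall t, aXp A t v = 0, aKp A v = l *: v
    & forall t, (0 < t <= r)%N -> aJ A t v = u t *: v].

End AbstractModules.

(** * Sums of eigenvectors for distinct eigenvalues *)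

Section Eigen.
Variables (K : fieldType) (V : lmodType K) (T : {linear V -> V}) (mu : nat -> K).
Hypothesis mu_inj : injective mu.

(** Applying T - mu_N removes the last term and multiplies the others by the nonzero scalars mu_j -
    mu_N. *)
Lemma eigen_sum_eq0 N (z : nat -> V) :
  (forall j, T (z j) = mu j *: z j) -> \sum_(j < N) z j = 0 ->
  forall j, (j < N)%N -> z j = 0.
Proof.
elim: N z => [|N IH] z Tz; first by [].
rewrite big_ord_recr /= => s0.
have z0 j : (j < N)%N -> z j = 0.
  move=> ltjN; have /eqP: (mu j - mu N) *: z j = 0.
    apply: (IH (fun j => (mu j - mu N) *: z j)) => [i||//].
      by rewrite linearZ /= Tz !scalerA mulrC.
    rewrite (eq_bigr (fun i : 'I_N => T (z i) - mu N *: z i)); last first.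
      by move=> i _; rewrite Tz scalerBl.
    rewrite sumrB -linear_sum -scaler_sumr /=.
    have -> : \sum_(i < N) z i = - z N by apply/eqP; rewrite -addr_eq0 s0.
    by rewrite linearN /= Tz scalerN subrr.
  by rewrite scaler_eq0 subr_eq0 (inj_eq mu_inj) (ltn_eqF ltjN) /= => /eqP.
move=> j; rewrite ltnS leq_eqVlt => /orP[/eqP->|/z0//].
by move: s0; rewrite big1 ?add0r // => i _; exact: z0.
Qed.

Lemma eigen_sum N (y : nat -> V) (nu : K) (x : V) :
  (forall j, T (y j) = mu j *: y j) -> x = \sum_(j < N) y j -> T x = nu *: x ->
  x != 0 -> exists2 j, nu = mu j & x = y j.
Proof.
move=> Ty xE Tx x0.
have h j : (j < N)%N -> (mu j - nu) *: y j = 0.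
  apply: (@eigen_sum_eq0 _ (fun j => (mu j - nu) *: y j)) => [i|].
    by rewrite linearZ /= Ty !scalerA mulrC.
  rewrite (eq_bigr (fun i : 'I_N => T (y i) - nu *: y i)); last first.
    by move=> i _; rewrite Ty scalerBl.
  by rewrite sumrB -linear_sum -scaler_sumr -xE Tx subrr.
case: (boolP [exists j : 'I_N, nu == mu j]) => [/existsP[j /eqP nuj]|/existsPn nn].
  exists j => //; rewrite xE (bigD1 j) //= big1 ?addr0 // => i ij.
  move/eqP: (h i (ltn_ord i)); rewrite scaler_eq0 nuj subr_eq0 (inj_eq mu_inj).
  by case/orP=> /eqP // /val_inj /eqP; rewrite (negPf ij).
case/eqP: x0; rewrite xE big1 // => i _.
move/eqP: (h i (ltn_ord i)); rewrite scaler_eq0 subr_eq0 eq_sym (negPf (nn i)).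
by move/eqP.
Qed.
End Eigen.

Section Words.
Variables (O : comUnitRingType) (K : fieldType) (rho : {rmorphism O -> K}).
Variables (q Q : O) (V : lmodType K) (A : amod (rho q) (rho Q) V) (v0 : V).

(* The [rho]-span of the words X^-_(s_1) .. X^-_(s_j) v0 with s_1 + .. + s_j <= d. *)
Inductive words : nat -> nat -> V -> Prop :=
| words0 d a : words 0 d (rho a *: v0)
| wordsD j d x y : words j d x -> words j d y -> words j d (x + y)
| wordsX j d d' s x : words j d x -> (d + s <= d')%N -> words j.+1 d' (aXm A s x).

Lemma words_mono j d d' x : (d <= d')%N -> words j d x -> words j d' x.
Proof.
move=> h w; elim: w d' h => {j d x} [d a d' _|j d x y _ IHx _ IHy d' h|j d e s x w _ h e' h'].
- exact: words0.
- exact: wordsD (IHx _ h) (IHy _ h).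
- exact: wordsX w (leq_trans h h').
Qed.

Lemma words_zero j d : words j d 0.
Proof.
elim: j d => [|j IH] d; first by rewrite -(scale0r v0) -(rmorph0 rho); apply: words0.
by rewrite -(linear0 (aXm A 0)); apply: (wordsX (d := d)); rewrite ?addn0.
Qed.

Lemma wordsZ j d a x : words j d x -> words j d (rho a *: x).
Proof.
elim=> {j d x} [d b|j d x y _ IHx _ IHy|j d e s x _ IH h].
- by rewrite scalerA -rmorphM; apply: words0.
- by rewrite scalerDr; apply: wordsD.
- by rewrite -linearZ; apply: wordsX IH h.
Qed.

Lemma wordsN j d x : words j d x -> words j d (- x).
Proof. by move=> w; rewrite -scaleN1r -(rmorphN1 rho); apply: wordsZ. Qed.

Lemma wordsB j d x y : words j d x -> words j d y -> words j d (x - y).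
Proof. by move=> wx wy; apply: wordsD => //; apply: wordsN. Qed.

Hypothesis (q_unit : q \is a GRing.unit) (c_unit : q - q^-1 \is a GRing.unit).

Lemma rho_qX n : rho (q ^- n) = rho q ^- n.
Proof. by rewrite rmorphV ?unitrX // rmorphXn. Qed.

Lemma rho_q0 : rho q != 0.
Proof. by rewrite -unitfE rmorph_unit. Qed.

Lemma rho_c : rho (q - q^-1) = rho q - (rho q)^-1.
Proof. by rewrite rmorphB rmorphV. Qed.

Variables (l : O) (l_unit : l \is a GRing.unit) (u : nat -> O) (r : nat).
Hypothesis hw : hw_upto A r (rho l) (rho \o u) v0.

(** The eigenvalue of K^+ on words of length [j]: each X^- contributes q^-2. *)
Definition word_wt j : O := l * q ^- (2 * j).

Lemma word_wt_unit j : word_wt j \is a GRing.unit.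
Proof. by rewrite unitrM l_unit unitrV unitrX. Qed.

Lemma aKpX t x : aKp A (aXm A t x) = rho (q ^- 2) *: aXm A t (aKp A x).
Proof. by have [_ h _ _] := aXmR A; rewrite -{1}(aKmp A x) h rho_qX. Qed.

Lemma words_Kp j d x : words j d x -> aKp A x = rho (word_wt j) *: x.
Proof.
elim=> {j d x} [d b|j d x y _ IHx _ IHy|j d e s x _ IH _].
- have [_ hK _] := hw; rewrite linearZ /= hK !scalerA /word_wt muln0 expr0 invr1 mulr1.
  by rewrite mulrC.
- by rewrite linearD /= IHx IHy scalerDr.
- rewrite aKpX IH linearZ /= scalerA -rmorphM; congr (rho _ *: _).
  rewrite /word_wt mulrCA; congr (_ * _).
  by rewrite mulnS exprD [RHS]invrM ?unitrX // mulrC.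
Qed.

Lemma words_Km j d x : words j d x -> aKm A x = rho (word_wt j)^-1 *: x.
Proof.
move=> w; rewrite -{2}(aKmp A x) (words_Kp w) linearZ /= scalerA -rmorphM.
by rewrite mulVr ?word_wt_unit // rmorph1 scale1r.
Qed.

(** J_0 is recovered from (K^-)^2 = 1 - (q - q^-1) J_0; this is where q - q^-1 must be invertible in
    [O]. *)
Lemma words_J0 j d x : words j d x -> words j d (aJ A 0 x).
Proof.
move=> w; have := aKK A x; rewrite (words_Km w) linearZ /= (words_Km w) => e.
have -> : aJ A 0 x = rho (q - q^-1)^-1 *: (x - rho (word_wt j)^-1 *: (rho (word_wt j)^-1 *: x)).
  rewrite e opprB addrCA subrr addr0 -rho_c scalerA -rmorphM.
  by rewrite mulVr // rmorph1 scale1r.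
by apply: wordsZ; apply: wordsB => //; do 2!apply: wordsZ.
Qed.

(** Moving J_(n+1) past X^-_s lowers the index of J by one and raises that of X^- by one, so the
    total index grows by at most the index of the original J, and only J of order at most [r] ever
    reaches [v0]. *)
Lemma words_J n j d x : (n <= r)%N -> words j d x -> words j (d + n) (aJ A n x).
Proof.
elim: n j d x => [|n IHn] j d x; first by rewrite addn0 => _; apply: words_J0.
move=> lenr; elim=> {j d x} [d b|j d x y _ IHx _ IHy|j d e s x w IH h].
- have [_ _ hJ] := hw; rewrite linearZ /= hJ ?lenr //= scalerA mulrC -scalerA.
  by apply: wordsZ; apply: words0.
- by rewrite linearD; apply: wordsD.
have [_ _ h0 h1] := aXmR A.
have -> : aJ A n.+1 (aXm A s x) = aXm A s (aJ A n.+1 x)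
    + (rho q ^- 2 *: aJ A n (aXm A s.+1 x) - rho q ^+ 2 *: aXm A s.+1 (aJ A n x)).
  by rewrite -h1 addrCA subrr addr0.
apply: wordsD; first by apply: wordsX IH _; rewrite addnAC leq_add2r.
have h' : (d + s.+1 <= e.+1)%N by rewrite addnS ltnS.
have [n0|n0] := posnP n.
  rewrite {}n0 in IHn lenr *; rewrite h0 addn1.
  have -> : (-1 * ((rho q ^+ 2 - rho q ^- 2) / (rho q - (rho q)^-1)))
      = rho (-1 * ((q ^+ 2 - q ^- 2) / (q - q^-1))).
    by rewrite !rmorphM rmorphN1 rmorphV // rho_c rmorphB rmorphXn rho_qX.
  by apply: wordsZ; apply: wordsX w h'.
rewrite -rho_qX -rmorphXn; apply: wordsB; apply: wordsZ.
  have := IHn _ _ _ (ltnW lenr) (wordsX w h').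
  by rewrite addSnnS.
apply: wordsX (IHn _ _ _ (ltnW lenr) w) _.
by rewrite addnAC addnS -[(e + _)%N]addSnnS leq_add2r.
Qed.

Lemma words_Kp_stable j d x : words j d x -> words j d (aKp A x).
Proof. by move=> w; rewrite (words_Kp w); apply: wordsZ. Qed.

Lemma words_Km_stable j d x : words j d x -> words j d (aKm A x).
Proof. by move=> w; rewrite (words_Km w); apply: wordsZ. Qed.

Lemma words0_Xp t d x : words 0 d x -> aXp A t x = 0.
Proof.
move=> w; move jE: 0%N w => j w; elim: w jE => {d x j} // [d b _|j d x y _ IHx _ IHy jE].
  by have [h _ _] := hw; rewrite linearZ /= h scaler0.
by rewrite linearD /= IHx // IHy // addr0.
Qed.

(** Each X^-_s met by X^+_t is replaced by K^+ (J_(s+t) - Q J_(s+t+1)): one letter is lost and the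
    total index grows by at most t + 1, the extra unit coming from J_(s+t+1). *)
Lemma words_Xp t j d x : (d + t.+1 <= r)%N -> words j.+1 d x -> words j (d + t.+1) (aXp A t x).
Proof.
move=> h w; move jE: j.+1 w h => j' w.
elim: w j jE => {j' d x} // [j' d x y _ IHx _ IHy|j' d e s x w IH h] j jE ler.
  by rewrite linearD; apply: wordsD; [apply: IHx|apply: IHy].
case: jE w IH => <- {j'} w IH; rewrite -(subrK (aXm A s (aXp A t x)) (aXp A t _)) aXX.
have hs : (d + (s + t).+1 <= e + t.+1)%N by rewrite -addnS addnA leq_add2r.
apply: wordsD.
  apply: words_Kp_stable; apply: wordsB.
    apply: words_mono (words_J _ w); last first.
      by apply: leq_trans (leq_trans hs ler); rewrite addnS; apply: leqW; apply: leq_addl.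
    by apply: leq_trans hs; rewrite addnS; apply: leqW.
  apply: wordsZ; apply: words_mono (words_J _ w); first exact: hs.
  by apply: leq_trans (leq_trans hs ler); apply: leq_addl.
have hd : (d + t.+1 + s <= e + t.+1)%N by rewrite addnAC leq_add2r.
case: j w IH => [|j] w IH.
  by rewrite (words0_Xp t w) linear0; apply: words_zero.
have hd' : (d + t.+1 <= r)%N by apply: leq_trans ler; apply: leq_trans hd; apply: leq_addr.
exact: wordsX (IH j (erefl _) hd') hd.
Qed.

End Words.

Section Span.
Variables (O : comUnitRingType) (K : fieldType) (rho : {rmorphism O -> K}).
Variables (q Q : O) (V : lmodType K) (A : amod (rho q) (rho Q) V) (v0 : V).

Inductive word_span : V -> Prop :=
| word_spanI j d x : words A v0 j d x -> word_span x
| word_spanD x y : word_span x -> word_span y -> word_span (x + y).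

Lemma word_span0 : word_span v0.
Proof. by rewrite -[v0]scale1r -(rmorph1 rho); apply: word_spanI (words0 _ _ 0 _). Qed.

Lemma word_spanZ a x : word_span x -> word_span (rho a *: x).
Proof.
elim=> {x} [j d x w|x y _ IHx _ IHy]; last by rewrite scalerDr; apply: word_spanD.
exact: word_spanI (wordsZ _ w).
Qed.

Lemma word_span_Xm t x : word_span x -> word_span (aXm A t x).
Proof.
elim=> {x} [j d x w|x y _ IHx _ IHy]; last by rewrite linearD; apply: word_spanD.
exact: word_spanI (wordsX w (leqnn _)).
Qed.

Lemma words0P d x : words A v0 0 d x -> exists a, x = rho a *: v0.
Proof.
move=> w; move jE: 0%N w => j w; elim: w jE => {d x j} // [d a _|j d x y _ IHx _ IHy jE].
  by exists a.
have [a ->] := IHx jE; have [b ->] := IHy jE.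
by exists (a + b); rewrite rmorphD scalerDl.
Qed.

Lemma word_span_decomp x : word_span x -> exists N (y : nat -> V),
  (forall j, exists d, words A v0 j d (y j)) /\ x = \sum_(j < N) y j.
Proof.
(* Vanishing beyond N is added so that two decompositions with different N can be summed. *)
suff: word_span x -> exists N (y : nat -> V), [/\ forall j, exists d, words A v0 j d (y j),
    forall j, (N <= j)%N -> y j = 0 & x = \sum_(j < N) y j].
  by move=> h /h [N [y [? _ ?]]]; exists N, y.
elim=> {x} [j d x w|x y _ [N [a [aw a0 ->]]] _ [M [b [bw b0 ->]]]].
  exists j.+1, (fun i => if i == j then x else 0); split.
  - move=> i; exists d; case: eqP => [->//|_]; exact: words_zero.
  - by move=> i; case: eqP => [->|//]; rewrite ltnn.
  - rewrite big_ord_recr /= eqxx big1 ?add0r // => i _.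
    by rewrite (ltn_eqF (ltn_ord i)).
exists (N + M)%N, (fun j => a j + b j); split.
- move=> j; have [d1 w1] := aw j; have [d2 w2] := bw j; exists (d1 + d2)%N.
  by apply: wordsD; [apply: words_mono w1; apply: leq_addr|apply: words_mono w2; apply: leq_addl].
- by move=> j h; rewrite a0 ?b0 ?addr0 //; apply: leq_trans h; rewrite (leq_addl, leq_addr).
rewrite big_split /=; congr (_ + _).
  rewrite big_split_ord /= [X in _ + X]big1 ?addr0 // => i _.
  by apply: a0; apply: leq_addr.
rewrite addnC big_split_ord /= [X in _ + X]big1 ?addr0 // => i _.
by apply: b0; apply: leq_addr.
Qed.

Hypothesis (q_unit : q \is a GRing.unit) (c_unit : q - q^-1 \is a GRing.unit).
Variables (l : O) (l_unit : l \is a GRing.unit) (u : nat -> O).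
Hypothesis hw : forall r, hw_upto A r (rho l) (rho \o u) v0.

Lemma word_span_Kp x : word_span x -> word_span (aKp A x).
Proof.
elim=> {x} [j d x w|x y _ IHx _ IHy]; last by rewrite linearD; apply: word_spanD.
exact: word_spanI (words_Kp_stable q_unit (hw 0) w).
Qed.

Lemma word_span_Km x : word_span x -> word_span (aKm A x).
Proof.
elim=> {x} [j d x w|x y _ IHx _ IHy]; last by rewrite linearD; apply: word_spanD.
exact: word_spanI (words_Km_stable q_unit l_unit (hw 0) w).
Qed.

Lemma word_span_J t x : word_span x -> word_span (aJ A t x).
Proof.
elim=> {x} [j d x w|x y _ IHx _ IHy]; last by rewrite linearD; apply: word_spanD.
exact: word_spanI (words_J q_unit c_unit l_unit (hw t) (leqnn t) w).
Qed.

Lemma word_span_Xp t x : word_span x -> word_span (aXp A t x).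
Proof.
elim=> {x} [j d x w|x y _ IHx _ IHy]; last by rewrite linearD; apply: word_spanD.
case: j w => [|j] w; last first.
  exact: word_spanI (words_Xp q_unit c_unit l_unit (hw (d + t.+1)) (leqnn _) w).
rewrite (words0_Xp (hw 0) t w) -(scale0r v0) -(rmorph0 rho).
exact: word_spanZ word_span0.
Qed.

Hypothesis q_nru : forall n, (0 < n)%N -> rho q ^+ n != 1.

Lemma word_wt_inj : injective (fun j => rho (word_wt q l j)).
Proof.
have q0 : rho q != 0 by apply: rho_q0.
have l0 : rho l != 0 by rewrite -unitfE rmorph_unit.
suff h i j : (i < j)%N -> rho (word_wt q l i) != rho (word_wt q l j).
  move=> i j /eqP e; case: (ltngtP i j) => // /h; first by rewrite e.
  by rewrite eq_sym e.
move=> ltij; rewrite !rmorphM (inj_eq (mulfI l0)) !rho_qX // (inj_eq (@invr_inj _)).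
rewrite -(subnK (ltnW ltij)) mulnDr exprD -subr_eq0 -[X in X - _]mul1r -mulrBl.
rewrite mulf_eq0 subr_eq0 expf_eq0 (negPf q0) andbF orbF eq_sym.
by apply: q_nru; rewrite muln_gt0 subn_gt0.
Qed.

(** Grouping words by length writes [x] as a sum of K^+-eigenvectors with distinct eigenvalues, of
    which only one can be nonzero. *)
Lemma word_span_eigen nu x : word_span x -> aKp A x = nu *: x -> x != 0 ->
  exists j d, nu = rho (word_wt q l j) /\ words A v0 j d x.
Proof.
move=> /word_span_decomp[N [y [yw xE]]] Kx x0.
have [|j nuE xj] := eigen_sum word_wt_inj _ xE Kx x0.
  by move=> j; have [d w] := yw j; rewrite (words_Kp q_unit (hw 0) w).
by have [d w] := yw j; exists j, d; rewrite xj.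
Qed.

End Span.

(** * Finite-dimensional subquotients *)

Section OfModule.
Variables (C : closedFieldType) (q Q : C) (M : fdmod q Q).
Let cv : lmodType C := 'cV[C]_(fd_dim M).

Lemma qint2 : qint q 2 = (q ^+ 2 - q ^- 2) / (q - q^-1). Proof. by []. Qed.

Let mm (A : 'M[C]_(fd_dim M)) : {linear cv -> cv} := mulmx A.

Lemma cur_rels_mx e e' sg X J Kp Km : X_rels q e e' sg X J Kp Km ->
  cur_rels q e e' sg (fun t => mm (X t)) (fun t => mm (J t)) (mm Kp) (mm Km).
Proof.
case=> h1 h2 h3 h4; split=> [t s v|t v|t v|s t v] /=; rewrite /mm /= !mulmxA.
- by rewrite !(scalemxAl _ _ v) -!mulmxBl h1.
- by rewrite (scalemxAl _ _ v) h2.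
- by rewrite !(scalemxAl _ _ v) -mulmxBl h3.
- by rewrite !(scalemxAl _ _ v) -!mulmxBl h4.
Qed.

Definition amod_of : amod q Q cv.
Proof.
refine (@AMod _ q Q cv (fun t => mm (fd_Xp M t)) (fun t => mm (fd_Xm M t))
  (fun t => mm (fd_J M t)) (mm (fd_Kp M)) (mm (fd_Km M)) _ _ _ _ _ _ _ _);
  have [[h1 h2 h3 h4 h5] h6 h7 h8] := fd_ax M => *;
  rewrite /mm /= ?mulmxA; try exact: cur_rels_mx.
- by rewrite h1.
- by rewrite h2.
- by rewrite h3 mul1mx.
- by rewrite h4 mul1mx.
- by rewrite h5 mulmxBl mul1mx scalemxAl.
- by rewrite -mulmxBl h8 -!mulmxA mulmxBl scalemxAl.
Defined.
End OfModule.

(** * Realising a subquotient by matrices *)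

Section Submodules.
Variables (C K : fieldType) (iota : {rmorphism C -> K}) (q Q : K) (V : lmodType K).
Variables (A : amod q Q V).

(** Linearity is required over C only, through [iota]: both a C[tau]-lattice in a space over C(tau)
    and its multiple by tau must qualify. *)
Definition asub (Y : V -> Prop) : Prop :=
  [/\ Y 0 /\ (forall a x y, Y x -> Y y -> Y (iota a *: x + y)),
      forall t x, Y x -> Y (aXp A t x), forall t x, Y x -> Y (aXm A t x),
      forall t x, Y x -> Y (aJ A t x)
    & (forall x, Y x -> Y (aKp A x)) /\ (forall x, Y x -> Y (aKm A x))].

Lemma asubD Y x y : asub Y -> Y x -> Y y -> Y (x + y).
Proof. by case=> -[_ h] _ _ _ _; rewrite -{2}[x]scale1r -(rmorph1 iota); apply: h. Qed.

Lemma asubZ Y a x : asub Y -> Y x -> Y (iota a *: x).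
Proof. by case=> -[h0 h] _ _ _ _ Yx; rewrite -[X in Y X]addr0; apply: h. Qed.

Lemma asubN Y x : asub Y -> Y x -> Y (- x).
Proof. by move=> YY Yx; rewrite -scaleN1r -(rmorphN1 iota); apply: asubZ. Qed.

Lemma asubB Y x y : asub Y -> Y x -> Y y -> Y (x - y).
Proof. by move=> YY Yx Yy; apply: asubD => //; apply: asubN. Qed.

Lemma asub_sum Y n (a : 'I_n -> C) (s : 'I_n -> V) : asub Y -> (forall i, Y (s i)) ->
  Y (\sum_i iota (a i) *: s i).
Proof.
move=> YY Ys; apply: (big_ind Y) => [|x y|i _]; first by case: YY => -[].
- exact: asubD.
- exact: asubZ.
Qed.

(** Says dim_C Y/Z < n without forming the quotient (for [Z] inside [Y]). *)
Definition dep_mod (Y Z : V -> Prop) n := forall s : 'I_n -> V, (forall i, Y (s i)) ->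
  exists a : 'I_n -> C, (exists i, a i != 0) /\ Z (\sum_i iota (a i) *: s i).
End Submodules.

Ltac stable := solve [repeat first [assumption | match goal with
  | H : asub _ _ ?Y |- ?Y (_ - _) => apply (asubB H)
  | H : asub _ _ ?Y |- ?Y (_ + _) => apply (asubD H)
  | H : asub _ _ ?Y |- ?Y (- _) => apply (asubN H)
  | H : asub _ _ ?Y |- ?Y (_ *: _) => apply (asubZ _ H)
  | H : forall t x, ?Y x -> _ |- ?Y _ => apply H
  | H : forall x, ?Y x -> _ |- ?Y _ => apply H
  end]].

Section Realize.
Variables (C : closedFieldType) (K : fieldType) (iota : {rmorphism C -> K}) (q Q : C).
Variables (V : lmodType K) (A : amod (iota q) (iota Q) V) (Y Z : V -> Prop).
Hypotheses (YY : asub iota A Y) (ZZ : asub iota A Z).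

(** [pi] plays the role of the projection Y -> Y/Z followed by coordinates; its values outside [Y]
    are arbitrary. *)
Definition realizes (M : fdmod q Q) (pi : V -> 'cV[C]_(fd_dim M)) : Prop :=
  [/\ forall a x y, Y x -> Y y -> pi (iota a *: x + y) = a *: pi x + pi y,
      forall w, exists2 x, Y x & pi x = w,
      forall x, Y x -> (pi x = 0 <-> Z x),
      (forall t x, Y x -> pi (aXp A t x) = fd_Xp M t *m pi x) /\
      (forall t x, Y x -> pi (aXm A t x) = fd_Xm M t *m pi x)
    & [/\ forall t x, Y x -> pi (aJ A t x) = fd_J M t *m pi x,
          forall x, Y x -> pi (aKp A x) = fd_Kp M *m pi x
        & forall x, Y x -> pi (aKm A x) = fd_Km M *m pi x]].

(** A maximal family of [Y] independent modulo [Z] has at most n elements and is a basis of Y/Z; the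
    module consists of the matrices of the operators in this basis. *)
Lemma realize n : dep_mod iota Y Z n.+1 ->
  exists (M : fdmod q Q) pi, (fd_dim M <= n)%N /\ @realizes M pi.
Proof.
move=> dep.
pose indep m := exists s : 'I_m -> V, (forall i, Y (s i)) /\
  forall a : 'I_m -> C, Z (\sum_i iota (a i) *: s i) -> forall i, a i = 0.
have ind0 : indep 0%N by exists (fun _ => 0); split=> [[]|? ? []].
have ind_le m : indep m -> (m <= n)%N.
  move=> [s [sY sI]]; rewrite leqNgt; apply/negP => ltnm.
  have [a [[i ai] aZ]] := dep (fun i => s (widen_ord ltnm i)) (fun i => sY _).
  pose b (j : 'I_m) : C := if insub (nat_of_ord j) is Some i then a i else 0.
  have bE i' : b (widen_ord ltnm i') = a i'.
    by rewrite /b /= insubT //= => h; congr a; apply: val_inj.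
  suff /sI/(_ (widen_ord ltnm i)) : Z (\sum_j iota (b j) *: s j).
    by rewrite bE => ai0; rewrite ai0 eqxx in ai.
  have -> // : \sum_j iota (b j) *: s j = \sum_i iota (a i) *: s (widen_ord ltnm i).
  rewrite (bigID (fun j : 'I_m => (j < n.+1)%N)) /= [X in _ + X]big1 ?addr0; last first.
    by move=> j jn; rewrite /b insubF ?rmorph0 ?scale0r //; apply/negbTE.
  under [RHS]eq_bigr => i' _ do rewrite -bE.
  by rewrite big_ord_narrow.
have [m /asboolP [s [sY sI]] mmax] := ex_maxnP
   (P := fun m => `[< indep m >]) (m := n)
   (ex_intro _ 0%N (introT (asboolP _) ind0)) (fun m im => ind_le m (elimT (asboolP _) im)).
have lemn : (m <= n)%N by apply: ind_le; exists s.
pose comb (a : 'cV[C]_m) := \sum_i iota (a i 0) *: s i.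
have combL c a b : comb (c *: a + b) = iota c *: comb a + comb b.
  rewrite /comb scaler_sumr -big_split /=; apply: eq_bigr => i _.
  by rewrite !mxE rmorphD rmorphM scalerDl scalerA.
have Ycomb a : Y (comb a) by apply: asub_sum YY _ .
have span x : exists a, Y x -> Z (x - comb a).
  have [Yx|] := pselect (Y x); last by exists 0.
  suff [a h] : exists a, Z (x - comb a) by exists a.
  apply: contrapT => nex.
  (* An element outside the span modulo [Z] would enlarge the maximal family. *)
  suff /asboolP/mmax : indep m.+1 by rewrite ltnn.
  exists (fun i => if unlift ord0 i is Some j then s j else x); split.
    by move=> i; case: unliftP.
  move=> a; rewrite big_ord_recl unlift_none.
  under eq_bigr => i _ do rewrite liftK.
  have [a0|a0] := eqVneq (a ord0) 0.
    rewrite a0 rmorph0 scale0r add0r => /sI h i; case: (unliftP ord0 i) => [j ->|->//].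
    exact: h.
  move=> h; case: nex; exists (\col_i (- (a ord0)^-1 * a (lift ord0 i))).
  have := asubZ (a ord0)^-1 ZZ h.
  rewrite scalerDr scalerA -rmorphM mulVf // rmorph1 scale1r.
  congr (Z (x + _)); rewrite /comb scaler_sumr -sumrN; apply: eq_bigr => i _.
  by rewrite mxE scalerA -rmorphM mulNr rmorphN scaleNr opprK.
have [pi piP] := choice span.
have piE x a : Y x -> Z (x - comb a) -> pi x = a.
  move=> Yx Zx; apply/colP => i; apply/eqP; rewrite -subr_eq0; apply/eqP.
  have : Z (comb (-1 *: a + pi x)).
    rewrite combL rmorphN1 scaleN1r.
    have -> : - comb a + comb (pi x) = (x - comb a) - (x - comb (pi x)).
      by rewrite opprB [RHS]addrC addrA subrK addrC.
    by apply: asubB ZZ Zx _; apply: piP.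
  by move=> /sI /(_ i); rewrite !mxE mulN1r addrC.
have piL a x y : Y x -> Y y -> pi (iota a *: x + y) = a *: pi x + pi y.
  move=> Yx Yy; apply: piE; first by apply: asubD YY _ _ => //; apply: asubZ YY _.
  rewrite combL opprD addrACA -scalerBr; apply: asubD ZZ _ (piP _ Yy).
  by apply: asubZ ZZ (piP _ Yx).
have pi_comb a : pi (comb a) = a.
  by apply: piE => //; rewrite subrr; case: ZZ => -[].
have pi0 x : Y x -> (pi x = 0 <-> Z x).
  have comb0 : comb 0 = 0.
    by rewrite /comb big1 // => i _; rewrite mxE rmorph0 scale0r.
  move=> Yx; split=> [px|Zx]; last by apply: piE => //; rewrite comb0 subr0.
  by have := piP _ Yx; rewrite px comb0 subr0.
have piD x y : Y x -> Y y -> pi (x + y) = pi x + pi y.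
  by move=> Yx Yy; have := piL 1 _ _ Yx Yy; rewrite rmorph1 !scale1r.
have pi00 : pi 0 = 0 by apply/pi0; [case: YY => -[]|case: ZZ => -[]].
have piZ a x : Y x -> pi (iota a *: x) = a *: pi x.
  move=> Yx; have [[Y0 _] _ _ _ _] := YY.
  by have := piL a _ _ Yx Y0; rewrite pi00 !addr0.
have piB x y : Y x -> Y y -> pi (x - y) = pi x - pi y.
  move=> Yx Yy; rewrite piD; try stable.
  by rewrite -scaleN1r -(rmorphN1 iota) piZ // scaleN1r.
pose mat (T : {linear V -> V}) := \matrix_(i, j) pi (T (s j)) i 0.
have matP (T : {linear V -> V}) : (forall x, Y x -> Y (T x)) -> (forall x, Z x -> Z (T x)) ->
    forall x, Y x -> pi (T x) = mat T *m pi x.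
  move=> TY TZ x Yx; rewrite -{1}(subrK (comb (pi x)) x) linearD.
  rewrite piD; [|by apply: TY; apply: asubB YY _ _|by apply: TY].
  have -> : pi (T (x - comb (pi x))) = 0.
    by apply/pi0; [apply: TY; apply: asubB YY _ _|apply/TZ/piP].
  rewrite add0r /comb linear_sum /=.
  have -> : pi (\sum_i T (iota (pi x i 0) *: s i)) = \sum_i pi x i 0 *: pi (T (s i)).
    have h : forall r : seq 'I_m, Y (\sum_(i <- r) T (iota (pi x i 0) *: s i)) /\
      pi (\sum_(i <- r) T (iota (pi x i 0) *: s i)) = \sum_(i <- r) pi x i 0 *: pi (T (s i)).
      elim=> [|i r [IH1 IH2]]; first by rewrite !big_nil pi00; split=> //; case: YY => -[].
      have Yi : Y (T (iota (pi x i 0) *: s i)) by apply: TY; apply: asubZ YY _.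
      rewrite !big_cons; split; first by apply: asubD YY _ _.
      by rewrite piD // IH2 linearZ /= piZ //; apply: TY.
    by have [] := h (index_enum 'I_m).
  apply/colP => i; rewrite !mxE summxE; apply: eq_bigr => j _.
  by rewrite !mxE mulrC.
have [_ Yp Ym YJ [YKp YKm]] := YY; have [_ Zp Zm ZJ [ZKp ZKm]] := ZZ.
have Xp_mat t := matP _ (Yp t) (Zp t); have Xm_mat t := matP _ (Ym t) (Zm t).
have J_mat t := matP _ (YJ t) (ZJ t).
have Kp_mat := matP _ YKp ZKp; have Km_mat := matP _ YKm ZKm.
have ext (B D : 'M[C]_m) : (forall x, Y x -> B *m pi x = D *m pi x) -> B = D.
  move=> h; apply/matrixP => i j; have := h (comb (delta_mx j 0)) (Ycomb _).
  by rewrite pi_comb -!colE => /colP/(_ i); rewrite !mxE.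
have rels e e' sg (X : nat -> {linear V -> V}) :
    (forall t x, Y x -> Y (X t x)) ->
    (forall t x, Y x -> pi (X t x) = mat (X t) *m pi x) ->
    cur_rels (iota q) (iota e) (iota e') (iota sg) X (aJ A) (aKp A) (aKm A) ->
    X_rels q e e' sg (fun t => mat (X t)) (fun t => mat (aJ A t)) (mat (aKp A)) (mat (aKm A)).
  move=> YX X_mat [h1 h2 h3 h4].
  split=> [t s'|t|t|s' t]; apply: ext => x Yx;
    rewrite ?mulmxBl -?scalemxAl -?mulmxA -?mulmxBl -?scalemxAl -?mulmxA.
  - rewrite -!X_mat; try stable.
    rewrite -!piZ; try stable.
    by rewrite -!piB ?h1; try stable.
  - rewrite -Km_mat -?X_mat -?Kp_mat ?h2 ?piZ; try stable.
    by [].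
  - rewrite -!X_mat -?J_mat -?X_mat; try stable.
    rewrite -!piZ -?piB ?h3; try stable.
    congr (pi (_ *: _)); rewrite qint2 !rmorphM fmorphV !rmorphB.
    by rewrite !fmorphV !rmorphXn.
  - rewrite -!X_mat -?J_mat -?X_mat; try stable.
    rewrite -!piZ; try stable.
    by rewrite -!piB ?h4; try stable.
have rep : is_rep q Q (fun t => mat (aXp A t)) (fun t => mat (aXm A t))
    (fun t => mat (aJ A t)) (mat (aKp A)) (mat (aKm A)).
  split.
  - split=> [t|s' t|||]; apply: ext => x Yx; rewrite ?mulmxBl -?scalemxAl ?mul1mx -?mulmxA.
    + by rewrite -J_mat -?Kp_mat -?J_mat ?aKJ; try stable.
    + rewrite -!J_mat; try stable.
      by rewrite aJJ.
    + by rewrite -Km_mat -?Kp_mat ?aKpm; try stable.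
    + by rewrite -Kp_mat -?Km_mat ?aKmp; try stable.
    + rewrite -!Km_mat -?J_mat; try stable.
      rewrite -piZ; try stable.
      rewrite -piB; try stable.
      by rewrite aKK rmorphB fmorphV.
  - by apply: rels => //; have := aXpR A; rewrite rmorphXn fmorphV rmorphXn rmorph1.
  - by apply: rels => //; have := aXmR A; rewrite rmorphXn fmorphV rmorphXn rmorphN1.
  - move=> t s'; apply: ext => x Yx; rewrite mulmxBl -!mulmxA mulmxBl -scalemxAl.
    rewrite -!J_mat -?Xp_mat -?Xm_mat -?Xp_mat -?Xm_mat; try stable.
    rewrite -?piZ -?piB -?Kp_mat ?aXX; try stable.
    by [].
exists (FDMod rep), pi; split=> //; split=> //.
by move=> w; exists (comb w).
Qed.

End Realize.

(** A matrix of maximal rank among those with row space inside [U] works: a missing vector could be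
    adjoined to it. *)
Lemma subspace_mx (F : fieldType) n (U : 'cV[F]_n -> Prop) :
  U 0 -> (forall a x y, U x -> U y -> U (a *: x + y)) ->
  exists B : 'M_n, forall v, U v <-> (v^T <= B)%MS.
Proof.
move=> U0 UD.
pose P r := `[< exists B : 'M[F]_n, (forall v : 'cV_n, (v^T <= B)%MS -> U v) /\ \rank B = r >].
have exP : exists r, P r.
  exists 0%N; apply/asboolP; exists 0; split; last exact: mxrank0.
  by move=> v; rewrite submx0 => /eqP vT; rewrite -[v]trmxK vT trmx0.
have leP r : P r -> (r <= n)%N by move=> /asboolP[B [_ <-]]; apply: rank_leq_col.
have [r /asboolP[B [BU Br]] rmax] := ex_maxnP exP leP.
exists B => v; split; last exact: BU.
move=> Uv; apply: contrapT => /negP nvB.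
suff /rmax : P (\rank (v^T + B)%MS).
  rewrite leqNgt => /negP; apply; rewrite -Br; apply: rank_ltmx.
  by rewrite /ltmx addsmxSr addsmx_sub (negPf nvB).
apply/asboolP; exists (v^T + B)%MS; split=> // w /sub_addsmxP[[a b] /= ab].
have -> : w = a 0 0 *: v + (b *m B)^T.
  rewrite -[w]trmxK ab linearD /= [a]mx11_scalar mul_scalar_mx linearZ /= trmxK.
  by rewrite mxE eqxx mulr1n.
by apply: UD Uv _; apply: BU; rewrite trmxK submxMl.
Qed.

Section Simple.
Variables (C : closedFieldType) (q Q : C).
Implicit Type M : fdmod q Q.

Notation fdsub M := (@asub C C idfun q Q _ (amod_of M)).

Lemma stable_byP n (B A : 'M[C]_n) : reflect (forall v : 'cV_n, (v^T <= B)%MS -> ((A *m v)^T <= B)%MS)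
  (stable_by B A).
Proof.
apply: (iffP idP) => [h v vB|h].
  by rewrite trmx_mul; apply: submx_trans h; apply: submxMr.
apply/row_subP => i; rewrite row_mul -[row i B]trmxK -trmx_mul; apply: h.
by rewrite trmxK row_sub.
Qed.

Lemma submoduleP M (B : 'M_(fd_dim M)) : submodule B <-> fdsub M (fun v => (v^T <= B)%MS).
Proof.
split=> [[h1 h2 h3 h4 h5]|[_ h1 h2 h3 [h4 h5]]]; last first.
  split=> [t|t|t||]; apply/stable_byP; [exact: h1|exact: h2|exact: h3|exact: h4|exact: h5].
split=> [|t x|t x|t x|]; rewrite /=.
- split=> [|a x y xB yB]; first by rewrite trmx0 sub0mx.
  by rewrite linearP /= addmx_sub // scalemx_sub.
- by move: x; apply/stable_byP.
- by move: x; apply/stable_byP.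
- by move: x; apply/stable_byP.
by split; apply/stable_byP.
Qed.

Lemma asub_mx M (U : 'cV_(fd_dim M) -> Prop) : fdsub M U ->
  exists2 B, submodule B & forall v, U v <-> (v^T <= B)%MS.
Proof.
move=> UU; have [[U0 UD] h1 h2 h3 [h4 h5]] := UU.
have [B BP] := subspace_mx U0 UD; exists B => //; apply/submoduleP.
split=> [|t x|t x|t x|].
- by split=> [|a x y]; rewrite -!BP; [exact: U0|exact: UD].
- by rewrite -!BP; apply: h1.
- by rewrite -!BP; apply: h2.
- by rewrite -!BP; apply: h3.
- by split=> x; rewrite -!BP; [apply: h4|apply: h5].
Qed.

Lemma simpleP M : simple M <-> (0 < fd_dim M)%N /\
  forall U, fdsub M U -> (forall v, U v -> v = 0) \/ (forall v, U v).
Proof.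
split=> -[n0 h]; split=> // U.
  move=> /asub_mx[B /h Bs BP]; case/orP: Bs => [/eqP B0|fB]; [left|right] => v; rewrite BP.
    by rewrite B0 submx0 => /eqP vT; rewrite -[v]trmxK vT trmx0.
  exact: submx_full.
move=> /submoduleP /h [U0|UT]; apply/orP; [left|right].
  apply/eqP/row_matrixP => i; rewrite row0; apply: trmx_inj; rewrite trmx0.
  by apply: U0; rewrite trmxK row_sub.
rewrite -sub1mx; apply/row_subP => i; rewrite -[row i _]trmxK; exact: UT.
Qed.

Lemma fdsub_zero M : fdsub M (fun v => v = 0).
Proof.
split=> [|t x ->|t x ->|t x ->|]; rewrite ?linear0 //.
  by split=> // a x y -> ->; rewrite scaler0 addr0.
by split=> x ->; rewrite linear0.
Qed.

Lemma hw_vector_upto M u v r : hw_vector (M := M) u v ->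
  hw_upto (amod_of M) r u.1 u.2 v.
Proof. by case=> v0 h1 h2 h3; split=> // t /andP[t0 _] /=; apply: h3. Qed.

Lemma hw_weight_neq0 M u v : hw_vector (M := M) u v -> u.1 != 0.
Proof.
case=> v0 _ Kv _; apply: contraNneq v0 => u0.
by have := aKmp (amod_of M) v; rewrite /= Kv u0 scale0r mulmx0 => <-.
Qed.
End Simple.

(** * Simple highest weight modules *)

Section ProductModule.
Variables (K : fieldType) (q Q : K) (V W : lmodType K).

Definition prod_end (f : V -> V) (g : W -> W) (x : V * W) : V * W := (f x.1, g x.2).

Fact prod_end_linear (f : {linear V -> V}) (g : {linear W -> W}) : linear (prod_end f g).
Proof. by move=> a x y; rewrite /prod_end /= !linearP. Qed.

HB.instance Definition _ (f : {linear V -> V}) (g : {linear W -> W}) :=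
  GRing.isLinear.Build K (V * W)%type (V * W)%type _ (prod_end f g) (prod_end_linear f g).

Variables (A : amod q Q V) (B : amod q Q W).

Let pm (f : {linear V -> V}) (g : {linear W -> W}) : {linear (V * W)%type -> (V * W)%type} :=
  prod_end f g.

Lemma cur_rels_prod e e' sg X X' J J' Kp Kp' Km Km' :
  cur_rels q e e' sg X J Kp Km -> cur_rels q e e' sg X' J' Kp' Km' ->
  cur_rels q e e' sg (fun t => pm (X t) (X' t)) (fun t => pm (J t) (J' t)) (pm Kp Kp') (pm Km Km').
Proof.
case=> h1 h2 h3 h4 [k1 k2 k3 k4]; split=> [t s v|t v|t v|s t v].
- exact: (congr2 pair (h1 t s v.1) (k1 t s v.2)).
- exact: (congr2 pair (h2 t v.1) (k2 t v.2)).
- exact: (congr2 pair (h3 t v.1) (k3 t v.2)).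
- exact: (congr2 pair (h4 s t v.1) (k4 s t v.2)).
Qed.

Definition amod_prod : amod q Q (V * W)%type.
Proof.
refine (@AMod _ q Q _ (fun t => pm (aXp A t) (aXp B t)) (fun t => pm (aXm A t) (aXm B t))
  (fun t => pm (aJ A t) (aJ B t)) (pm (aKp A) (aKp B)) (pm (aKm A) (aKm B)) _ _ _ _ _ _ _ _).
- by move=> t v; apply: (congr2 pair); apply: aKJ.
- by move=> s t v; apply: (congr2 pair); apply: aJJ.
- by move=> v; rewrite [RHS]surjective_pairing; apply: (congr2 pair); apply: aKpm.
- by move=> v; rewrite [RHS]surjective_pairing; apply: (congr2 pair); apply: aKmp.
- by move=> v; apply: (congr2 pair); apply: aKK.
- exact: cur_rels_prod (aXpR A) (aXpR B).
- exact: cur_rels_prod (aXmR A) (aXmR B).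
- by move=> t s v; apply: (congr2 pair); apply: aXX.
Defined.

Lemma hw_upto_prod r l u v w :
  hw_upto A r l u v -> hw_upto B r l u w -> hw_upto amod_prod r l u (v, w).
Proof.
case=> h1 h2 h3 [k1 k2 k3]; split=> [t||t ht]; rewrite /= /pm /prod_end /=.
- by rewrite h1 k1.
- by rewrite h2 k2.
- by rewrite h3 ?k3.
Qed.
End ProductModule.

Section HighestWeight.
Variables (C : closedFieldType) (q Q : C).
Hypotheses (q0 : q != 0) (q_nru : not_root_of_unity q).
Implicit Type M N : fdmod q Q.

Notation fdsub M := (@asub C C idfun q Q _ (amod_of M)).
Notation gen A v := (@word_span C C idfun q Q _ A v).

Let q_unit : q \is a GRing.unit. Proof. by rewrite unitfE. Qed.

Lemma qqV_neq0 : q - q^-1 != 0.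
Proof.
have := q_nru (n := 2) isT; apply: contraNneq => /eqP; rewrite subr_eq0 => /eqP qV.
by rewrite expr2 {1}qV mulVf.
Qed.
Let c_unit : q - q^-1 \is a GRing.unit. Proof. by rewrite unitfE qqV_neq0. Qed.

Let rid : {rmorphism C -> C} := idfun.
Let hw_id (V : lmodType C) (A : amod q Q V) l u v (hw : forall r, hw_upto A r l u v) r :
  @hw_upto C (rid q) (rid Q) V A r (rid l) (rid \o u) v := hw r.

Lemma gen_asub (V : lmodType C) (A : amod q Q V) l u v : l != 0 ->
  (forall r, hw_upto A r l u v) -> asub idfun A (gen A v).
Proof.
move=> l0 hw; have l_unit : l \is a GRing.unit by rewrite unitfE.
split=> [|t x|t x|t x|].
- split=> [|a x y gx gy]; first by rewrite -(scale0r v); apply: (word_spanZ 0); apply: word_span0.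
  by apply: word_spanD gy; apply: word_spanZ.
- exact: (word_span_Xp q_unit c_unit l_unit (hw_id hw)).
- exact: word_span_Xm.
- exact: (word_span_J q_unit c_unit l_unit (hw_id hw)).
split=> x; first exact: (word_span_Kp q_unit (hw_id hw)).
exact: (word_span_Km q_unit l_unit (hw_id hw)).
Qed.

(** The weight of [v] is reached only by words of length 0, which are multiples of [v]. *)
Lemma gen_top (V : lmodType C) (A : amod q Q V) l u v x : l != 0 ->
  (forall r, hw_upto A r l u v) -> gen A v x -> aKp A x = l *: x -> exists a, x = a *: v.
Proof.
move=> l0 hw gx Kx; have [->|x0] := eqVneq x 0; first by exists 0; rewrite scale0r.
have l_unit : l \is a GRing.unit by rewrite unitfE.
have [j [d [lE w]]] := word_span_eigen q_unit l_unit (hw_id hw) q_nru gx Kx x0.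
have : idfun (word_wt q l 0) = idfun (word_wt q l j).
  by rewrite -lE /= /word_wt muln0 expr0 invr1 mulr1.
move=> /(word_wt_inj (rho := idfun) q_unit l_unit q_nru) jE; rewrite -jE in w.
by have [a ->] := words0P w; exists a.
Qed.

Lemma simple_gen M u v x : simple M -> hw_vector (M := M) u v -> gen (amod_of M) v x.
Proof.
move=> /simpleP[_ Ms] hv.
have := gen_asub (hw_weight_neq0 hv) (fun r => hw_vector_upto r hv).
case/Ms=> // g0; have [vn0 _ _ _] := hv.
by case/eqP: vn0; apply: g0; apply: word_span0.
Qed.

(** Each of the two K^+-weights is the other one times some q^(-2j), so they coincide; the two
    vectors then lie on the same line and have the same J_t-eigenvalues. *)
Lemma hw_unique M u u' v v' : simple M -> hw_vector (M := M) u v -> hw_vector (M := M) u' v' ->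
  u.1 = u'.1 /\ forall t, (0 < t)%N -> u.2 t = u'.2 t.
Proof.
move=> Ms hv hv'.
have level u1 u2 v1 v2 : hw_vector (M := M) u1 v1 -> hw_vector (M := M) u2 v2 ->
    exists j, u2.1 = word_wt q u1.1 j.
  move=> h1 h2; have [v20 _ K2 _] := h2.
  have l_unit : u1.1 \is a GRing.unit by rewrite unitfE (hw_weight_neq0 h1).
  have [j [d [-> _]]] := word_span_eigen q_unit l_unit (hw_id (fun r => hw_vector_upto r h1))
    q_nru (simple_gen v2 Ms h1) K2 v20.
  by exists j.
have [j jE] := level _ _ _ _ hv hv'; have [i iE] := level _ _ _ _ hv' hv.
have ul : u.1 != 0 := hw_weight_neq0 hv.
have ij0 : (i + j = 0)%N.
  apply/eqP; apply: contraT; rewrite -lt0n => ij.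
  have /(q_nru (n := _)) : (0 < 2 * (i + j))%N by rewrite muln_gt0.
  move/eqP; case; move: iE; rewrite jE /word_wt -mulrA -invfM -exprD -mulnDr addnC => uE.
  by apply: (mulfI ul); rewrite {1}uE mulr1 divfK // expf_neq0.
move/eqP: ij0; rewrite addn_eq0 => /andP[_ /eqP j0].
have uE : u'.1 = u.1 by rewrite jE j0 /word_wt muln0 expr0 invr1 mulr1.
split=> // t t0; have [v'0 _ K' J'] := hv'.
have [|a v'E] := gen_top ul (fun r => hw_vector_upto r hv) (simple_gen v' Ms hv) (x := v').
  by rewrite /= K' uE.
have [_ _ _ J] := hv.
have := J' t t0; rewrite v'E -scalemxAr J // !scalerA mulrC => /eqP.
rewrite -subr_eq0 -scalerBl -mulrBl -scalerA -v'E scaler_eq0 (negPf v'0) orbF subr_eq0.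
by move/eqP.
Qed.

Lemma iso_hw M N u v : iso M N -> hw_vector (M := M) u v -> exists w, hw_vector (M := N) u w.
Proof.
case=> P [/andP[Pf Pl] [h1 h2] h3 h4 h5] [v0 vX vK vJ]; exists (P *m v); split=> [|t||t t0].
- apply: contraNneq v0 => Pv; have /row_fullP[B BP] := Pl.
  by rewrite -[v]mul1mx -BP -mulmxA Pv mulmx0.
- by rewrite mulmxA -h1 -mulmxA vX mulmx0.
- by rewrite mulmxA -h4 -mulmxA vK scalemxAr.
- by rewrite mulmxA -h3 -mulmxA vJ // scalemxAr.
Qed.

Section Uniqueness.
Variables (M N : fdmod q Q) (u : C * (nat -> C)).
Variables (v : 'cV[C]_(fd_dim M)) (w : 'cV[C]_(fd_dim N)).
Hypotheses (Ms : simple M) (Ns : simple N).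
Hypotheses (hv : hw_vector (M := M) u v) (hw : hw_vector (M := N) u w).

Let graph x y := gen (amod_prod (amod_of M) (amod_of N)) (v, w) (x, y).
Let graph_asub := gen_asub (hw_weight_neq0 hv)
  (fun r => hw_upto_prod (hw_vector_upto r hv) (hw_vector_upto r hw)).

Let graph_top x y : graph x y -> aKp (amod_of M) x = u.1 *: x -> aKp (amod_of N) y = u.1 *: y ->
  exists a, x = a *: v /\ y = a *: w.
Proof.
move=> g Kx Ky.
have [|a [-> ->]] := gen_top (hw_weight_neq0 hv)
  (fun r => hw_upto_prod (hw_vector_upto r hv) (hw_vector_upto r hw)) g.
  exact: (congr2 pair Kx Ky).
by exists a.
Qed.

Let graph_lin a x y x' y' : graph x y -> graph x' y' -> graph (a *: x + x') (a *: y + y').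
Proof. by have [[_ h] _ _ _ _] := graph_asub; apply: h. Qed.

(** The domain of the relation is a submodule of M containing [v], hence all of M. *)
Let graph_dom x : exists y, graph x y.
Proof.
have [vn0 _ _ _] := hv.
have /simpleP[_ /(_ (fun x => exists y, graph x y))] := Ms; case=> // [|h]; last first.
  by case/eqP: vn0; apply: h; exists w; apply: word_span0.
have [[h0 hD] h1 h2 h3 [h4 h5]] := graph_asub.
split=> [|t x' [y g]|t x' [y g]|t x' [y g]|].
- split=> [|a x1 x2 [y1 g1] [y2 g2]]; first by exists 0.
  by exists (a *: y1 + y2); apply: graph_lin.
- by exists (aXp (amod_of N) t y); apply: (h1 t _ g).
- by exists (aXm (amod_of N) t y); apply: (h2 t _ g).
- by exists (aJ (amod_of N) t y); apply: (h3 t _ g).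
split=> x' [y g]; first by exists (aKp (amod_of N) y); apply: (h4 _ g).
by exists (aKm (amod_of N) y); apply: (h5 _ g).
Qed.

Let graph_cod y : exists x, graph x y.
Proof.
have [wn0 _ _ _] := hw.
have /simpleP[_ /(_ (fun y => exists x, graph x y))] := Ns; case=> // [|h]; last first.
  by case/eqP: wn0; apply: h; exists v; apply: word_span0.
have [[h0 hD] h1 h2 h3 [h4 h5]] := graph_asub.
split=> [|t y' [x g]|t y' [x g]|t y' [x g]|].
- split=> [|a y1 y2 [x1 g1] [x2 g2]]; first by exists 0.
  by exists (a *: x1 + x2); apply: graph_lin.
- by exists (aXp (amod_of M) t x); apply: (h1 t _ g).
- by exists (aXm (amod_of M) t x); apply: (h2 t _ g).
- by exists (aJ (amod_of M) t x); apply: (h3 t _ g).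
split=> y' [x g]; first by exists (aKp (amod_of M) x); apply: (h4 _ g).
by exists (aKm (amod_of M) x); apply: (h5 _ g).
Qed.

(** The [y] related to 0 form a submodule of N. Were it all of N, (0, w) would belong to the top
    weight line, spanned by (v, w). *)
Let graph0r y : graph 0 y -> y = 0.
Proof.
move: y; have /simpleP[_ /(_ (graph 0))] := Ns; case=> // [|h].
  have [[h0 hD] h1 h2 h3 [h4 h5]] := graph_asub.
  split=> [|t y g|t y g|t y g|].
  - split=> // a x y gx gy; have := graph_lin a gx gy; by rewrite scaler0 addr0.
  - by rewrite -(linear0 (aXp (amod_of M) t)); apply: (h1 t _ g).
  - by rewrite -(linear0 (aXm (amod_of M) t)); apply: (h2 t _ g).
  - by rewrite -(linear0 (aJ (amod_of M) t)); apply: (h3 t _ g).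
  split=> y g; first by rewrite -(linear0 (aKp (amod_of M))); apply: (h4 _ g).
  by rewrite -(linear0 (aKm (amod_of M))); apply: (h5 _ g).
have [vn0 _ _ _] := hv; have [wn0 _ Kw _] := hw.
have [||a [/esym/eqP a0 wE]] := graph_top (h w); rewrite ?linear0 ?scaler0 //.
case/eqP: wn0; rewrite wE; move: a0; rewrite scaler_eq0 (negPf vn0) orbF => /eqP ->.
by rewrite scale0r.
Qed.

Let graph0l x : graph x 0 -> x = 0.
Proof.
move: x; have /simpleP[_ /(_ (graph^~ 0))] := Ms; case=> // [|h].
  have [[h0 hD] h1 h2 h3 [h4 h5]] := graph_asub.
  split=> [|t x g|t x g|t x g|].
  - split=> // a x y gx gy; have := graph_lin a gx gy; by rewrite scaler0 addr0.
  - by rewrite -(linear0 (aXp (amod_of N) t)); apply: (h1 t _ g).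
  - by rewrite -(linear0 (aXm (amod_of N) t)); apply: (h2 t _ g).
  - by rewrite -(linear0 (aJ (amod_of N) t)); apply: (h3 t _ g).
  split=> x g; first by rewrite -(linear0 (aKp (amod_of N))); apply: (h4 _ g).
  by rewrite -(linear0 (aKm (amod_of N))); apply: (h5 _ g).
have [vn0 _ Kv _] := hv; have [wn0 _ _ _] := hw.
have [||a [vE /esym/eqP a0]] := graph_top (h v); rewrite ?linear0 ?scaler0 //.
case/eqP: vn0; rewrite vE; move: a0; rewrite scaler_eq0 (negPf wn0) orbF => /eqP ->.
by rewrite scale0r.
Qed.

Let graph_fun x y y' : graph x y -> graph x y' -> y = y'.
Proof.
move=> g g'; have := graph_lin (-1) g' g; rewrite !scaleN1r addNr => /graph0r/eqP.
by rewrite addrC subr_eq0 => /eqP.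
Qed.

Let graph_inj x x' y : graph x y -> graph x' y -> x = x'.
Proof.
move=> g g'; have := graph_lin (-1) g' g; rewrite !scaleN1r addNr => /graph0l/eqP.
by rewrite addrC subr_eq0 => /eqP.
Qed.

Lemma hw_iso : iso M N.
Proof.
have [f fP] := choice graph_dom; have [g gP] := choice graph_cod.
have [[h0 hD] h1 h2 h3 [h4 h5]] := graph_asub.
have gsum n (I : seq 'I_n) (c : 'I_n -> C) x y : (forall i, graph (x i) (y i)) ->
    graph (\sum_(i <- I) c i *: x i) (\sum_(i <- I) c i *: y i).
  move=> xy; elim: I => [|i I IH]; first by rewrite !big_nil.
  by rewrite !big_cons; apply: graph_lin.
pose P := \matrix_(i, j) f (delta_mx j 0) i 0 : 'M[C]_(fd_dim N, fd_dim M).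
pose P' := \matrix_(i, j) g (delta_mx j 0) i 0 : 'M[C]_(fd_dim M, fd_dim N).
have mxE' m n (F : 'cV[C]_n -> 'cV[C]_m) (x : 'cV[C]_n) :
    \matrix_(i, j) F (delta_mx j 0) i 0 *m x = \sum_j x j 0 *: F (delta_mx j 0).
  apply/colP => i; rewrite !mxE summxE; apply: eq_bigr => j _.
  by rewrite !mxE mulrC.
have cVE n (x : 'cV[C]_n) : x = \sum_j x j 0 *: delta_mx j 0.
  by rewrite {1}[x]matrix_sum_delta; apply: eq_bigr => i _; rewrite big_ord1.
(* [f] is a mere choice on basis vectors; the graph being a subspace, P x is related to x for every
   x, which turns all remaining claims into single-valuedness of the graph. *)
have PP x : graph x (P *m x) by rewrite {1}[x]cVE mxE'; apply: gsum.
have PP' y : graph (P' *m y) y by rewrite {2}[y]cVE mxE'; apply: gsum.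
have ext m n (B D : 'M[C]_(m, n)) : (forall x : 'cV[C]_n, B *m x = D *m x) -> B = D.
  by move=> h; apply/matrixP => i j; have /colP/(_ i) := h (delta_mx j 0); rewrite -!colE !mxE.
have inv1 : P *m P' = 1%:M.
  by apply: ext => x; rewrite -mulmxA mul1mx; apply: graph_fun (PP _) (PP' x).
have inv2 : P' *m P = 1%:M.
  by apply: ext => x; rewrite -mulmxA mul1mx; apply: graph_inj (PP' _) (PP x).
exists P; split.
- by apply/andP; split; [apply/row_freeP; exists P'|apply/row_fullP; exists P'].
- split=> t; apply: ext => x; rewrite -!mulmxA.
    exact: graph_fun (PP _) (h1 t _ (PP x)).
  exact: graph_fun (PP _) (h2 t _ (PP x)).
- by move=> t; apply: ext => x; rewrite -!mulmxA; exact: graph_fun (PP _) (h3 t _ (PP x)).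
- by apply: ext => x; rewrite -!mulmxA; exact: graph_fun (PP _) (h4 _ (PP x)).
- by apply: ext => x; rewrite -!mulmxA; exact: graph_fun (PP _) (h5 _ (PP x)).
Qed.
End Uniqueness.
End HighestWeight.

(** Being a highest weight vector is asked modulo [Z] only. This serves both for passing to
    quotients and for reduction modulo tau. *)
Lemma realize_hw (C : closedFieldType) (K : fieldType) (iota : {rmorphism C -> K}) (q Q : C)
    (V : lmodType K) (A : amod (iota q) (iota Q) V) (Y Z : V -> Prop) n u v :
  asub iota A Y -> asub iota A Z -> dep_mod iota Y Z n.+1 ->
  Y v -> ~ Z v -> (forall t, Z (aXp A t v)) -> Z (aKp A v - iota u.1 *: v) ->
  (forall t, (0 < t)%N -> Z (aJ A t v - iota (u.2 t) *: v)) ->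
  exists (M : fdmod q Q) pi, [/\ (fd_dim M <= n)%N, realizes A Y Z (M := M) pi
    & hw_vector (M := M) u (pi v)].
Proof.
move=> YY ZZ dep Yv nZv hX hK hJ; have [M [pi [leM rM]]] := realize YY ZZ dep.
have [piL _ pi0 [piXp _] [piJ piKp _]] := rM.
have [_ YXp _ YJ [YKp _]] := YY.
have piE x a : Y x -> Z (x - iota a *: v) -> pi x = a *: pi v.
  move=> Yx Zx; have Yd : Y (x - iota a *: v) by apply: asubB YY Yx (asubZ _ YY Yv).
  have := piL a _ _ Yv Yd; rewrite addrCA subrr addr0 => ->.
  by rewrite (pi0 _ Yd).2 ?addr0.
exists M, pi; split=> //; split=> [|t||t t0].
- by apply/eqP => /pi0 - /(_ Yv).
- by rewrite -piXp //; apply/pi0 => //; apply: YXp.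
- by rewrite -piKp //; apply: piE => //; apply: YKp.
- by rewrite -piJ //; apply: piE; [apply: YJ|apply: hJ].
Qed.

Lemma family_dep (F : fieldType) m n (s : 'I_m -> 'cV[F]_n) : (n < m)%N ->
  exists a : 'I_m -> F, (exists i, a i != 0) /\ \sum_i a i *: s i = 0.
Proof.
move=> ltnm; pose B := \matrix_(i, j) s i j 0.
have /rowV0Pn[y /sub_kermxP yB y0] : kermx B != 0.
  rewrite kermx_eq0 /row_free; apply: contraTneq ltnm => <-.
  by rewrite -leqNgt rank_leq_col.
exists (fun i => y 0 i); split; first by apply/existsP; apply: contraR y0 => /existsPn h;
  apply/eqP/rowP => i; move: (h i); rewrite negbK mxE => /eqP.
apply/colP => j; have /rowP/(_ j) := yB; rewrite !mxE summxE => {2}<-.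
by apply: eq_bigr => i _; rewrite !mxE.
Qed.

Lemma family_dep_or_span (F : fieldType) n (s : 'I_n -> 'cV[F]_n) :
  (exists a : 'I_n -> F, (exists i, a i != 0) /\ \sum_i a i *: s i = 0) \/
  (forall x, exists a : 'I_n -> F, x = \sum_i a i *: s i).
Proof.
pose B := \matrix_(i, j) s i j 0.
have BE (y : 'rV_n) : (y *m B)^T = \sum_i y 0 i *: s i.
  by apply/colP => j; rewrite !mxE summxE; apply: eq_bigr => i _; rewrite !mxE.
have [k0|/rowV0Pn[y /sub_kermxP yB y0]] := eqVneq (kermx B) 0.
  right=> x; exists (fun i => (x^T *m invmx B) 0 i); rewrite -BE.
  by rewrite mulmxKV ?trmxK // -row_free_unit -kermx_eq0 k0.
left; exists (fun i => y 0 i); rewrite -BE yB trmx0; split=> //.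
by apply/existsP; apply: contraR y0 => /existsPn h;
  apply/eqP/rowP => i; move: (h i); rewrite negbK mxE => /eqP.
Qed.

Lemma iter_prod_end (K : fieldType) (V W : lmodType K) (f : V -> V) (g : W -> W) r x y :
  iter r (prod_end f g) (x, y) = (iter r f x, iter r g y).
Proof. by elim: r => //= r ->. Qed.

(** * Simple quotients, highest weight vectors, and the test E^r F^r *)

Section Existence.
Variables (C : closedFieldType) (q Q : C).
Hypotheses (q0 : q != 0) (q_nru : not_root_of_unity q).
Implicit Type M N : fdmod q Q.
Notation fdsub M := (@asub C C idfun q Q _ (amod_of M)).

(** A module of least dimension having a highest weight vector [w] of weight u is simple: a
    nontrivial submodule U gives a smaller such module, namely U if it contains [w] and the quotient
    by U otherwise. *)
Lemma simple_of_hw M u v : hw_vector (M := M) u v -> exists N : fdmod q Q, is_L N u.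
Proof.
move=> hv.
pose P d := `[< exists N : fdmod q Q, fd_dim N = d /\ exists w, hw_vector (M := N) u w >].
have exP : exists d, P d by exists (fd_dim M); apply/asboolP; exists M; split; last exists v.
have [d /asboolP[N [<- [w hw]]] dmin] := ex_minnP exP; exists N; split; last by exists w.
have [wn0 _ _ _] := hw.
have N0 : (0 < fd_dim N)%N.
  rewrite lt0n; apply: contraNneq wn0 => d0; apply/eqP/colP => -[i hi].
  by exfalso; move: hi; rewrite d0.
have red (Y Z : 'cV_(fd_dim N) -> Prop) : fdsub N Y -> fdsub N Z ->
    Y w -> ~ Z w -> dep_mod (idfun : {rmorphism C -> C}) Y Z (fd_dim N) -> False.
  move=> YY ZZ Yw Zw dep.
  have [n dE] : exists n, fd_dim N = n.+1 by exists (fd_dim N).-1; rewrite prednK.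
  have dep' : dep_mod (idfun : {rmorphism C -> C}) Y Z n.+1 by rewrite -dE.
  have Z0 : Z 0 by case: ZZ => -[].
  have [_ wX wK wJ] := hw.
  have hX t : Z (aXp (amod_of N) t w) by rewrite /= wX.
  have hK : Z (aKp (amod_of N) w - u.1 *: w) by rewrite /= wK subrr.
  have hJ t : (0 < t)%N -> Z (aJ (amod_of N) t w - u.2 t *: w).
    by move=> t0; rewrite /= wJ // subrr.
  have [N' [pi [leN' _ hw']]] :=
    realize_hw (u := u) YY ZZ dep' Yw Zw hX hK hJ.
  have /dmin : P (fd_dim N') by apply/asboolP; exists N'; split; last exists (pi w).
  by rewrite dE leqNgt ltnS leN'.
apply/simpleP; split=> // U UU; have [Uw|nUw] := pselect (U w); last first.
  left=> x Ux; apply: contrapT => /eqP x0; apply: (red (fun=> True) U) => // s _.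
  (* As many vectors as the dimension are either dependent or span; in the second case the
     expression of the nonzero [x] of U is a nontrivial relation modulo U. *)
  have [[a [ai aE]]|/(_ x)[a aE]] := family_dep_or_span s; exists a; split=> //=.
  - by rewrite aE; case: UU => -[].
  - apply: contrapT => /forallNP h; case/eqP: x0; rewrite aE big1 // => i _.
    by move/negP: (h i); rewrite negbK => /eqP ->; rewrite scale0r.
  - by rewrite -aE.
right=> x; apply: contrapT => nUx.
apply: (red U (fun v => v = 0)) => // [|/eqP|s sU]; first exact: fdsub_zero.
- by rewrite (negPf wn0).
have [//|/(_ x)[a aE]] := family_dep_or_span s.
case: nUx; rewrite aE; exact: (asub_sum (iota := idfun) a UU sU).
Qed.


Lemma exists_eigenvalue n (A : 'M[C]_n) : (0 < n)%N -> exists a, eigenvalue A a.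
Proof.
move=> n0; have /closed_rootP[a ra] : size (char_poly A) != 1%N.
  by rewrite size_char_poly; case: n n0 {A}.
by exists a; rewrite eigenvalue_root_char.
Qed.

Lemma eigenvalue_colP n (A : 'M[C]_n) a : eigenvalue A^T a <->
  exists2 v : 'cV_n, v != 0 & A *m v = a *: v.
Proof.
split.
  move=> /eigenvalueP[v va v0]; exists v^T; first by rewrite trmx_eq0.
  by rewrite -[A]trmxK -trmx_mul va linearZ.
case=> v v0 va; apply/eigenvalueP; exists v^T; last by rewrite trmx_eq0.
by rewrite -trmx_mul va linearZ.
Qed.

(** In a nonzero subspace of [E] stable under all J_t and of least dimension, an eigenspace of one
    J_t is again stable, hence everything: so each of the infinitely many J_t acts there by a
    scalar. *)
Lemma common_eigenvector n (E : 'cV[C]_n -> Prop) (J : nat -> 'M[C]_n) x :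
  E 0 -> (forall a x y, E x -> E y -> E (a *: x + y)) -> E x -> x != 0 ->
  (forall t y, E y -> E (J t *m y)) -> (forall s t, J s *m J t = J t *m J s) ->
  exists v u, [/\ E v, v != 0 & forall t, J t *m v = u t *: v].
Proof.
move=> E0 ED Ex x0 EJ JJ; have [B0 B0E] := subspace_mx E0 ED.
pose inv (B : 'M[C]_n) := (forall v : 'cV_n, (v^T <= B)%MS -> E v) /\ forall t, stable_by B (J t).
pose P d := `[< exists B : 'M[C]_n, inv B /\ \rank B = d /\ (0 < d)%N >].
have exP : exists d, P d.
  exists (\rank B0); apply/asboolP; exists B0; split.
    by split=> [v /B0E//|t]; apply/stable_byP => v /B0E Ev; apply/B0E/EJ.
  by split=> //; rewrite lt0n mxrank_eq0; apply: contraNneq x0 => B00; move/B0E: Ex;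
    rewrite B00 submx0 trmx_eq0.
have [d /asboolP[B [[BE BJ] [<- rB]]] dmin] := ex_minnP exP.
have scal t : exists a, forall v : 'cV_n, (v^T <= B)%MS -> J t *m v = a *: v.
  (* [D] is the matrix of J_t restricted to the row space of [B], in the basis [b]. *)
  pose b := row_base B; pose D := b *m (J t)^T *m pinvmx b.
  have bJ : b *m (J t)^T = D *m b.
    rewrite mulmxKpV // /b (eqmxMr _ (eq_row_base B)) eq_row_base; exact: BJ.
  have [a /eigenvalueP[y yD y0]] := exists_eigenvalue D rB; exists a.
  pose U := (B :&: kermx ((J t)^T - a%:M))%MS.
  have inU (v : 'cV_n) : (v^T <= U)%MS <-> (v^T <= B)%MS /\ J t *m v = a *: v.
    rewrite sub_capmx; split=> [/andP[-> /sub_kermxP]|[-> va]].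
      rewrite mulmxBr mul_mx_scalar -trmx_mul -linearZ -linearB /= => /eqP.
      by rewrite trmx_eq0 subr_eq0 => /eqP.
    apply/sub_kermxP; rewrite mulmxBr mul_mx_scalar -trmx_mul va linearZ /=.
    by rewrite subrr.
  have rU : (0 < \rank U)%N.
    rewrite lt0n mxrank_eq0; apply/rowV0Pn; exists (y *m b).
      rewrite -[y *m b]trmxK; apply/inU; rewrite trmxK; split.
        by apply: submx_trans (submxMl _ _) _; rewrite eq_row_base.
      by rewrite -[J t]trmxK -trmx_mul -mulmxA bJ mulmxA yD -scalemxAl linearZ.
    apply: contraNneq y0 => yb; rewrite -(inj_eq (row_free_inj (row_base_free B))) .
    by rewrite yb mul0mx.
  have /dmin : P (\rank U).
    apply/asboolP; exists U; split=> //; split=> [v /inU[/BE]//|s].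
    apply/stable_byP => v /inU[vB va]; apply/inU; split.
      exact: (elimT (stable_byP B (J s)) (BJ s)).
    by rewrite mulmxA -JJ -mulmxA va scalemxAr.
  have UB : (U <= B)%MS by apply: capmxSl.
  rewrite (geq_leqif (mxrank_leqif_sup UB)) => BU v vB.
  by have /inU[] := submx_trans vB BU.
have [u uP] := choice scal.
have /rowV0Pn[v vB v0] : B != 0 by rewrite -mxrank_eq0 -lt0n.
exists v^T, u; split; [|by rewrite trmx_eq0|by move=> t; apply: uP; rewrite trmxK].
by apply: BE; rewrite trmxK.
Qed.

(** X^+_t multiplies K^+-eigenvalues by q^2, and K^+ has finitely many of them. X^+_t therefore
    kills the eigenspace at the end of a chain l0 q^(2j), where the commuting J_t have a common
    eigenvector. *)
Lemma exists_hw_vector M : (0 < fd_dim M)%N -> exists u v, hw_vector (M := M) u v.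
Proof.
move=> n0; set K := fd_Kp M.
have [l0 El0] : exists l0, eigenvalue K^T l0 by apply: exists_eigenvalue.
have l00 : l0 != 0.
  have /eigenvalue_colP[v v0 vl] := El0; apply: contraNneq v0 => l00.
  by have := aKmp (amod_of M) v; rewrite /= vl l00 scale0r mulmx0 => <-.
have [j [Ej nEj]] : exists j, eigenvalue K^T (l0 * q ^+ (2 * j)) /\
    ~~ eigenvalue K^T (l0 * q ^+ (2 * j.+1)).
  apply: contrapT => h.
  have all_E j : eigenvalue K^T (l0 * q ^+ (2 * j)).
    elim: j => [|j IH]; first by rewrite muln0 mulr1.
    by apply: contraT => nE; case: h; exists j.
  pose rs := [seq l0 * q ^+ (2 * i) | i <- iota 0 (fd_dim M).+1].
  have p0 : char_poly K^T != 0 by rewrite -size_poly_eq0 size_char_poly.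
  have rs_root : all (root (char_poly K^T)) rs.
    by apply/allP => _ /mapP[i _ ->]; rewrite -eigenvalue_root_char.
  suff rs_uniq : uniq rs.
    by have := max_poly_roots p0 rs_root rs_uniq;
      rewrite size_char_poly size_map size_iota ltnn.
  rewrite map_inj_uniq ?iota_uniq //.
  suff ne i k : (i < k)%N -> q ^+ (2 * i) != q ^+ (2 * k).
    move=> i k /(mulfI l00) e; case: (ltngtP i k) => // /ne; first by rewrite e eqxx.
    by rewrite e eqxx.
  move=> ik; rewrite -(subnK (ltnW ik)) mulnDr exprD -subr_eq0 -[X in X - _]mul1r -mulrBl.
  rewrite mulf_eq0 expf_eq0 (negPf q0) andbF orbF subr_eq0 eq_sym.
  by apply: q_nru; rewrite muln_gt0 subn_gt0.
set l := l0 * _ in Ej.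
have /eigenvalue_colP[x x0 xl] := Ej.
have [[h1 h2 _ _ _] [_ hX _ _] _ _] := fd_ax M.
have [|a y z ay az|t y yl|v [u [vl v0 vu]]] :=
    @common_eigenvector _ (fun v => K *m v = l *: v) (fd_J M) x _ _ xl x0 _ h2.
- by rewrite mulmx0 scaler0.
- by rewrite linearP /= ay az scalerDr !scalerA mulrC.
- by rewrite mulmxA h1 -mulmxA yl scalemxAr.
exists (l, u), v; split=> // t; apply/eqP; apply: contraNT nEj => Xv.
apply/eigenvalue_colP; exists (fd_Xp M t *m v) => //.
have e : K *m (fd_Xp M t *m v) = q ^+ 2 *: (fd_Xp M t *m (K *m v)).
  have := congr1 (fun B => B *m (K *m v)) (hX t).
  rewrite -!mulmxA; have -> : fd_Km M *m (K *m v) = v by apply: (aKmp (amod_of M)).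
  by move=> ->; rewrite -scalemxAl.
rewrite e vl -scalemxAr scalerA; congr (_ *: _).
by rewrite /l mulnS exprD mulrCA mulrA.
Qed.

(** The r + 1 vectors F^j v with j <= r are dependent but have distinct K^+-weights, so one of them
    vanishes. *)
Lemma iter_Xm_eq0 M u v r : hw_vector (M := M) u v -> (fd_dim M <= r)%N ->
  iter r (mulmx (fd_Xm M 0)) v = 0.
Proof.
move=> hv ler; pose z j := iter j (mulmx (fd_Xm M 0)) v.
have q_unit : q \is a GRing.unit by rewrite unitfE.
have l_unit : u.1 \is a GRing.unit by rewrite unitfE (hw_weight_neq0 hv).
pose rid : {rmorphism C -> C} := idfun.
have hw : @hw_upto C (rid q) (rid Q) _ (amod_of M) 0 (rid u.1) (rid \o u.2) v.
  exact: hw_vector_upto hv.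
have zw j : @words C C rid q Q _ (amod_of M) v j 0 (z j).
  elim: j => [|j IH]; first by have := words0 (rho := rid) (amod_of M) v 0 1; rewrite rmorph1 scale1r.
  exact: (wordsX IH).
have [a [[i ai] a0]] := family_dep (fun i : 'I_r.+1 => z i) ler.
pose b j : C := if insub j is Some i then a i else 0.
have bE (k : 'I_r.+1) : b k = a k by rewrite /b valK.
have zi0 : a i *: z i = 0.
  rewrite -bE; apply: (@eigen_sum_eq0 _ _ (aKp (amod_of M)) _
    (word_wt_inj (rho := rid) q_unit l_unit q_nru) r.+1 (fun j => b j *: z j)) => // [j|].
    by rewrite linearZ /= (words_Kp q_unit hw (zw j)) !scalerA mulrC.
  by rewrite -[RHS]a0; apply: eq_bigr => k _; rewrite bE.
move/eqP: zi0; rewrite scaler_eq0 (negPf ai) /= => /eqP zi0.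
have lei : (i <= r)%N by rewrite -ltnS.
rewrite -(subnK lei) iterD -/(z i) zi0.
by elim: (r - i)%N => //= k ->; rewrite mulmx0.
Qed.

(* With E = X^+_0 and F = X^-_0, [E^r F^r v] is a multiple of [v] that depends only on the highest
   weight up to order r: compare on M x N the words of total index at most r. *)
Lemma iter_Xp_Xm_eq0 M N u u' v w r : hw_vector (M := M) u v -> hw_vector (M := N) u' w ->
  u.1 = u'.1 -> (forall t, (0 < t <= r)%N -> u.2 t = u'.2 t) ->
  iter r (mulmx (fd_Xm M 0)) v = 0 ->
  iter r (mulmx (fd_Xp N 0)) (iter r (mulmx (fd_Xm N 0)) w) = 0.
Proof.
move=> hv hw1 u1 u2 Fv.
have q_unit : q \is a GRing.unit by rewrite unitfE.
have c_unit : q - q^-1 \is a GRing.unit by rewrite unitfE qqV_neq0.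
have l_unit : u.1 \is a GRing.unit by rewrite unitfE (hw_weight_neq0 hv).
pose rid : {rmorphism C -> C} := idfun.
pose A := amod_prod (amod_of M) (amod_of N).
have hw : @hw_upto C (rid q) (rid Q) _ A r (rid u.1) (rid \o u.2) (v, w).
  apply: hw_upto_prod; first exact: hw_vector_upto hv.
  have [h1 h2 h3] := hw_vector_upto r hw1; split=> // [|t ht]; first by rewrite h2 u1.
  by rewrite h3 // -u2.
have wF j : @words C C rid q Q _ A (v, w) j 0 (iter j (aXm A 0) (v, w)).
  elim: j => [|j IH]; first by have := words0 (rho := rid) A (v, w) 0 1; rewrite rmorph1 scale1r.
  exact: (wordsX IH).
(* Each X^+_0 removes one letter and adds at most one to the total index, which thus never exceeds
   r. *)
have wE j : (j <= r)%N ->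
    @words C C rid q Q _ A (v, w) (r - j) j (iter j (aXp A 0) (iter r (aXm A 0) (v, w))).
  elim: j => [|j IH] ltjr; first by rewrite subn0.
  have := words_Xp q_unit c_unit l_unit hw (t := 0) (j := (r - j.+1)%N) (d := j).
  rewrite addn1 -subSn // subSS; apply=> //; exact: IH (ltnW _).
(* The same scalar [a] multiplies [v] and [w]; it is zero because F^r v = 0. *)
have := wE r (leqnn r); rewrite subnn => /words0P[a].
rewrite !iter_prod_end => -[/eqP aE ->].
have [v0 _ _ _] := hv; move: aE; rewrite Fv.
have -> : iter r (mulmx (fd_Xp M 0)) 0 = 0 :> 'cV_(fd_dim M).
  by elim: (r) => //= k ->; rewrite mulmx0.
by rewrite eq_sym scaler_eq0 (negPf v0) orbF => /eqP ->; rewrite scale0r.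
Qed.
End Existence.

(** * Power series *)

Section Series.
Variable R : comNzRingType.
Implicit Types (p N D A B : {poly R}) (m n : nat).

(** Congruence modulo X^m: a power series is handled through its truncations. *)
Definition eqm m p p' : Prop := forall i, (i < m)%N -> p`_i = p'`_i.

Lemma eqm_trans m p2 p1 p3 : eqm m p1 p2 -> eqm m p2 p3 -> eqm m p1 p3.
Proof. by move=> h1 h2 i im; rewrite h1 ?h2. Qed.

Lemma eqm_sym m p1 p2 : eqm m p1 p2 -> eqm m p2 p1.
Proof. by move=> h i im; rewrite h. Qed.

Lemma eqmM m p1 p2 p3 p4 : eqm m p1 p2 -> eqm m p3 p4 -> eqm m (p1 * p3) (p2 * p4).
Proof.
move=> h1 h2 i im; rewrite !coefM; apply: eq_bigr => j _.
by rewrite h1 ?h2 //; apply: leq_ltn_trans im; rewrite ?leq_subr // -ltnS.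
Qed.

Lemma eqmMl m p1 p2 p3 : eqm m p1 p2 -> eqm m (p3 * p1) (p3 * p2).
Proof. exact: eqmM. Qed.

Lemma eqm_le m m' p1 p2 : (m' <= m)%N -> eqm m p1 p2 -> eqm m' p1 p2.
Proof. by move=> h e i im; apply: e; apply: leq_trans h. Qed.

Lemma eqm_all p1 p2 : (forall m, eqm m p1 p2) -> p1 = p2.
Proof. by move=> h; apply/polyP => i; apply: (h i.+1). Qed.

(** The truncated geometric series, inverse of [D] modulo X^m when D(0) = 1. *)
Definition sinv m D := \sum_(j < m) (1 - D) ^+ j.

Lemma sinvP m D : D`_0 = 1 -> eqm m (D * sinv m D) 1.
Proof.
move=> D0; have -> : D * sinv m D = 1 - (1 - D) ^+ m.
  by rewrite -[RHS]opprB subrX1 -/(sinv m D) addrAC subrr sub0r mulNr opprK.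
have [E ->] : exists E, 1 - D = E * 'X.
  have : root (1 - D) 0 by rewrite /root horner_coef0 coefB coef1 D0 subrr.
  by move/factor_theorem => [E ->]; exists E; rewrite polyC0 subr0.
by move=> i im; rewrite coefB exprMn coefMXn im subr0.
Qed.

Lemma eqm_cancel m D A B : D`_0 = 1 -> eqm m (D * A) (D * B) -> eqm m A B.
Proof.
move=> D0 h; have e P : eqm m P (sinv m D * (D * P)).
  by rewrite mulrA (mulrC _ D) => i im; rewrite -{1}[P]mul1r; apply: eqmM im => //;
    apply: eqm_sym; apply: sinvP.
apply: eqm_trans (e A) _; apply: eqm_trans (eqm_sym (e B)).
exact: eqmMl.
Qed.

(* The coefficients of the power series N / D. *)
Definition ser N D n := (N * sinv n.+1 D)`_n.

Lemma ser_sinv N D m : D`_0 = 1 -> eqm m (\poly_(i < m) ser N D i) (N * sinv m D).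
Proof.
move=> D0 i im; rewrite coef_poly im /ser; apply: (@eqmMl i.+1) => //.
apply: (eqm_cancel D0); have h : eqm i.+1 (D * sinv m D) 1 := eqm_le im (sinvP D0).
exact: eqm_trans (sinvP D0) (eqm_sym h).
Qed.

Lemma serP N D m : D`_0 = 1 -> eqm m (D * \poly_(i < m) ser N D i) N.
Proof.
move=> D0; apply: (@eqm_trans _ (D * (N * sinv m D))); first exact: eqmMl _ (ser_sinv _ D0).
by rewrite mulrCA -[X in eqm _ _ X]mulr1; apply: eqmMl; apply: sinvP.
Qed.

Lemma ser_uniq N D (a : nat -> R) r : D`_0 = 1 ->
  (forall m, (m <= r)%N -> eqm m (D * \poly_(i < m) a i) N) -> forall n, (n < r)%N -> a n = ser N D n.
Proof.
move=> D0 h n nr; have := eqm_trans (h _ nr) (eqm_sym (@serP N _ n.+1 D0)).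
by move/(eqm_cancel D0)/(_ n (ltnSn n)); rewrite !coef_poly ltnSn.
Qed.

Lemma coef0_lin (a : R) : (1 - a *: 'X)`_0 = 1.
Proof. by rewrite coefB coef1 coefZ coefX mulr0 subr0. Qed.

Lemma coef_linM (a : R) p i : ((1 - a *: 'X) * p)`_i = p`_i - (if i is j.+1 then a * p`_j else 0).
Proof. by rewrite mulrBl mul1r -scalerAl coefB coefZ coefXM; case: i => //=; rewrite mulr0. Qed.

Definition rev_poly (gs : seq R) : {poly R} := \prod_(g <- gs) (1 - g *: 'X).

Lemma rev_poly0 gs : (rev_poly gs)`_0 = 1.
Proof.
rewrite /rev_poly; elim: gs => [|g gs IH]; first by rewrite big_nil coef1.
by rewrite big_cons coef0M IH coef0_lin mulr1.
Qed.

(* Power series prod (1 - s g z)/(1 - g z) * (1 - t z)/(1 - w z). *)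
Definition hw_num (s t : R) gs := rev_poly (map ( *%R s) gs) * (1 - t *: 'X).
Definition hw_den (w : R) gs := rev_poly gs * (1 - w *: 'X).
Definition hw_ser s t w gs n := ser (hw_num s t gs) (hw_den w gs) n.

Lemma hw_den0 w gs : (hw_den w gs)`_0 = 1.
Proof. by rewrite coef0M rev_poly0 coef0_lin mulr1. Qed.

Lemma hw_num0 s t gs : (hw_num s t gs)`_0 = 1.
Proof. by rewrite coef0M rev_poly0 coef0_lin mulr1. Qed.
End Series.

Section SeriesMorph.
Variables (R S : comNzRingType) (f : {rmorphism R -> S}).

(** The truncated inverse is a polynomial expression in [D], so series coefficients commute with
    every ring morphism; this applies to C[tau] -> C(tau) and to tau = 0. *)
Lemma map_ser N D n : f (ser N D n) = ser (map_poly f N) (map_poly f D) n.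
Proof.
have sE : map_poly f (sinv n.+1 D) = sinv n.+1 (map_poly f D).
  by rewrite rmorph_sum; apply: eq_bigr => i _; rewrite rmorphXn rmorphB rmorph1.
by rewrite /ser -coef_map rmorphM /= sE.
Qed.

Lemma map_lin a : map_poly f (1 - a *: 'X) = 1 - f a *: 'X.
Proof. by rewrite rmorphB rmorph1 /= map_polyZ map_polyX. Qed.

Lemma map_rev_poly gs : map_poly f (rev_poly gs) = rev_poly (map f gs).
Proof. by rewrite /rev_poly rmorph_prod big_map; apply: eq_bigr => g _; apply: map_lin. Qed.

Lemma map_hw_ser s t w gs n : f (hw_ser s t w gs n) = hw_ser (f s) (f t) (f w) (map f gs) n.
Proof.
rewrite /hw_ser map_ser /hw_num /hw_den !rmorphM /= !map_lin !map_rev_poly -!map_comp.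
by congr (ser (rev_poly _ * _) _ _); apply: eq_map => x /=; rewrite rmorphM.
Qed.
End SeriesMorph.

(** * The subset model *)

Section PartialFractions.
Variable K : fieldType.

Lemma prod_lin_top (R : comNzRingType) k (a : 'I_k -> R) :
  let p := \prod_i (1 - a i *: 'X) : {poly R} in (size p <= k.+1)%N /\ p`_k = \prod_i - a i.
Proof.
elim: k a => [|k IH] a /=; first by rewrite !big_ord0 coef1 size_poly1.
rewrite !big_ord_recr /=; have [] := IH (fun i => a (widen_ord (leqnSn k) i)).
set p := \prod_i _; move=> sp pk; split.
  rewrite mulrBr mulr1 -scalerAr (leq_trans (size_polyD _ _)) //.
  rewrite size_polyN geq_max (leq_trans sp) //= (leq_trans (size_scale_leq _ _)) //.
  by rewrite (leq_trans (size_polyMleq _ _)) // size_polyX addn2 ltnS.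
rewrite mulrBr mulr1 -scalerAr coefB coefZ coefMX /= -pk.
by rewrite nth_default // sub0r -mulNr mulrC.
Qed.

Variables (k : nat) (g : 'I_k -> K).
Hypotheses (g_inj : injective g) (g_neq0 : forall i, g i != 0).

Definition pf_res (s : 'I_k -> K) i : K :=
  (1 - s i) * \prod_(l | l != i) ((g i - s l * g l) / (g i - g l)).

(** The coefficients of X^k agree, so the difference has degree below k; it vanishes at the k
    distinct points 1/g_i. *)
Lemma partial_fractions (s : 'I_k -> K) :
  \prod_i (1 - (s i * g i) *: 'X) = (\prod_i s i) *: (\prod_i (1 - g i *: 'X))
    + \sum_i pf_res s i *: \prod_(l | l != i) (1 - g l *: 'X) :> {poly K}.
Proof.
apply/eqP; rewrite -subr_eq0; apply/eqP; set P := _ - _.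
(* The omitted factor is restored as 1 - 0 X: the product still has k factors, and its coefficient
   of order k is visibly 0. *)
have skip i : \prod_(l | l != i) (1 - g l *: 'X)
    = \prod_l (1 - (if l == i then 0 else g l) *: 'X) :> {poly K}.
  rewrite [RHS](bigD1 i) //= eqxx scale0r subr0 mul1r.
  by apply: eq_bigr => l /negbTE ->.
have sizeP : (size P <= k)%N.
  have [s1 c1] := prod_lin_top (fun i => s i * g i).
  have [s2 c2] := prod_lin_top g.
  have s3 i : (size (\prod_(l | l != i) (1 - g l *: 'X) : {poly K})%R <= k.+1)%N
      /\ (\prod_(l | l != i) (1 - g l *: 'X) : {poly K})`_k = 0.
    rewrite skip; have [s3 ->] := prod_lin_top (fun l => if l == i then 0 else g l).
    by split=> //; rewrite (bigD1 i) //= eqxx oppr0 mul0r.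
  have sP : (size P <= k.+1)%N.
    rewrite (leq_trans (size_polyD _ _)) // geq_max s1 size_polyN.
    rewrite (leq_trans (size_polyD _ _)) // geq_max (leq_trans (size_scale_leq _ _)) //.
    apply: (leq_trans (size_sum _ _ _)); apply/bigmax_leqP => i _.
    by rewrite (leq_trans (size_scale_leq _ _)) //; have [] := s3 i.
  have cP : P`_k = 0.
    rewrite coefB coefD coefZ c1 c2 coef_sum [X in _ - (_ + X)]big1 ?addr0; last first.
      by move=> i _; rewrite coefZ (s3 i).2 mulr0.
    by rewrite -big_split /= (eq_bigr (fun i => s i * - g i)) ?subrr // => i _; rewrite mulrN.
  have [P0|P0] := eqVneq P 0; first by rewrite P0 size_poly0.
  rewrite leq_eqVlt in sP; case/orP: sP => // /eqP sP.
  by move/eqP: cP; rewrite -[k]/(k.+1.-1) -sP -lead_coefE lead_coef_eq0 (negPf P0).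
apply/eqP; apply: contraLR sizeP => P0; rewrite -ltnNge.
rewrite -[X in (X < _)%N](size_enum_ord k) -(size_map (fun i => (g i)^-1)).
apply: max_poly_roots => //; last first.
  by rewrite map_inj_uniq ?enum_uniq // => i j /invr_inj /g_inj.
apply/allP => _ /mapP[i _ ->]; apply/rootP.
have lin (a x : K) : (1 - a *: 'X).[x] = 1 - a * x by rewrite !hornerE.
have gV : (1 - g i *: 'X).[(g i)^-1] = 0 by rewrite lin divff ?subrr.
rewrite /P hornerD hornerN !hornerE horner_sum.
rewrite [X in _ * X](_ : _ = 0); last first.
  by rewrite horner_prod (bigD1 i) //= gV mul0r.
rewrite mulr0 add0r [X in _ - X](bigD1 i) //= [X in _ - (_ + X)]big1 ?addr0; last first.
  by move=> j ji; rewrite hornerZ horner_prod (bigD1 i) 1?eq_sym //= gV mul0r mulr0.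
rewrite hornerZ !horner_prod (bigD1 i) //= lin mulfK // /pf_res -mulrA -big_split /=.
apply/eqP; rewrite subr_eq0; apply/eqP; congr (_ * _); apply: eq_bigr => l li.
rewrite !lin; have gil : g i - g l != 0 by rewrite subr_eq0 (inj_eq g_inj) eq_sym.
by field; rewrite gil g_neq0.
Qed.

Lemma sum_pf_res (s : 'I_k -> K) : \sum_i pf_res s i = 1 - \prod_i s i.
Proof.
have := congr1 (fun p : {poly K} => p.[0]) (partial_fractions s).
have val0 (A : pred 'I_k) (a : 'I_k -> K) : (\prod_(i | A i) (1 - a i *: 'X)).[0] = 1.
  by rewrite horner_prod big1 // => i _; rewrite !hornerE ?mulr0 ?subr0.
rewrite hornerD hornerZ horner_sum !val0 mulr1.
under [X in _ = _ + X]eq_bigr => i _ do rewrite hornerZ val0 mulr1.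
by move=> h; apply/eqP; rewrite eq_sym subr_eq addrC; apply/eqP.
Qed.
End PartialFractions.

(* The module with basis the subsets T of the (distinct) roots g_i: X^-_t adds a root i to T
   with weight g_i^t, X^+_t removes one, and J_t is diagonal. *)
Section SubsetModel.
Variables (K : fieldType) (k : nat) (g : 'I_k -> K) (q Q b : K).
Hypotheses (g_inj : injective g) (g_neq0 : forall i, g i != 0).
Hypotheses (q0 : q != 0) (Q0 : Q != 0) (b0 : b != 0) (c0 : q - q^-1 != 0).

Notation V := {ffun {set 'I_k} -> K^o}.
Implicit Types (T : {set 'I_k}) (i j : 'I_k) (f : V).

(** The space consists of functions of T, so [m] runs backwards: X^-, which adds a root to a basis
    subset, evaluates its argument at T with that root removed. *)
Definition edge_op (w : {set 'I_k} -> 'I_k -> K) (m : {set 'I_k} -> 'I_k -> {set 'I_k})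
  (s : nat) f : V := [ffun T => \sum_i g i ^+ s * w T i * f (m T i)].

Definition diag_op (h : {set 'I_k} -> K) f : V := [ffun T => h T * f T].

Let scE (a x : K^o) : a *: x = a * x. Proof. by []. Qed.

Fact edge_op_linear w m s : linear (edge_op w m s).
Proof.
move=> a x y; apply/ffunP => T; rewrite !ffunE scE mulr_sumr -big_split /=.
by apply: eq_bigr => i _; rewrite !ffunE scE mulrDr mulrCA.
Qed.
HB.instance Definition _ w m s := GRing.isLinear.Build K V V _ (edge_op w m s) (edge_op_linear w m s).

Fact diag_op_linear h : linear (diag_op h).
Proof.
by move=> a x y; apply/ffunP => T; rewrite !ffunE !scE mulrDr mulrCA.
Qed.
HB.instance Definition _ h := GRing.isLinear.Build K V V _ (diag_op h) (diag_op_linear h).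

Lemma sum_antisym (H : 'I_k -> 'I_k -> K) : (forall i, H i i = 0) ->
  (forall i j, i != j -> H i j + H j i = 0) -> \sum_i \sum_j H i j = 0.
Proof.
move=> Hd Ha.
have E : \sum_i \sum_j H i j = \sum_(i < k) \sum_(j < k | (i < j)%N) H i j
    + \sum_(i < k) \sum_(j < k | (j < i)%N) H i j.
  rewrite -big_split /=; apply: eq_bigr => i _.
  rewrite (bigID (fun j : 'I_k => (i < j)%N)) /=; congr (_ + _).
  rewrite (bigID (fun j : 'I_k => j == i)) /= big1 ?add0r; last first.
    by move=> j /andP[_ /eqP ->].
  by apply: eq_bigl => j; rewrite -leqNgt ltn_neqAle andbC.
rewrite E (exchange_big_dep xpredT) //= -big_split big1 // => i _ /=.
by rewrite -big_split big1 // => j ij; rewrite /= Ha // neq_ltn ij ?orbT.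
Qed.

(** The quadratic relation has coefficient (g_i^t g_j^s + g_i^s g_j^t) (g_i - e g_j) times the
    weights of the path i, j. The first factor is symmetric, so antisymmetry of the rest in i and j
    suffices; the other relations are checked edge by edge. *)
Lemma edge_rels w m (jj : nat -> {set 'I_k} -> K) kk (e e' sg : K) :
  (forall T, kk T != 0) ->
  (forall T i j, m (m T i) j = m (m T j) i) ->
  (forall T i, w T i * w (m T i) i = 0) ->
  (forall T i j, i != j -> (g i - e * g j) * (w T i * w (m T i) j)
      + (g j - e * g i) * (w T j * w (m T j) i) = 0) ->
  (forall T i, w T i != 0 -> kk T = e * kk (m T i)) ->
  (forall T i, w T i != 0 -> e * jj 0%N T - e' * jj 0%N (m T i)
      = sg * ((q ^+ 2 - q ^- 2) / (q - q^-1))) ->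
  (forall s T i, w T i != 0 -> jj s.+1 T - jj s.+1 (m T i)
      = g i * (e * jj s T - e' * jj s (m T i))) ->
  cur_rels q e e' sg (fun t => edge_op w m t : {linear V -> V})
    (fun t => diag_op (jj t) : {linear V -> V}) (diag_op kk : {linear V -> V})
    (diag_op (fun T => (kk T)^-1) : {linear V -> V}).
Proof.
move=> kk0 mC wii wij wk wj0 wj.
split=> [t s f|t f|t f|s t f]; apply/ffunP => T; rewrite !ffunE ?scE.
- apply/eqP; rewrite -subr_eq0 !mulr_sumr -!sumrB; apply/eqP.
  under eq_bigr => i _.
    rewrite !ffunE !mulr_sumr -!sumrB.
    under eq_bigr => j _.
      rewrite [X in X - _ - _](_ : _ = g i ^+ t.+1 * g j ^+ s * (w T i * w (m T i) j * f (m (m T i) j))); last by ring.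
      over.
    over.
  rewrite /=.
  set H := fun i j => (g i ^+ t * g j ^+ s + g i ^+ s * g j ^+ t)
     * ((g i - e * g j) * (w T i * w (m T i) j)) * f (m (m T i) j).
  rewrite (eq_bigr (fun i => \sum_j H i j)); last first.
    by move=> i _; apply: eq_bigr => j _; rewrite /H !exprS; ring.
  apply: sum_antisym => [i|i j ij]; rewrite /H; first by rewrite wii !mulr0 mul0r.
  rewrite (mC T j i) [g j ^+ t * _ + _]addrC [g j ^+ s * _]mulrC [g j ^+ t * _]mulrC.
  by rewrite -mulrDl -mulrDr wij // mulr0 mul0r.
- rewrite !mulr_sumr; apply: eq_bigr => i _; rewrite !ffunE.
  have [->|wn0] := eqVneq (w T i) 0; first by rewrite !(mulr0, mul0r).
  by rewrite {1}(wk T i wn0); field; rewrite kk0.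
- rewrite !mulr_sumr -sumrB; apply: eq_bigr => i _; rewrite !ffunE.
  have [->|wn0] := eqVneq (w T i) 0; first by rewrite !(mulr0, mul0r) subr0.
  by rewrite -(wj0 T i wn0); ring.
rewrite !mulr_sumr -!sumrB; apply: eq_bigr => i _; rewrite !ffunE.
have [->|wn0] := eqVneq (w T i) 0; first by rewrite !(mulr0, mul0r) !subr0.
transitivity (g i ^+ t * w T i * f (m T i) * (jj s.+1 T - jj s.+1 (m T i))); first by ring.
by rewrite (wj s T i wn0) exprS; ring.
Qed.

(* [sgn_q], [res]: Psi acts on T by prod_i (1 - sgn_q T i g_i z)/(1 - g_i z) times
   (1 - b^-2 z/Q)/(1 - z/Q), and [res T i] is the residue of the first factor at g_i;
   [ser_pi], [ser_psi] are the coefficients of the first factor and of the product. *)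
Definition wt_K T : K := b * q ^+ k * q ^- (2 * #|T|).
Definition sgn_q T i : K := if i \in T then q ^+ 2 else q ^- 2.
Definition res T i : K := pf_res g (sgn_q T) i.
Definition ser_pi T n : K := (if n == 0%N then \prod_i sgn_q T i else 0) + \sum_i res T i * g i ^+ n.
Fixpoint ser_psi T n : K := if n is n'.+1
  then Q^-1 * ser_psi T n' + ser_pi T n - b ^- 2 * Q^-1 * ser_pi T n' else 1.
Definition wt_J n T : K :=
  if n is n'.+1 then ser_psi T n / (q - q^-1) else (1 - wt_K T ^- 2) / (q - q^-1).
(** The product in the residue at g_i is split between the roots in T, given to X^-, and those
    outside T, given to X^+, so that composing the two operators restores the residue. *)
Definition fac_in T i : K := \prod_(l | (l != i) && (l \in T)) ((g i - q ^+ 2 * g l) / (g i - g l)).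
Definition fac_out T i : K := \prod_(l | (l != i) && (l \notin T)) ((g i - q ^- 2 * g l) / (g i - g l)).
Definition w_m T i : K := if i \in T then fac_in T i else 0.
(** The scalar is dictated by the commutator [X^+_t, X^-_s] on the diagonal, see [comm_diag]; q^-1
    stands for (1 - q^-2)/(q - q^-1). *)
Definition w_p T i : K :=
  if i \in T then 0 else wt_K T * q^-1 * (b ^- 2 - Q * g i) * fac_out T i.

Lemma g_neq i j : i != j -> g i - g j != 0.
Proof. by move=> ij; rewrite subr_eq0 (inj_eq g_inj). Qed.

Lemma wt_K_neq0 T : wt_K T != 0.
Proof. by rewrite !mulf_neq0 ?invr_eq0 ?expf_neq0. Qed.

Lemma wt_KD1 T i : i \in T -> wt_K (T :\ i) = q ^+ 2 * wt_K T.
Proof.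
move=> iT; rewrite /wt_K (cardsD1 i T) iT mulnDr exprD invfM mulrCA; congr (_ * _).
by rewrite mulrA divff ?mul1r // expf_neq0.
Qed.

Lemma wt_KU1 T i : i \notin T -> wt_K (i |: T) = q ^- 2 * wt_K T.
Proof.
move=> iT; rewrite -[in RHS](setU1K iT) wt_KD1 ?setU11 //.
by rewrite mulrA mulVf ?mul1r // expf_neq0.
Qed.

Lemma fac_inD1 T i j : i != j -> j \in T ->
  fac_in T i = fac_in (T :\ j) i * ((g i - q ^+ 2 * g j) / (g i - g j)).
Proof.
move=> ij jT; rewrite /fac_in (bigD1 j) /= ?jT ?andbT 1?eq_sym // mulrC; congr (_ * _).
by apply: eq_bigl => l; rewrite !inE andbAC -andbA.
Qed.

Lemma fac_outU1 T i j : i != j -> j \notin T ->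
  fac_out T i = fac_out (j |: T) i * ((g i - q ^- 2 * g j) / (g i - g j)).
Proof.
move=> ij jT; rewrite /fac_out (bigD1 j) /= ?jT ?andbT 1?eq_sym // mulrC; congr (_ * _).
by apply: eq_bigl => l; rewrite !inE negb_or andbAC -andbA.
Qed.

Lemma fac_in_same T i : fac_in (T :\ i) i = fac_in T i.
Proof. by apply: eq_bigl => l; rewrite !inE; case: (l != i). Qed.

Lemma fac_in_sameU T i : fac_in (i |: T) i = fac_in T i.
Proof. by apply: eq_bigl => l; rewrite !inE; case: (l == i). Qed.

Lemma fac_out_same T i : fac_out (T :\ i) i = fac_out T i.
Proof. by apply: eq_bigl => l; rewrite !inE; case: (l == i). Qed.

Lemma resE T i : res T i = (1 - sgn_q T i) * (fac_in T i * fac_out T i).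
Proof.
rewrite /res /pf_res (bigID (mem T)) /=; congr (_ * (_ * _)); apply: eq_bigr => l /andP[_ lT].
  by rewrite /sgn_q lT.
by rewrite /sgn_q (negPf lT).
Qed.

(** Removing i from T changes a single factor of the residue at g_l. The identity is kept free of
    division: either multiplier may vanish, and the case l = i is included. *)
Lemma resD1 T i l : i \in T -> (g l - q ^- 2 * g i) * res T l = (g l - q ^+ 2 * g i) * res (T :\ i) l.
Proof.
move=> iT; rewrite !resE; have [->|li] := eqVneq l i.
  rewrite /sgn_q iT !inE eqxx /= fac_in_same fac_out_same.
  by ring.
rewrite (fac_inD1 li iT).
have -> : fac_out (T :\ i) l = fac_out T l * ((g l - q ^- 2 * g i) / (g l - g i)).
  by rewrite (@fac_outU1 (T :\ i) l i) ?setD1K // !inE eqxx.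
by rewrite /sgn_q !inE li /=; ring.
Qed.

Lemma prod_sgnD1 T i : i \in T -> q ^- 2 * \prod_l sgn_q T l = q ^+ 2 * \prod_l sgn_q (T :\ i) l.
Proof.
move=> iT; rewrite (bigD1 i) //= [in RHS](bigD1 i) //=.
have -> : sgn_q T i = q ^+ 2 by rewrite /sgn_q iT.
have -> : sgn_q (T :\ i) i = q ^- 2 by rewrite /sgn_q !inE eqxx.
rewrite mulrA [RHS]mulrA mulVf ?mulfV ?expf_neq0 // !mul1r; apply: eq_bigr => l li.
by rewrite /sgn_q !inE li.
Qed.

Lemma ser_pi0 T : ser_pi T 0 = 1.
Proof.
rewrite -[RHS](subrK (\prod_i sgn_q T i)) -(sum_pf_res g_inj g_neq0) addrC /ser_pi /=.
by congr (_ + _); apply: eq_bigr => i _; rewrite mulr1.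
Qed.

(** The coefficient of z^(n+1) in (1 - q^-2 g_i z) Pi_T(z) = (1 - q^2 g_i z) Pi_(T - i)(z), where
    Pi_T has coefficients [ser_pi T]. *)
Lemma ser_piD1 T i n : i \in T -> ser_pi T n.+1 - q ^- 2 * g i * ser_pi T n
  = ser_pi (T :\ i) n.+1 - q ^+ 2 * g i * ser_pi (T :\ i) n.
Proof.
move=> iT.
have sE T' c : \sum_l res T' l * g l ^+ n.+1 - c * \sum_l res T' l * g l ^+ n
    = \sum_l (g l - c) * res T' l * g l ^+ n.
  by rewrite mulr_sumr -sumrB; apply: eq_bigr => l _; rewrite exprS; ring.
have hs : \sum_l res T l * g l ^+ n.+1 - q ^- 2 * g i * \sum_l res T l * g l ^+ n
    = \sum_l res (T :\ i) l * g l ^+ n.+1 - q ^+ 2 * g i * \sum_l res (T :\ i) l * g l ^+ n.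
  by rewrite !sE; apply: eq_bigr => l _; rewrite (resD1 l iT).
have h0 := prod_sgnD1 iT; rewrite /ser_pi /= !add0r.
(* Only n = 0 involves the constant of [ser_pi] at order 0, that is, the value of Pi_T at
   infinity. *)
case: n hs {sE} => [|n] hs /=; last by rewrite !add0r.
set S1 := \sum_l _ in hs *; set S0 := \sum_l _ in hs *.
transitivity (S1 - q ^- 2 * g i * S0 - g i * (q ^- 2 * \prod_l sgn_q T l)); first by ring.
by rewrite hs h0; ring.
Qed.

Lemma ser_psiD1 T i n : i \in T -> ser_psi T n.+1 - q ^- 2 * g i * ser_psi T n
  = ser_psi (T :\ i) n.+1 - q ^+ 2 * g i * ser_psi (T :\ i) n.
Proof.
move=> iT; elim: n => [|n IH].
  have h := ser_piD1 0 iT; move: h; rewrite /= !ser_pi0 !mulr1 => h.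
  have -> : ser_pi T 1 = ser_pi (T :\ i) 1 - q ^+ 2 * g i + q ^- 2 * g i.
    by rewrite -h subrK.
  by ring.
have h1 := ser_piD1 n.+1 iT; have h0 := ser_piD1 n iT.
rewrite ![ser_psi _ n.+2]/=; rewrite -/(ser_psi T n.+1) -/(ser_psi (T :\ i) n.+1).
transitivity (Q^-1 * (ser_psi T n.+1 - q ^- 2 * g i * ser_psi T n)
   + (ser_pi T n.+2 - q ^- 2 * g i * ser_pi T n.+1)
   - b ^- 2 * Q^-1 * (ser_pi T n.+1 - q ^- 2 * g i * ser_pi T n)).
  by rewrite /=; ring.
by rewrite IH h1 h0 /=; ring.
Qed.

Lemma wt_JD1 T i n : i \in T -> wt_J n.+1 T - wt_J n.+1 (T :\ i)
   = g i * (q ^- 2 * wt_J n T - q ^+ 2 * wt_J n (T :\ i)).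
Proof.
move=> iT; have h := ser_psiD1 n iT; case: n h => [|n] h.
  rewrite /wt_J (wt_KD1 iT).
  have -> : ser_psi T 1 = ser_psi (T :\ i) 1 - q ^+ 2 * g i + q ^- 2 * g i.
    by move: h; rewrite [ser_psi _ 0]/= [ser_psi _ 0]/= !mulr1 => <-; rewrite subrK.
  move: (q - q^-1) c0 => c cn0.
  by field; rewrite wt_K_neq0 q0 cn0.
rewrite /wt_J.
have -> : ser_psi T n.+2 = ser_psi (T :\ i) n.+2 - q ^+ 2 * g i * ser_psi (T :\ i) n.+1
   + q ^- 2 * g i * ser_psi T n.+1 by rewrite -h subrK.
by ring.
Qed.

Hypothesis q_nru : forall n, (0 < n)%N -> q ^+ n != 1.

(** (K^-)^2 acts on T by the value of Psi at z = infinity; this makes J_0 fit with the J_n for n > 0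
    in [comm_diag]. *)
Lemma wt_K_prod T : wt_K T ^- 2 = b ^- 2 * \prod_i sgn_q T i.
Proof.
have -> : \prod_i sgn_q T i = q ^+ (2 * #|T|) * q ^- (2 * #|~: T|).
  rewrite (bigID (mem T)) /=; congr (_ * _).
    rewrite (eq_bigr (fun=> q ^+ 2)) => [|i iT]; last by rewrite /sgn_q iT.
    by rewrite prodr_const -exprM mulnC.
  rewrite (eq_bigr (fun=> q ^- 2)) => [|i /negbTE iT]; last by rewrite /sgn_q iT.
  rewrite (eq_bigl (mem (~: T))) => [|i]; last by rewrite !inE.
  by rewrite prodr_const exprVn -exprM mulnC.
have kE : (k = #|T| + #|~: T|)%N by rewrite cardsC card_ord.
have -> : wt_K T = b * (q ^+ #|T| * q ^+ #|~: T|) * q ^- (2 * #|T|).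
  by rewrite /wt_K {1}kE exprD.
rewrite ![(2 * _)%N]mulSn !mul1n !exprD.
by field; rewrite b0 !expf_neq0.
Qed.

(** The combination J_n - Q J_(n+1) cancels the factor 1/(1 - z/Q) of Psi and leaves power sums of
    the g_i weighted by the residues. *)
Lemma comm_diag T n : \sum_i g i ^+ n * (wt_K T * (b ^- 2 - Q * g i) * res T i / (q - q^-1))
  = wt_K T * (wt_J n T - Q * wt_J n.+1 T).
Proof.
have -> : \sum_i g i ^+ n * (wt_K T * (b ^- 2 - Q * g i) * res T i / (q - q^-1))
    = wt_K T / (q - q^-1) * (b ^- 2 * (\sum_i res T i * g i ^+ n) - Q * \sum_i res T i * g i ^+ n.+1).
  rewrite !mulr_sumr -sumrB mulr_sumr; apply: eq_bigr => i _.
  by rewrite (exprS (g i)); move: (q - q^-1)^-1 (b ^- 2) => c1 b1; ring.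
rewrite -mulrA; congr (_ * _); case: n => [|n]; last first.
  have piE m : \sum_i res T i * g i ^+ m.+1 = ser_pi T m.+1 by rewrite /ser_pi add0r.
  have psiE : ser_psi T n.+2 = Q^-1 * ser_psi T n.+1 + ser_pi T n.+2
      - b ^- 2 * Q^-1 * ser_pi T n.+1 by [].
  rewrite !piE /wt_J psiE; move: (ser_psi T n.+1) (q - q^-1) c0 => x c cn0.
  by field; rewrite cn0 b0 Q0.
rewrite /wt_J wt_K_prod /= /ser_pi /= !add0r.
have := ser_pi0 T; rewrite /ser_pi /=; set S0 := \sum_i _; set P := \prod_i _ => h.
have -> : P = 1 - S0 by rewrite -h addrK.
by move: (q - q^-1) c0 => c cn0; rewrite subrK; field; rewrite Q0 b0 cn0.
Qed.

Definition subset_amod : amod q Q V.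
Proof.
refine (@AMod _ q Q V (fun t => edge_op w_p (fun T i => i |: T) t : {linear V -> V})
  (fun t => edge_op w_m (fun T i => T :\ i) t : {linear V -> V})
  (fun t => diag_op (wt_J t) : {linear V -> V}) (diag_op wt_K : {linear V -> V})
  (diag_op (fun T => (wt_K T)^-1) : {linear V -> V}) _ _ _ _ _ _ _ _).
- by move=> t f; apply/ffunP => T; rewrite !ffunE mulrCA.
- by move=> s t f; apply/ffunP => T; rewrite !ffunE mulrCA.
- by move=> f; apply/ffunP => T; rewrite !ffunE mulVKf ?wt_K_neq0.
- by move=> f; apply/ffunP => T; rewrite !ffunE mulKf ?wt_K_neq0.
- move=> f; apply/ffunP => T; rewrite !ffunE scE /wt_J.
  by move: (q - q^-1) c0 => c cn0; field; rewrite wt_K_neq0 cn0.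
- apply: edge_rels => [|T i j|T i|T i j ij|T i|T i|s T i].
  + exact: wt_K_neq0.
  + by rewrite setUCA.
  + by rewrite /w_p setU11 mulr0.
  + rewrite /w_p !inE eq_sym (negPf ij) /=.
    case: ifP => [|/negbT iT]; first by rewrite !(mulr0, mul0r, addr0).
    case: ifP => [|/negbT jT]; first by rewrite !(mulr0, mul0r, addr0).
    rewrite !wt_KU1 // (fac_outU1 ij jT) (@fac_outU1 T j i) 1?eq_sym //.
    have gji : g j - g i != 0 by rewrite g_neq // eq_sym.
    by field; rewrite (g_neq ij) gji q0 b0.
  + rewrite /w_p; case: ifP => [|/negbT iT _]; first by rewrite eqxx.
    by rewrite wt_KU1 // mulrA mulfV ?mul1r ?expf_neq0.
  + rewrite /w_p; case: ifP => [|/negbT iT _]; first by rewrite eqxx.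
    rewrite /wt_J wt_KU1 //; move: (q - q^-1) c0 => c cn0.
    by field; rewrite wt_K_neq0 q0 cn0.
  + rewrite /w_p; case: ifP => [|/negbT iT _]; first by rewrite eqxx.
    have := @wt_JD1 (i |: T) i s; rewrite setU11 setU1K // => /(_ isT) h.
    by rewrite -opprB h -mulrN opprB.
- apply: edge_rels => [|T i j|T i|T i j ij|T i|T i|s T i].
  + exact: wt_K_neq0.
  + by apply/setP => l; rewrite !inE; case: (l == i); case: (l == j).
  + by rewrite /w_m !inE eqxx mulr0.
  + rewrite /w_m !inE (negPf ij) eq_sym (negPf ij) /=.
    case: ifP => iT; last by rewrite !(mulr0, mul0r, addr0).
    case: ifP => jT; last by rewrite !(mulr0, mul0r, addr0).
    rewrite (fac_inD1 ij jT) (@fac_inD1 T j i) 1?eq_sym //.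
    have gji : g j - g i != 0 by rewrite g_neq // eq_sym.
    by field; rewrite (g_neq ij) gji q0.
  + rewrite /w_m; case: ifP => [iT _|]; last by rewrite eqxx.
    by rewrite wt_KD1 // mulrA mulVf ?mul1r ?expf_neq0.
  + rewrite /w_m; case: ifP => [iT _|]; last by rewrite eqxx.
    rewrite /wt_J wt_KD1 //; move: (q - q^-1) c0 => c cn0.
    by field; rewrite wt_K_neq0 q0 cn0.
  + rewrite /w_m; case: ifP => [iT _|]; last by rewrite eqxx.
    exact: wt_JD1.
move=> t s f; apply/ffunP => T; rewrite !ffunE scE -[Q * _]/(Q * _) /=.
have -> : wt_K T * (wt_J (s + t) T * f T - Q * (wt_J (s + t).+1 T * f T))
    = (wt_K T * (wt_J (s + t)%N T - Q * wt_J (s + t).+1 T)) * f T by ring.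
rewrite -comm_diag mulr_suml.
pose a i j := g i ^+ t * g j ^+ s * (w_p T i * w_m (i |: T) j) * f ((i |: T) :\ j).
pose a' i j := g i ^+ t * g j ^+ s * (w_m T j * w_p (T :\ j) i) * f (i |: (T :\ j)).
have -> : \sum_i g i ^+ t * w_p T i * (edge_op w_m (fun T i => T :\ i) s f) (i |: T)
    = \sum_i \sum_j a i j.
  apply: eq_bigr => i _; rewrite ffunE mulr_sumr; apply: eq_bigr => j _.
  by rewrite /a; ring.
have -> : \sum_i g i ^+ s * w_m T i * (edge_op w_p (fun T i => i |: T) t f) (T :\ i)
    = \sum_i \sum_j a' i j.
  rewrite exchange_big; apply: eq_bigr => i _; rewrite ffunE mulr_sumr.
  by apply: eq_bigr => j _; rewrite /a'; ring.
(* The terms with j = i return to T and give the summands of [comm_diag]; the others cancel. *)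
rewrite -sumrB; apply: eq_bigr => i _; rewrite -sumrB (bigD1 i) //= big1 ?addr0.
  rewrite /a /a' /w_p /w_m !inE eqxx /= fac_in_sameU fac_out_same resE exprD.
  case: ifP => [iT|/negbT iT].
    rewrite setD1K // wt_KD1 // /sgn_q iT; move: c0 => /eqP cn0.
    have cE : q - q^-1 = (q ^+ 2 - 1) / q by field.
    have q21 : q ^+ 2 - 1 != 0 by rewrite subr_eq0 q_nru.
    by rewrite cE; field; rewrite q0 q21.
  rewrite setU1K // /sgn_q (negPf iT).
  have cE : q - q^-1 = (q ^+ 2 - 1) / q by field.
  have q21 : q ^+ 2 - 1 != 0 by rewrite subr_eq0 q_nru.
  by rewrite cE; field; rewrite b0 q0 q21.
(* For j != i, adding i and removing j lead to the same set in either order, with equal weights. *)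
move=> j ji; rewrite /a /a' /w_p /w_m !inE (eq_sym i) (negPf ji) /=.
case: ifP => iT; first by case: ifP; rewrite !(mulr0, mul0r) ?subr0.
case: ifP => jT; last by rewrite !(mulr0, mul0r) ?subr0.
have iT' := negbT iT.
have sE : (i |: T) :\ j = i |: (T :\ j).
  by apply/setP => l; rewrite !inE; case: (eqVneq l i) => // ->; rewrite eq_sym ji.
rewrite sE wt_KD1 // (@fac_inD1 (i |: T) j i) ?setU11 // setU1K //.
rewrite (@fac_outU1 (T :\ j) i j) ?setD1K 1?eq_sym ?inE ?eqxx //.
have gji : g j - g i != 0 by rewrite g_neq.
have gij : g i - g j != 0 by rewrite g_neq // eq_sym.
by field; rewrite gji gij q0 b0.
Defined.

Definition delta_set (S : {set 'I_k}) : V := [ffun T => (T == S)%:R].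

Lemma delta_hw r : hw_upto subset_amod r (wt_K set0) (wt_J^~ set0) (delta_set set0).
Proof.
split=> [t||t _]; apply/ffunP => T; rewrite !ffunE ?scE.
- rewrite big1 // => i _; rewrite ffunE; case: eqP => [/setP/(_ i)|_]; last by rewrite mulr0.
  by rewrite !inE eqxx.
- by case: eqP => [->//|]; rewrite !mulr0.
- by case: eqP => [->//|]; rewrite !mulr0.
Qed.

(** The scalars of F^k and E^k: q-factorials whose factors are the sums of [fac_in] and [fac_out]
    over j + 1 roots, together with the K^+-weights met on the way back. *)
Definition top_const : K :=
  \prod_(j < k) ((1 - q ^+ (2 * j.+1)) / (1 - q ^+ 2)) *
  \prod_(j < k) (b * q ^+ k * q ^- (2 * (k - j.+1)) * q^-1 * ((1 - q ^- (2 * j.+1)) / (1 - q ^- 2))).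

(** The sum of the residues for the multipliers q^2 on T and 1 outside T, where the residues
    vanish. *)
Lemma sum_fac_in T : \sum_(i in T) fac_in T i = (1 - q ^+ (2 * #|T|)) / (1 - q ^+ 2).
Proof.
have q21 : 1 - q ^+ 2 != 0 by rewrite subr_eq0 eq_sym q_nru.
pose s i : K := if i \in T then q ^+ 2 else 1.
apply: (mulIf q21); rewrite divfK // mulr_suml.
have -> : q ^+ (2 * #|T|) = \prod_i s i.
  rewrite (bigID (mem T)) /= [X in _ * X]big1 ?mulr1 => [|i /negbTE iT]; last by rewrite /s iT.
  rewrite (eq_bigr (fun=> q ^+ 2)) => [|i iT]; last by rewrite /s iT.
  by rewrite prodr_const -exprM.
have out : \sum_(i | i \notin T) pf_res g s i = 0.
  by apply: big1 => i /negbTE iT; rewrite /pf_res /s iT subrr mul0r.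
rewrite -(sum_pf_res g_inj g_neq0) [RHS](bigID (mem T)) /= out addr0.
apply: eq_bigr => i iT; rewrite mulrC /pf_res {1}/s iT; congr (_ * _).
have trv : \prod_(l | (l != i) && (l \notin T)) ((g i - s l * g l) / (g i - g l)) = 1.
  by apply: big1 => l /andP[li /negbTE lT]; rewrite /s lT mul1r divff // g_neq // eq_sym.
rewrite /fac_in [RHS](bigID (mem T)) /= trv mulr1.
by apply: eq_bigr => l /andP[_ lT]; rewrite /s lT.
Qed.

Lemma sum_fac_out T : \sum_(i in ~: T) fac_out T i = (1 - q ^- (2 * #|~: T|)) / (1 - q ^- 2).
Proof.
have q21 : 1 - q ^- 2 != 0 by rewrite subr_eq0 eq_sym invr_eq1 q_nru.
pose s i : K := if i \notin T then q ^- 2 else 1.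
apply: (mulIf q21); rewrite divfK // mulr_suml.
have -> : q ^- (2 * #|~: T|) = \prod_i s i.
  rewrite (bigID (mem T)) /= big1 ?mul1r => [|i iT]; last by rewrite /s iT.
  rewrite (eq_bigr (fun=> q ^- 2)) => [|i iT]; last by rewrite /s iT.
  rewrite (eq_bigl (mem (~: T))) => [|i]; last by rewrite !inE.
  by rewrite prodr_const exprVn -exprM.
have out : \sum_(i in T) pf_res g s i = 0.
  by apply: big1 => i iT; rewrite /pf_res /s iT subrr mul0r.
rewrite -(sum_pf_res g_inj g_neq0) [RHS](bigID (mem T)) /= out add0r.
apply: eq_big => [i|i iT]; first by rewrite !inE.
rewrite inE in iT; rewrite mulrC /pf_res {1}/s iT; congr (_ * _).
have trv : \prod_(l | (l != i) && (l \in T)) ((g i - s l * g l) / (g i - g l)) = 1.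
  by apply: big1 => l /andP[li lT]; rewrite /s lT mul1r divff // g_neq // eq_sym.
rewrite /fac_out [RHS](bigID (mem T)) /= trv mul1r.
by apply: eq_bigr => l /andP[_ lT]; rewrite /s lT.
Qed.

Let F := edge_op w_m (fun T i => T :\ i) 0.
Let E := edge_op w_p (fun T i => i |: T) 0.

Lemma iterF m : (m <= k)%N -> iter m F (delta_set set0)
  = [ffun T : {set 'I_k} => if #|T| == m then \prod_(j < m) ((1 - q ^+ (2 * j.+1)) / (1 - q ^+ 2)) else 0].
Proof.
elim: m => [|m IH] ltmk.
  by apply/ffunP => T; rewrite !ffunE cards_eq0 big_ord0; case: eqP.
rewrite iterS IH 1?ltnW //; apply/ffunP => T; rewrite !ffunE.
have [Tm|Tm] := eqVneq #|T| m.+1; last first.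
  rewrite big1 // => i _; rewrite ffunE /w_m; case: ifP => iT; last by rewrite mulr0 mul0r.
  case: eqP => [e|_]; last by rewrite mulr0.
  by move: Tm; rewrite (cardsD1 i T) iT e eqxx.
rewrite big_ord_recr /= -Tm -sum_fac_in mulrC mulr_suml [RHS]big_mkcond; apply: eq_bigr => i _.
rewrite ffunE /w_m expr0 mul1r; case: ifP => iT; last by rewrite mul0r.
have -> : #|T :\ i| = m by move: Tm; rewrite (cardsD1 i T) iT => -[].
by rewrite eqxx mulrC.
Qed.

Lemma iterE m : (m <= k)%N -> iter m E (delta_set setT)
  = [ffun T : {set 'I_k} => if #|~: T| == m then
      \prod_(j < m) (b * q ^+ k * q ^- (2 * (k - j.+1)) * q^-1 * ((1 - q ^- (2 * j.+1)) / (1 - q ^- 2)))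
      * \prod_(i in ~: T) (b ^- 2 - Q * g i) else 0].
Proof.
elim: m => [|m IH] ltmk.
  apply/ffunP => T; rewrite !ffunE cards_eq0 big_ord0 -setCT (inj_eq (@setC_inj _)).
  by case: eqP => [->|]; rewrite // setCT big_set0 mulr1.
rewrite iterS IH 1?ltnW //; apply/ffunP => T; rewrite !ffunE.
have CU i : ~: (i |: T) = (~: T) :\ i by rewrite setCU setIC -setDE.
have [Tm|Tm] := eqVneq #|~: T| m.+1; last first.
  rewrite big1 // => i _; rewrite ffunE /w_p; case: ifP => iT; first by rewrite mulr0 mul0r.
  case: eqP => [e|_]; last by rewrite mulr0.
  by move: Tm; rewrite (cardsD1 i (~: T)) inE iT -CU e eqxx.
have TE : #|T| = (k - m.+1)%N by rewrite -Tm -[X in (X - _)%N](card_ord k) -(cardsC T) addnK.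
rewrite big_ord_recr /= -TE -/(wt_K T) -Tm -sum_fac_out.
rewrite mulr_sumr !mulr_sumr mulr_suml [RHS]big_mkcond; apply: eq_bigr => i _.
rewrite ffunE /w_p expr0 mul1r inE; case: ifP => iT /=; first by rewrite mul0r.
have -> : #|~: (i |: T)| = m by move: Tm; rewrite CU (cardsD1 i (~: T)) inE iT => -[].
rewrite eqxx CU.
by rewrite [in RHS](big_setD1 i) ?inE ?iT //=; ring.
Qed.

Lemma iter_E_F : iter k (aXp subset_amod 0) (iter k (aXm subset_amod 0) (delta_set set0))
  = (top_const * \prod_i (b ^- 2 - Q * g i)) *: delta_set set0.
Proof.
have -> : iter k (aXm subset_amod 0) (delta_set set0)
    = \prod_(j < k) ((1 - q ^+ (2 * j.+1)) / (1 - q ^+ 2)) *: delta_set setT.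
  rewrite (iterF (leqnn k)); apply/ffunP => T; rewrite !ffunE scE.
  rewrite eqEcard subsetT cardsT card_ord /=.
  have : (#|T| <= k)%N by rewrite -[X in (_ <= X)%N]card_ord max_card.
  by case: ltngtP; rewrite ?mulr1 ?mulr0.
have iterZ m (a : K) x : iter m (aXp subset_amod 0) (a *: x) = a *: iter m (aXp subset_amod 0) x.
  by elim: m => //= m ->; rewrite linearZ.
rewrite iterZ (iterE (leqnn k)); apply/ffunP => T; rewrite !ffunE !scE.
have [->|T0] := eqVneq T set0.
  rewrite setC0 cardsT card_ord eqxx mulr1 /top_const -mulrA; congr (_ * (_ * _)).
  by apply: eq_bigl => i; rewrite !inE.
case: eqP => [e|_]; last by rewrite !mulr0.
case/eqP: T0; apply/eqP; rewrite -cards_eq0; have := cardsC T.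
by rewrite e card_ord => /eqP; rewrite -[X in _ == X]add0n eqn_add2r.
Qed.

Lemma top_const_neq0 : top_const != 0.
Proof.
have h n : (0 < n)%N -> 1 - q ^+ n != 0 by move=> n0; rewrite subr_eq0 eq_sym q_nru.
have h' n : (0 < n)%N -> 1 - q ^- n != 0 by move=> n0; rewrite subr_eq0 eq_sym invr_eq1 q_nru.
rewrite mulf_neq0 //; apply/prodf_neq0 => j _.
  by rewrite mulf_neq0 ?invr_eq0 ?h.
by rewrite !mulf_neq0 ?invr_eq0 ?expf_neq0 ?h' // h'.
Qed.

(** Multiplying by each 1 - g_i z sums the geometric series of the residues, which recombine by
    [partial_fractions]; multiplying by 1 - z/Q undoes the recursion of [ser_psi]. *)
Lemma ser_psiE n : ser_psi set0 n = hw_ser (q ^- 2) (b ^- 2 * Q^-1) Q^-1 [seq g i | i : 'I_k] n.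
Proof.
apply: (ser_uniq (r := n.+1) (hw_den0 _ _)) (ltnSn n) => m _.
set A := rev_poly [seq g i | i : 'I_k].
have AE : A = \prod_i (1 - g i *: 'X) by rewrite /A /rev_poly big_map big_enum.
have geo i : eqm m ((1 - g i *: 'X) * \poly_(n < m) g i ^+ n) 1.
  move=> [|j] jm; rewrite coef_linM !coef_poly jm coef1 ?subr0 //=.
  by rewrite ltnW // exprS subrr.
have piA : eqm m (A * \poly_(n < m) ser_pi set0 n) (rev_poly [seq q ^- 2 * x | x <- [seq g i | i : 'I_k]]).
  have -> : rev_poly [seq q ^- 2 * x | x <- [seq g i | i : 'I_k]] = \prod_i (1 - (sgn_q set0 i * g i) *: 'X).
    by rewrite /rev_poly big_map big_image /=; apply: eq_bigr => i _; rewrite /sgn_q inE.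
  have pE : eqm m (\poly_(n < m) ser_pi set0 n)
      ((\prod_i sgn_q set0 i)%:P + \sum_i res set0 i *: \poly_(n < m) g i ^+ n).
    move=> j jm; rewrite coef_poly jm coefD coefC coef_sum /ser_pi; congr (_ + _).
    by apply: eq_bigr => i _; rewrite coefZ coef_poly jm.
  rewrite (partial_fractions g_inj g_neq0); apply: eqm_trans (eqmMl _ pE) _ => j jm.
  rewrite mulrDr coefD [RHS]coefD mulrC mul_polyC -AE; congr (_ + _).
  rewrite mulr_sumr !coef_sum; apply: eq_bigr => i _.
  rewrite -scalerAr !coefZ; congr (_ * _).
  set P := \prod_(l | l != i) _.
  have -> : A * \poly_(n < m) g i ^+ n = (1 - g i *: 'X) * (\poly_(n < m) g i ^+ n) * P.
    by rewrite AE (bigD1 i) //= mulrAC.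
  by have := eqmM (geo i) (fun (a : nat) (_ : (a < m)%N) => erefl (P`_a)) jm; rewrite mul1r.
have psiE : eqm m ((1 - Q^-1 *: 'X) * \poly_(n < m) ser_psi set0 n)
    ((1 - (b ^- 2 * Q^-1) *: 'X) * \poly_(n < m) ser_pi set0 n).
  move=> [|j] jm; rewrite !coef_linM !coef_poly jm ?ser_pi0 ?subr0 // (ltnW jm) /=.
  by ring.
rewrite /hw_den /hw_num -mulrA; apply: eqm_trans (eqmMl _ psiE) _.
by rewrite mulrCA mulrC; apply: eqmM.
Qed.
End SubsetModel.

(** * Specialisation of the roots *)

Lemma frac_denom (R : idomainType) (x : {fraction R}) : exists d n : R,
  d != 0 /\ x * FracField.tofrac d = FracField.tofrac n.
Proof.
elim/quotW: x => r; exists (frac r).2, (frac r).1; split; first exact: denom_ratioP.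
unlock FracField.tofrac; rewrite -[LHS]FracField.pi_mul; apply/eqmodP => /=.
have d0 := denom_ratioP r.
by rewrite FracField.equivfE /FracField.mulf !numden_Ratio ?oner_eq0 ?mulr1 ?mul1r ?oner_neq0 // mulrC.
Qed.

Lemma common_denom (R : idomainType) n (x : 'I_n -> {fraction R}) :
  exists (d : R) (a : 'I_n -> R), d != 0 /\ forall i, x i * FracField.tofrac d = FracField.tofrac (a i).
Proof.
have [d dP] := choice (fun i => frac_denom (x i)); have [m mP] := choice dP.
exists (\prod_i d i), (fun i => m i * \prod_(j | j != i) d j); split.
  by apply/prodf_neq0 => i _; have [] := mP i.
move=> i; rewrite (bigD1 i) //= rmorphM mulrA; have [_ ->] := mP i.
by rewrite -rmorphM.
Qed.

Lemma ffun_dep (F : fieldType) (I : finType) (s : 'I_#|I|.+1 -> {ffun I -> F^o}) :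
  exists a : 'I_#|I|.+1 -> F, (exists i, a i != 0) /\ \sum_i a i *: s i = 0.
Proof.
have [a [ai aE]] := family_dep (fun i => \col_j s i (enum_val j) : 'cV[F]_#|I|) (leqnn _).
exists a; split=> //; apply/ffunP => x.
have /colP/(_ (enum_rank x)) := aE; rewrite summxE mxE => h.
rewrite sum_ffunE [RHS]ffunE -[RHS]h; apply: eq_bigr => i _.
by rewrite !mxE enum_rankK ffunE.
Qed.

Lemma fmorph_top_const (F K : fieldType) (f : {rmorphism F -> K}) k q b :
  f (top_const k q b) = top_const k (f q) (f b).
Proof.
rewrite /top_const rmorphM !rmorph_prod; congr (_ * _); apply: eq_bigr => j _.
  by rewrite rmorphM fmorphV !rmorphB !rmorph1 !rmorphXn.
by rewrite !(rmorphM, fmorphV, rmorphB, rmorph1, rmorphXn).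
Qed.

(* Specialisation at tau = 0 of a module over K = C(tau): the C[tau]-span Y of the words on the
   highest weight vector is stable, and Y / tau Y has dimension at most dim_K since every
   K-linear relation yields a nontrivial one modulo tau. *)
Section Specialize.
Variables (C : closedFieldType) (K : fieldType) (rho : {rmorphism {poly C} -> K}).
Hypothesis rho_inj : injective rho.
Hypothesis rho_denom : forall n (x : 'I_n -> K), exists (d : {poly C}) (a : 'I_n -> {poly C}),
  d != 0 /\ forall i, x i * rho d = rho (a i).
Let iota : {rmorphism C -> K} := rho \o polyC.
Let O : comUnitRingType := {poly C}.

Variables (q Q l : C).
Hypotheses (q0 : q != 0) (q_nru : not_root_of_unity q) (l0 : l != 0).
Let qO : O := q%:P.
Let QO : O := Q%:P.
Let lO : O := l%:P.

Variables (I : finType) (AO : amod (rho qO) (rho QO) {ffun I -> K^o}).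
Variables (v0 : {ffun I -> K^o}) (uO : nat -> O) (e : O) (k : nat).
Hypotheses (v0n0 : v0 != 0) (hwO : forall r, hw_upto AO r (rho lO) (rho \o uO) v0).
Hypothesis iter_e : iter k (aXp AO 0) (iter k (aXm AO 0) v0) = rho e *: v0.
Let A : amod (iota q) (iota Q) {ffun I -> K^o} := AO.
Let u n := (uO n).[0].

Let rho_eq0 x : (rho x == 0) = (x == 0).
Proof. by rewrite -(inj_eq rho_inj) rmorph0. Qed.

Let iq_nru n : (0 < n)%N -> rho qO ^+ n != 1.
Proof.
move=> n0; rewrite -rmorphXn -(rmorph1 rho) (inj_eq rho_inj) -rmorphXn.
by rewrite -subr_eq0 -rmorphB polyC_eq0 subr_eq0 q_nru.
Qed.

Let q_unit : qO \is a GRing.unit. Proof. by apply: rmorph_unit; rewrite unitfE. Qed.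
Let c_unit : qO - qO^-1 \is a GRing.unit.
Proof. by rewrite /qO -rmorphV ?unitfE // -rmorphB; apply: rmorph_unit; rewrite unitfE (qqV_neq0 q0 q_nru). Qed.
Let l_unit : lO \is a GRing.unit.
Proof. by apply: rmorph_unit; rewrite unitfE. Qed.
Let Y := word_span AO v0.
Let Z x := exists2 y, Y y & x = rho 'X *: y.

Let YY : asub iota A Y.
Proof.
split=> [|t x|t x|t x|].
- split=> [|a x y Yx Yy].
    by rewrite -(scale0r v0) -(rmorph0 rho); apply: word_spanZ; apply: word_span0.
  by apply: word_spanD Yy; apply: (word_spanZ a%:P).
- exact: (word_span_Xp q_unit c_unit l_unit hwO).
- exact: word_span_Xm.
- exact: (word_span_J q_unit c_unit l_unit hwO).
split=> x; first exact: (word_span_Kp q_unit hwO).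
exact: (word_span_Km q_unit l_unit hwO).
Qed.

Let ZZ : asub iota A Z.
Proof.
have [[Y0 YD] h1 h2 h3 [h4 h5]] := YY.
split=> [|t x [y Yy ->]|t x [y Yy ->]|t x [y Yy ->]|].
- split=> [|a x x' [y Yy ->] [y' Yy' ->]]; first by exists 0; rewrite ?scaler0.
  exists (iota a *: y + y'); first exact: YD.
  by rewrite scalerDr !scalerA mulrC.
- by exists (aXp A t y); [apply: h1|rewrite linearZ].
- by exists (aXm A t y); [apply: h2|rewrite linearZ].
- by exists (aJ A t y); [apply: h3|rewrite linearZ].
split=> x [y Yy ->].
  by exists (aKp A y); [apply: h4|rewrite linearZ].
by exists (aKm A y); [apply: h5|rewrite linearZ].
Qed.

Let rX0 : rho 'X != 0. Proof. by rewrite rho_eq0 polyX_eq0. Qed.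

(* A [C[tau]]-linear relation can be divided by the power of [tau] common to its coefficients. *)
Let dep : dep_mod iota Y Z #|I|.+1.
Proof.
move=> s sY; have [x [[i xi] x0]] := ffun_dep s.
have [d [a [d0 aE]]] := rho_denom x.
have {xi} ai : a i != 0.
  by rewrite -(rho_eq0 (a i)) -aE mulf_neq0 // rho_eq0.
have {x x0 d0 aE} as0 : \sum_j rho (a j) *: s j = 0.
  transitivity (rho d *: \sum_j x j *: s j); last by rewrite x0 scaler0.
  by rewrite scaler_sumr; apply: eq_bigr => j _; rewrite scalerA mulrC aE.
have [n] := ubnP (size (a i)); elim: n a ai as0 => // n IH a ai as0 an.
have [[j aj]|a0] := pselect (exists j, (a j).[0] != 0).
  exists (fun j => (a j).[0]); split; first by exists j.
  have /choice[a' a'E] j' : exists a', a j' = a' * 'X + ((a j').[0])%:P.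
    have /factor_theorem[a' a'E] : root (a j' - ((a j').[0])%:P) 0.
      by rewrite /root hornerD hornerN hornerC subrr.
    by exists a'; rewrite -[LHS](subrK ((a j').[0])%:P) a'E subr0.
  exists (- \sum_j' rho (a' j') *: s j').
    apply: (asubN YY); apply: (big_ind Y) => [|y y' Yy Yy'|j' _].
    - by case: YY => -[].
    - exact: word_spanD.
    - by apply: (word_spanZ (a' j')); apply: sY.
  apply/eqP; rewrite scalerN -addr_eq0; apply/eqP; rewrite scaler_sumr -big_split -[RHS]as0 /=.
  apply: eq_bigr => j' _; rewrite scalerA -scalerDl; congr (_ *: _).
  by rewrite [in RHS]a'E rmorphD rmorphM addrC mulrC.
have /choice[a' a'E] j : exists a', a j = a' * 'X.
  have /factor_theorem[a' a'E] : root (a j) 0.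
    by apply: contrapT => /negP ra; apply: a0; exists j.
  by exists a'; rewrite a'E subr0.
have a'i : a' i != 0 by apply: contraNneq ai => a0'; rewrite a'E a0' mul0r.
apply: (IH a' a'i) => //.
  apply: (scalerI rX0); rewrite scaler0 scaler_sumr -[RHS]as0.
  by apply: eq_bigr => j _; rewrite scalerA -rmorphM a'E mulrC.
by move: an; rewrite a'E size_mulX // ltnS.
Qed.

(** If x v0 = tau y with y in the lattice, then y has the weight of v0, so it is a C[tau]-multiple
    of v0 and tau divides x. Hence v0 survives modulo tau. *)
Let top_in_Z (x : O) : Z (rho x *: v0) -> x.[0] = 0.
Proof.
move=> [y Yy yE]; have [->|xn0] := eqVneq x 0; first by rewrite horner0.
have Ky : aKp AO y = rho lO *: y.
  apply: (scalerI rX0); have h : aKp AO (rho 'X *: y) = rho 'X *: aKp AO y by rewrite linearZ.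
  rewrite -h -yE linearZ /= [RHS]scalerA mulrC -scalerA -yE.
  by have [_ -> _] := hwO 0; rewrite !scalerA mulrC.
have y0 : y != 0.
  apply: contraNneq v0n0 => y0; move: yE; rewrite y0 scaler0 => /eqP.
  by rewrite scaler_eq0 rho_eq0 (negPf xn0).
have [j [d [lE w]]] := word_span_eigen q_unit l_unit hwO iq_nru Yy Ky y0.
have : rho (word_wt qO lO 0) = rho (word_wt qO lO j).
  by rewrite -lE /word_wt muln0 expr0 invr1 mulr1.
move=> /(word_wt_inj q_unit l_unit iq_nru) jE; rewrite -jE in w.
have [a yE'] := words0P w; move: yE; rewrite yE' scalerA -rmorphM => /eqP.
rewrite -subr_eq0 -scalerBl scaler_eq0 (negPf v0n0) orbF subr_eq0 (inj_eq rho_inj) => /eqP ->.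
by rewrite hornerM hornerX mul0r.
Qed.

Lemma specialize : exists (M : fdmod q Q) v,
  hw_vector (M := M) (l, u) v /\
  (e.[0] != 0 -> iter k (mulmx (fd_Xp M 0)) (iter k (mulmx (fd_Xm M 0)) v) != 0).
Proof.
have Yv : Y v0 by apply: word_span0.
have nZv : ~ Z v0.
  rewrite -[v0]scale1r -(rmorph1 rho) => /top_in_Z; rewrite hornerC => /eqP.
  by rewrite oner_eq0.
(* Modulo tau, a scalar of C[tau] acts on v0 by its value at 0. *)
have ZO (x : O) : Z (rho x *: v0 - iota x.[0] *: v0).
  have /factor_theorem[y yE] : root (x - (x.[0])%:P) 0.
    by rewrite /root hornerD hornerN hornerC subrr.
  exists (rho y *: v0); first exact: word_spanZ.
  by rewrite -scalerBl -rmorphB yE subr0 rmorphM scalerA mulrC.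
have hX t : Z (aXp A t v0) by have [-> _ _] := hwO 0; case: ZZ => -[].
have hK : Z (aKp A v0 - iota l *: v0).
  by have [_ -> _] := hwO 0; have := ZO lO; rewrite hornerC.
have hJ t : (0 < t)%N -> Z (aJ A t v0 - iota (u t) *: v0).
  by move=> t0; have [_ _ ->] := hwO t; rewrite ?t0 ?leqnn //= ; apply: ZO.
have [M [pi [_ rM hwM]]] := realize_hw (u := (l, u)) YY ZZ dep Yv nZv hX hK hJ.
exists M, (pi v0); split=> // gsn.
have [_ _ pi0 [piXp piXm] _] := rM; have [_ Yp Ym _ _] := YY.
have YF j : Y (iter j (aXm A 0) v0) by elim: j => //= j; apply: Ym.
have piF j : iter j (mulmx (fd_Xm M 0)) (pi v0) = pi (iter j (aXm A 0) v0).
  by elim: j => //= j ->; rewrite piXm.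
set w := iter k (aXm A 0) v0 in YF piF.
have YE j : Y (iter j (aXp A 0) w) by elim: j => [|j IH]; [apply: YF|apply: Yp].
have piE j : iter j (mulmx (fd_Xp M 0)) (pi w) = pi (iter j (aXp A 0) w).
  by elim: j => //= j ->; rewrite piXp.
rewrite piF piE /w iter_e; apply/eqP => /pi0 h.
have /top_in_Z/eqP : Z (rho e *: v0) by apply: h; apply: (word_spanZ e).
by rewrite (negPf gsn).
Qed.
End Specialize.

Section ModelOver.
Variables (C : closedFieldType) (q Q b : C) (gs : seq C).
Hypotheses (q0 : q != 0) (q_nru : not_root_of_unity q) (Q0 : Q != 0) (b0 : b != 0).
Variables (K : fieldType) (rho : {rmorphism {poly C} -> K}).
Hypothesis rho_inj : injective rho.
Let k := size gs.
Let O : comUnitRingType := {poly C}.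
Let iota : {rmorphism C -> K} := rho \o polyC.
(* The perturbed roots g_i + q^i tau are pairwise distinct and nonzero. *)
Let gO (i : 'I_k) : O := (gs`_i)%:P + q ^+ i *: 'X.
Let g i : K := rho (gO i).

Let rho_eq0 x : (rho x == 0) = (x == 0).
Proof. by rewrite -(inj_eq rho_inj) rmorph0. Qed.

Let g_inj : injective g.
Proof.
move=> i j /rho_inj/(congr1 (fun p : {poly C} => p`_1)).
rewrite /gO !coefD !coefC !coefZ !coefX /= !add0r !mulr1 => e.
suff ne (m n : nat) : (m < n)%N -> q ^+ m != q ^+ n.
  by apply: val_inj; case: (ltngtP i j) => // /ne; rewrite e eqxx.
move=> mn; rewrite -(subnK (ltnW mn)) exprD -subr_eq0 -[X in X - _]mul1r -mulrBl.
by rewrite mulf_eq0 expf_eq0 (negPf q0) andbF orbF subr_eq0 eq_sym q_nru // subn_gt0.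
Qed.

Let g_neq0 i : g i != 0.
Proof.
rewrite /g rho_eq0; apply/eqP => /(congr1 (fun p : {poly C} => p`_1)).
rewrite /gO !coefD !coefC !coefZ !coefX ?coef0 /= ?add0r ?mulr1 => /eqP.
by rewrite expf_eq0 (negPf q0) andbF.
Qed.

Let iq0 : iota q != 0. Proof. by rewrite fmorph_eq0. Qed.
Let iQ0 : iota Q != 0. Proof. by rewrite fmorph_eq0. Qed.
Let ib0 : iota b != 0. Proof. by rewrite fmorph_eq0. Qed.
Let ic0 : iota q - (iota q)^-1 != 0.
Proof. by rewrite -fmorphV -rmorphB fmorph_eq0 (qqV_neq0 q0 q_nru). Qed.
Let iq_nru n : (0 < n)%N -> iota q ^+ n != 1.
Proof. by move=> n0; rewrite -rmorphXn fmorph_eq1 q_nru. Qed.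


Let uO n : O := ((q - q^-1)^-1)%:P * hw_ser (q ^- 2)%:P (b ^- 2 * Q^-1)%:P (Q^-1)%:P [seq gO i | i : 'I_k] n.
Let e : O := (top_const k q b)%:P * \prod_i ((b ^- 2)%:P - Q%:P * gO i).

Lemma model_over : exists (A : amod (rho q%:P) (rho Q%:P) {ffun {set 'I_k} -> K^o}) v0,
  [/\ v0 != 0, forall r, hw_upto A r (rho (b * q ^+ k)%:P) (rho \o uO) v0
    & iter k (aXp A 0) (iter k (aXm A 0) v0) = rho e *: v0].
Proof.
have hwd := delta_hw g_inj g_neq0 iq0 iQ0 ib0 ic0 iq_nru.
have top := iter_E_F g_inj g_neq0 iq0 iQ0 ib0 ic0 iq_nru.
exists (subset_amod g_inj g_neq0 iq0 iQ0 ib0 ic0 iq_nru), (delta_set K (k := k) set0); split.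
- by apply/eqP => /ffunP/(_ set0); rewrite !ffunE eqxx => /eqP; rewrite oner_eq0.
- move=> r; have [h1 h2 h3] := hwd r; split=> // [|t ht].
    rewrite h2 /wt_K cards0 muln0 expr0 invr1 mulr1; congr (_ *: _).
    by rewrite -[RHS]/(iota _) rmorphM rmorphXn.
  rewrite h3 //; case: t ht => // t _; rewrite /wt_J ser_psiE //; congr (_ *: _).
  rewrite mulrC /= /uO rmorphM map_hw_ser; congr (_ * _).
    by rewrite -[RHS]/(iota _) fmorphV rmorphB fmorphV.
  congr (hw_ser _ _ _ _ _).
  - by rewrite -[RHS]/(iota (q ^- 2)) fmorphV rmorphXn.
  - by rewrite -[RHS]/(iota (b ^- 2 * Q^-1)) rmorphM !fmorphV rmorphXn.
  - by rewrite -[RHS]/(iota Q^-1) fmorphV.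
  - exact: (map_comp rho gO).
rewrite top; congr (_ *: _).
rewrite rmorphM -[rho (top_const _ _ _)%:P]/(iota _) fmorph_top_const rmorph_prod; congr (_ * _).
apply: eq_bigr => i _; rewrite rmorphB rmorphM; congr (_ - _).
by rewrite -[RHS]/(iota (b ^- 2)) fmorphV rmorphXn.
Qed.

Lemma model_over_spec n :
  (uO n).[0] = (q - q^-1)^-1 * hw_ser (q ^- 2) (b ^- 2 * Q^-1) (Q^-1) gs n.
Proof.
rewrite /uO hornerM hornerC; congr (_ * _).
pose ev : {rmorphism {poly C} -> C} := horner_eval 0; have evE p : ev p = p.[0] by [].
rewrite -evE map_hw_ser !evE !hornerC; congr (hw_ser _ _ _ _ _).
rewrite /image_mem -map_comp.
apply: (@eq_from_nth _ 0) => [|i]; rewrite size_map size_enum_ord // => ik.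
rewrite (nth_map (Ordinal ik)) ?size_enum_ord //= evE /gO hornerD hornerC hornerZ hornerX.
by rewrite mulr0 addr0 nth_enum_ord.
Qed.


Lemma model_over_top : (forall g, g \in gs -> b ^- 2 - Q * g != 0) -> e.[0] != 0.
Proof.
move=> gsn; rewrite hornerM hornerC mulf_neq0 ?top_const_neq0 // horner_prod.
apply/prodf_neq0 => i _.
rewrite hornerD hornerN hornerM !hornerC /gO hornerD hornerC hornerZ hornerX mulr0 addr0.
by apply: gsn; apply: mem_nth.
Qed.
End ModelOver.

(** At tau = 0 the perturbed roots become [gs], so repeated and zero roots are reached as well. *)
Lemma exists_hw_module (C : closedFieldType) (q Q b : C) (gs : seq C) :
  q != 0 -> not_root_of_unity q -> Q != 0 -> b != 0 ->
  exists (M : fdmod q Q) v,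
  hw_vector (M := M) (b * q ^+ size gs,
    fun n => (q - q^-1)^-1 * hw_ser (q ^- 2) (b ^- 2 * Q^-1) (Q^-1) gs n) v /\
  ((forall g, g \in gs -> b ^- 2 - Q * g != 0) ->
   iter (size gs) (mulmx (fd_Xp M 0)) (iter (size gs) (mulmx (fd_Xm M 0)) v) != 0).
Proof.
move=> q0 q_nru Q0 b0.
pose rho : {rmorphism {poly C} -> {fraction {poly C}}} := @FracField.tofrac {poly C}.
have rho_inj : injective rho by move=> x y /eqP; rewrite tofrac_eq => /eqP.
have [A [v0 [v0n0 hw top]]] := model_over gs q0 q_nru Q0 b0 rho_inj.
have l0 : b * q ^+ size gs != 0 by rewrite mulf_neq0 // expf_neq0.
have [M [v [[vn0 vX vK vJ] hM]]] :=
  specialize rho_inj (@common_denom {poly C}) q0 q_nru l0 v0n0 hw top.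
exists M, v; split; last by move=> /(model_over_top q0 q_nru b0)/hM.
by split=> // t t0; rewrite vJ //= model_over_spec.
Qed.

(** * Highest weights and polynomials *)

Section Dilation.
Variable F : fieldType.
Implicit Types (s : F) (gs : seq F) (A B : {poly F}).

Definition dil s A := A \Po (s *: 'X).

Lemma coef_dil s A i : (dil s A)`_i = s ^+ i * A`_i.
Proof.
rewrite /dil comp_polyE coef_sum.
under eq_bigr => j _ do rewrite exprZn scalerA coefZ coefXn.
have [iA|iA] := ltnP i (size A).
  rewrite (bigD1 (Ordinal iA)) //= eqxx mulr1 big1 ?addr0 1?mulrC // => j ji.
  by case: eqP => [ij|]; rewrite ?mulr0 //; case/eqP: ji; apply: val_inj; rewrite /= ij.
rewrite big1 ?nth_default ?mulr0 // => j _.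
by case: eqP => [ij|]; rewrite ?mulr0 //; move: (ltn_ord j); rewrite -ij ltnNge iA.
Qed.

Lemma dilM s A B : dil s (A * B) = dil s A * dil s B.
Proof. exact: rmorphM. Qed.

Lemma dil_lin s a : dil s (1 - a *: 'X) = 1 - (s * a) *: 'X.
Proof.
by rewrite /dil rmorphB rmorph1 /= linearZ /= comp_polyX scalerA mulrC.
Qed.

Lemma rev_poly_dil s gs : rev_poly (map ( *%R s) gs) = dil s (rev_poly gs).
Proof.
rewrite /rev_poly big_map; elim: gs => [|g gs IH]; first by rewrite !big_nil /dil rmorph1.
by rewrite !big_cons dilM IH dil_lin.
Qed.

(** A/B is invariant under z -> s z. In order n + 1, once lower coefficients agree, the equation
    reads (1 - s^(n+1)) (a - b) = 0 for the two coefficients a and b. *)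
Lemma dil_uniq s A B : (forall n, (0 < n)%N -> s ^+ n != 1) -> A`_0 = 1 -> B`_0 = 1 ->
  A * dil s B = B * dil s A -> A = B.
Proof.
move=> s_nru A0 B0 AB; apply/polyP => n.
have [m] := ubnP n; elim: m n => // m IH [|n] nm; first by rewrite A0 B0.
have := congr1 (fun p : {poly F} => p`_n.+1) AB; rewrite !coefM.
rewrite ![\sum_(i < n.+2) _]big_ord_recr ![\sum_(i < n.+1) _]big_ord_recl /= !subn0 !subnn !coef_dil !expr0 A0 B0.
rewrite (eq_bigr (fun i : 'I_n => B`_(bump 0 i) * (dil s A)`_(n.+1 - bump 0 i))); last first.
  move=> i _; have lin : (bump 0 i < m)%N by rewrite /bump /= add1n (leq_ltn_trans (ltn_ord i)).
  rewrite !coef_dil (IH _ lin) (IH (n.+1 - bump 0 i)%N) //.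
  by rewrite /bump /= add1n subSS (leq_ltn_trans (leq_subr _ _)).
move: (\sum_(i < n) _) => S; rewrite !mul1r !mulr1 => e.
have s1 : 1 - s ^+ n.+1 != 0 by rewrite subr_eq0 eq_sym s_nru.
apply: (mulfI s1); move: e; move: (A`_n.+1) (B`_n.+1) (s ^+ n.+1) => x y z e.
have e2 : x - z * x = y - z * y + ((z * y + S + x) - (z * x + S + y)) by ring.
by rewrite !mulrBl !mul1r e2 e subrr addr0.
Qed.

Lemma rev_poly_cons g gs : rev_poly (g :: gs) = (1 - g *: 'X) * rev_poly gs.
Proof. by rewrite /rev_poly big_cons. Qed.

Lemma rev_poly_cat gs gs' : rev_poly (gs ++ gs') = rev_poly gs * rev_poly gs'.
Proof. by rewrite /rev_poly big_cat. Qed.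

Lemma size_rev_poly gs : (size (rev_poly gs) <= (size gs).+1)%N.
Proof.
rewrite /rev_poly (big_nth 0) big_mkord.
by have [] := prod_lin_top (fun i : 'I_(size gs) => gs`_i).
Qed.

Lemma coef_rev_poly gs i : (i <= size gs)%N ->
  (\prod_(g <- gs) ('X - g%:P))`_i = (rev_poly gs)`_(size gs - i).
Proof.
elim: gs i => [|g gs IH] i /=; first by rewrite leqn0 => /eqP ->; rewrite big_nil /rev_poly big_nil.
rewrite big_cons rev_poly_cons coef_linM mulrBl coefB coefXM mul_polyC coefZ => ile.
case: i ile => [|i] ile.
  rewrite subn0 /= IH // subn0 [(rev_poly gs)`_(size gs).+1]nth_default ?size_rev_poly //.
rewrite subSS /= IH //; have [->|ltik] := eqVneq i (size gs).
  by rewrite subnn [X in _ - _ * X]nth_default ?size_prod_XsubC // mulr0.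
have lt : (i < size gs)%N by rewrite ltn_neqAle ltik.
rewrite IH // -(subnSK lt) /=.
by [].
Qed.

Lemma root_rev_poly gs a : a != 0 -> root (rev_poly gs) a^-1 = (a \in gs).
Proof.
move=> a0; elim: gs => [|g gs IH]; first by rewrite /rev_poly big_nil (negbTE (root1 _)).
rewrite rev_poly_cons rootM IH inE; congr (_ || _).
rewrite /root hornerD hornerN hornerC hornerZ hornerX subr_eq0 eq_sym.
by rewrite -(inj_eq (mulIf a0)) mulfVK // mul1r eq_sym.
Qed.
End Dilation.

(** The list of inverse roots is padded with zeros to length [k]; they are the roots 0 of the
    corresponding phi. *)
Lemma rev_poly_split (C : closedFieldType) (A : {poly C}) k : A`_0 = 1 -> (size A <= k.+1)%N ->
  exists2 gs, size gs = k & A = rev_poly gs.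
Proof.
move=> A0 sA; have An0 : A != 0 by apply: contra_eq_neq A0 => ->; rewrite coef0 eq_sym oner_eq0.
have [rs AE] := closed_field_poly_normal A.
have lA : lead_coef A != 0 by rewrite lead_coef_eq0.
have srs : (size rs <= k)%N by move: sA; rewrite AE size_scale // size_prod_XsubC ltnS.
have A0E : A.[0] = 1 by rewrite horner_coef0.
have rs0 r : r \in rs -> r != 0.
  move=> rrs; apply: contra_eq_neq A0E => r0; rewrite AE hornerZ.
  suff /rootP -> : root (\prod_(z <- rs) ('X - z%:P)) 0 by rewrite mulr0 eq_sym oner_eq0.
  by rewrite root_prod_XsubC -r0.
exists ([seq r^-1 | r <- rs] ++ nseq (k - size rs) 0).
  by rewrite size_cat size_map size_nseq subnKC.
have -> : rev_poly ([seq r^-1 | r <- rs] ++ nseq (k - size rs) 0) = rev_poly [seq r^-1 | r <- rs].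
  rewrite rev_poly_cat [X in _ * X](_ : _ = 1) ?mulr1 // /rev_poly big_nseq.
  by elim: (k - size rs)%N => //= n ->; rewrite scale0r subr0 mulr1.
have rsE : \prod_(z <- rs) ('X - z%:P) = (\prod_(z <- rs) - z) *: rev_poly [seq r^-1 | r <- rs].
  rewrite /rev_poly big_map {AE srs}; elim: rs rs0 => [|r rs IH] rs0.
    by rewrite !big_nil scale1r.
  rewrite !big_cons IH => [|x xrs]; last by apply: rs0; rewrite inE xrs orbT.
  have r0 : r != 0 by apply: rs0; rewrite mem_head.
  have -> : 'X - r%:P = (- r) *: (1 - r^-1 *: 'X).
    by rewrite scalerBr scalerA mulNr mulfV // scaleN1r opprK addrC scaleNr alg_polyC.
  by rewrite -scalerAl -scalerAr scalerA.
have := A0; rewrite {1 2}AE rsE scalerA coefZ rev_poly0 mulr1 => ->.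
by rewrite scale1r.
Qed.

(** * Generating functions of the prescribed weights *)

Section HighestWeights.
Variables (C : closedFieldType) (q Q : C).
Hypotheses (q0 : q != 0) (q_nru : not_root_of_unity q) (Q0 : Q != 0).

Let c0 : q - q^-1 != 0 := qqV_neq0 q0 q_nru.
Let s := q ^- 2.

Lemma nru_s n : (0 < n)%N -> s ^+ n != 1.
Proof. by move=> n0; rewrite exprVn invr_eq1 -exprM q_nru // muln_gt0. Qed.

Definition hw_of (b : C) (gs : seq C) : C * (nat -> C) :=
  (b * q ^+ size gs, fun n => (q - q^-1)^-1 * hw_ser s (b ^- 2 * Q^-1) Q^-1 gs n).

(** Each factor (1 - q^-2 g z)/(1 - g z) equals 1 + q^-1 (q - q^-1) sum_(a > 0) g^a z^a. Expanding
    their product gives a sum over exponent vectors, each nonzero exponent contributing q^-1 (q -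
    q^-1). *)
Lemma p_poly_ser t gs : (0 < t)%N ->
  (q - q^-1) * p_poly q t gs = ser (rev_poly (map ( *%R s) gs)) (rev_poly gs) t.
Proof.
move=> t0; pose c := q - q^-1; pose w a : C := if a == 0%N then 1 else q^-1 * c.
pose f g := \poly_(a < t.+1) (w a * g ^+ a) : {poly C}.
have fP g : eqm t.+1 ((1 - g *: 'X) * f g) (1 - (s * g) *: 'X).
  move=> i it; rewrite coef_linM !coef_poly it coefB coef1 coefZ coefX.
  case: i it => [|i] it; first by rewrite /w /= expr0 mulr0 !subr0 mulr1.
  rewrite coef_poly (ltnW it) /w /= eqSS sub0r exprS.
  case: i it => [|i] it /=; last by rewrite mulr0 oppr0 mulrCA subrr.
  by rewrite /c /s expr0; field.
have prodP : eqm t.+1 (rev_poly gs * \prod_(g <- gs) f g) (rev_poly (map ( *%R s) gs)).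
  elim: gs => [|g gs IH]; first by rewrite big_nil mulr1.
  by rewrite big_cons /= !rev_poly_cons mulrACA; apply: eqmM.
have <- : (\prod_(g <- gs) f g)`_t = ser (rev_poly (map ( *%R s) gs)) (rev_poly gs) t.
  have := eqm_trans prodP (eqm_sym (@serP _ (rev_poly (map ( *%R s) gs)) _ t.+1 (rev_poly0 gs))).
  by move/(eqm_cancel (rev_poly0 gs))/(_ t (ltnSn t)) => ->; rewrite coef_poly ltnSn.
rewrite (big_nth 0) big_mkord.
under eq_bigr => i _ do rewrite /f poly_def.
rewrite bigA_distr_bigA coef_sum /p_poly mulr_sumr [LHS]big_mkcond.
apply: eq_bigr => a _; rewrite scaler_prod coefZ -expr_sum coefXn eq_sym.
case: eqP => [at_|]; last by rewrite mulr0.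
rewrite mulr1 big_split /= mulrA; congr (_ * _).
have -> : \prod_(i < size gs) w (a i) = (q^-1 * c) ^+ ell a.
  rewrite /ell cardsE -prodr_const [RHS]big_mkcond; apply: eq_bigr => i _.
  by rewrite /w unfold_in /=; case: eqP.
(* As t > 0, some exponent is nonzero, so the factor q - q^-1 on the left completes the power (ell
   a).-1. *)
have l0 : (0 < ell a)%N.
  rewrite lt0n; apply/negP; rewrite cards_eq0 => /eqP/setP a0.
  suff t00 : t = 0%N by rewrite t00 in t0.
  by rewrite {1}at_ big1 // => i _; have := a0 i; rewrite !inE => /negbFE/eqP.
by rewrite mulrCA -exprS prednK // exprMn exprVn.
Qed.

(** The extra terms of [pQ_poly] are the convolution with (1 - b^-2 z/Q)/(1 - z/Q) = 1 + (1 - b^-2)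
    sum_(n > 0) Q^-n z^n. *)
Lemma hw_ser_gt0 gs t : (0 < t)%N ->
  forall b, pQ_poly q Q b t gs = (q - q^-1)^-1 * hw_ser s (b ^- 2 * Q^-1) Q^-1 gs t.
Proof.
move=> t0 b; apply: (mulfI c0); rewrite mulrA mulfV // mul1r.
pose P := ser (rev_poly (map ( *%R s) gs)) (rev_poly gs).
have P0 : P 0%N = 1.
  by have := @serP _ (rev_poly (map ( *%R s) gs)) _ 1 (rev_poly0 gs) 0%N isT;
    rewrite coef0M !rev_poly0 mul1r coef_poly.
pose S n := \sum_(z < n) Q ^- (n - z) * P z.
have SS n : S n.+1 = Q^-1 * (S n + P n).
  rewrite /S big_ord_recr /= subSnn expr1 mulrDr mulr_sumr; congr (_ + _).
  by apply: eq_bigr => i _; rewrite subSn 1?ltnW // exprS invfM mulrA.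
pose Psi n := P n + (1 - b ^- 2) * S n.
have -> : (q - q^-1) * pQ_poly q Q b t gs = Psi t.
  have bt : (q - q^-1) * beta_tilde q b = 1 - b ^- 2 by rewrite /beta_tilde mulrA mulfV // mul1r.
  rewrite /pQ_poly !mulrDr p_poly_ser // -/(P t) -addrA; congr (_ + _).
  rewrite {1}[(q - q^-1) * _]mulrA bt /S; case: t t0 => // t _.
  rewrite big_ord_recl /= subn0 P0 mulr1 mulrDr.
  congr (_ + _); rewrite big_add1 big_mkord /= !mulr_sumr; apply: eq_bigr => i _.
  rewrite /P /bump /= add1n -p_poly_ser // -bt.
  by move: (p_poly _ _ _) (beta_tilde _ _) (_ ^- _) (q - q^-1) => x y z c; ring.
apply: (ser_uniq (r := t.+1) (hw_den0 _ _)) (ltnSn t) => m _.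
have PP : eqm m (rev_poly gs * \poly_(i < m) P i) (rev_poly (map ( *%R s) gs)).
  exact: serP (rev_poly0 gs).
have PsiP : eqm m ((1 - Q^-1 *: 'X) * \poly_(n < m) Psi n)
    ((1 - (b ^- 2 * Q^-1) *: 'X) * \poly_(n < m) P n).
  move=> [|j] jm; rewrite !coef_linM !coef_poly jm ?subr0 /Psi.
    by rewrite /S big_ord0 mulr0 addr0.
  rewrite (ltnW jm) SS; move: (S j) (P j) (P j.+1) (b ^- 2) (Q^-1) => x y z t' Q'.
  by ring.
rewrite /hw_den /hw_num -mulrA; apply: eqm_trans (eqmMl _ PsiP) _.
by rewrite mulrCA mulrC; apply: eqmM.
Qed.

Lemma roots_ofE (phi : {poly C}) :
  phi = lead_coef phi *: \prod_(g <- roots_of phi) ('X - g%:P).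
Proof. exact: svalP (closed_field_poly_normal phi). Qed.

Lemma size_roots_of (phi : {poly C}) : phi != 0 -> size (roots_of phi) = (size phi).-1.
Proof.
by move=> p0; rewrite {2}[phi]roots_ofE size_scale ?lead_coef_eq0 // size_prod_XsubC.
Qed.

Lemma uQ_hw (phi : {poly C}) : phi != 0 ->
  (uQ q Q phi).1 = (hw_of (lead_coef phi) (roots_of phi)).1 /\
  forall t, (0 < t)%N -> (uQ q Q phi).2 t = (hw_of (lead_coef phi) (roots_of phi)).2 t.
Proof.
move=> p0; rewrite /uQ /hw_of /= -size_roots_of //.
case: eqP => [k0|_]; last by split=> // t t0; apply: hw_ser_gt0.
rewrite k0 expr0 mulr1; split=> // t t0; rewrite -hw_ser_gt0 // (size0nil k0) /pQ_poly.
have pn z : (0 < z)%N -> p_poly q z [::] = 0.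
  move=> z0; rewrite /p_poly big1 // => a; rewrite big_ord0 => /eqP z0'.
  by rewrite -z0' in z0.
rewrite pn // add0r big_nat big1 ?mulr0 ?addr0 // => z /andP[z0 _].
by rewrite pn // mulr0.
Qed.

Lemma CxQ_roots (phi : {poly C}) : (phi \in CxQ Q) =
  (phi != 0) && (lead_coef phi ^- 2 * Q^-1 \notin roots_of phi).
Proof.
rewrite unfold_in; case: eqVneq => //= p0; congr (~~ _).
by rewrite {1}[phi]roots_ofE rootZ ?lead_coef_eq0 // root_prod_XsubC.
Qed.
End HighestWeights.

(** * Injectivity and surjectivity through the q-difference equation *)

Section Classification.
Variables (C : closedFieldType) (q Q : C).
Hypotheses (q0 : q != 0) (q_nru : not_root_of_unity q) (Q0 : Q != 0).

Let c0 : q - q^-1 != 0 := qqV_neq0 q0 q_nru.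
Let s := q ^- 2.
Let s_nru := nru_s q_nru.
Notation lin a := (1 - a *: 'X).

Lemma hw_vector_ext (M : fdmod q Q) u u' v : hw_vector (M := M) u v ->
  u.1 = u'.1 -> (forall t, (0 < t)%N -> u.2 t = u'.2 t) -> hw_vector (M := M) u' v.
Proof.
case=> v0 vX vK vJ e1 e2; split=> // [|t t0]; first by rewrite -e1.
by rewrite -e2 // vJ.
Qed.

(** The roots q^2 b, ..., q^(2m) b. Dilation by q^-2 shifts them down one rung, so multiplying A by
    their product turns the equation for b into the one for q^(2m) b. *)
Definition ladder (b : C) m := [seq q ^+ (2 * j.+1) * b | j <- iota 0 m].

Lemma ladder_dil b m : lin b * rev_poly (ladder b m)
  = dil s (rev_poly (ladder b m)) * lin (q ^+ (2 * m) * b).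
Proof.
elim: m => [|m IH]; first by rewrite /ladder /= /rev_poly big_nil /dil rmorph1 mulr1 muln0 mul1r mul1r.
have -> : rev_poly (ladder b m.+1) = rev_poly (ladder b m) * lin (q ^+ (2 * m.+1) * b).
  have -> : ladder b m.+1 = ladder b m ++ [:: q ^+ (2 * m.+1) * b].
    have h : iota 0 m.+1 = iota 0 m ++ [:: m] by rewrite -[in LHS]addn1 iotaD.
    by rewrite /ladder h map_cat.
  by rewrite rev_poly_cat {2}/rev_poly big_seq1.
rewrite mulrA IH dilM dil_lin; congr (_ * _ * _); congr (1 - _ *: _).
by rewrite mulrA mulnS exprD mulrA /s mulVf ?mul1r // expf_neq0.
Qed.

(** The q-difference equation A(z) (1 - z/Q) Psi(z) = A(q^-2 z) (1 - b z) modulo z^m, in which [b]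
    already stands for beta^-2/Q. *)
Definition hw_eqn (Psi : nat -> C) m (A : {poly C}) b : Prop :=
  eqm m (A * (lin Q^-1 * \poly_(i < m) Psi i)) (dil s A * lin b).

Lemma hw_eqn_ser m b gs : hw_eqn (hw_ser s b Q^-1 gs) m (rev_poly gs) b.
Proof.
by rewrite /hw_eqn mulrA -rev_poly_dil; apply: (serP _ (hw_den0 Q^-1 gs)).
Qed.

Lemma hw_eqn_uniq Psi r b gs : hw_eqn Psi r (rev_poly gs) b ->
  forall n, (n < r)%N -> Psi n = hw_ser s b Q^-1 gs n.
Proof.
move=> h n nr; have := @hw_eqn_ser r b gs; rewrite /hw_eqn !mulrA => h'.
rewrite /hw_eqn mulrA in h.
have := eqm_trans h (eqm_sym h').
by move/(eqm_cancel (hw_den0 Q^-1 gs))/(_ n nr); rewrite !coef_poly nr.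
Qed.

Lemma bt_ladder b m : b != 0 -> (b * q ^- m) ^- 2 * Q^-1 = q ^+ (2 * m) * (b ^- 2 * Q^-1).
Proof. by move=> b0; rewrite exprMn invfM exprVn invrK -exprM mulnC mulrA [b ^- 2 * _]mulrC. Qed.

Lemma hw_ser0 b gs : hw_ser s b Q^-1 gs 0 = 1.
Proof.
have := @serP _ (hw_num s b gs) _ 1 (hw_den0 Q^-1 gs) 0%N isT.
by rewrite coef0M hw_den0 mul1r coef_poly hw_num0.
Qed.

(** Both R' and R times a ladder of length m = |gs'| - |gs| solve the same equation, hence are
    equal. If m > 0, the top rung b'^-2/Q would be a root in gs', which is excluded. *)
Lemma hw_of_inj_le b b' gs gs' : (size gs <= size gs')%N -> b != 0 -> b' != 0 ->
  b' ^- 2 * Q^-1 \notin gs' ->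
  (hw_of q Q b gs).1 = (hw_of q Q b' gs').1 ->
  (forall t, (0 < t)%N -> (hw_of q Q b gs).2 t = (hw_of q Q b' gs').2 t) ->
  b = b' /\ size gs = size gs' /\ rev_poly gs = rev_poly gs'.
Proof.
move=> sz b0 b'0 nr /= e1 e2; pose m := (size gs' - size gs)%N.
have b'E : b' = b * q ^- m.
  have qk : q ^+ size gs' != 0 by rewrite expf_neq0.
  apply: (mulIf qk); rewrite -e1 -mulrA; congr (_ * _).
  by rewrite -[in RHS](subnK sz) -/m exprD mulKf // expf_neq0.
set t := b ^- 2 * Q^-1 in e2; have tE : b' ^- 2 * Q^-1 = q ^+ (2 * m) * t by rewrite b'E bt_ladder.
rewrite tE in e2 nr; set t' := q ^+ (2 * m) * t in e2 nr.
have eS n : hw_ser s t Q^-1 gs n = hw_ser s t' Q^-1 gs' n.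
  case: n => [|n]; first by rewrite !hw_ser0.
  by apply: (mulfI (invr_neq0 c0)); apply: e2.
set R := rev_poly gs; set R' := rev_poly gs'; pose D := rev_poly (ladder t m).
have RR' : R' * (dil s R * lin t) = R * (dil s R' * lin t').
  apply: eqm_all => n; have h := @hw_eqn_ser n t gs; have h' := @hw_eqn_ser n t' gs'.
  have eP : \poly_(i < n) hw_ser s t Q^-1 gs i = \poly_(i < n) hw_ser s t' Q^-1 gs' i.
    by apply: eq_poly => i _; apply: eS.
  apply: (@eqm_trans _ _ (R' * (R * (lin Q^-1 * \poly_(i < n) hw_ser s t Q^-1 gs i)))).
    exact: eqmMl _ (eqm_sym h).
  rewrite mulrCA eP; exact: eqmMl _ h'.
have t'0 : lin t' != 0 by apply: contra_eq_neq (coef0_lin t') => ->; rewrite coef0 eq_sym oner_eq0.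
have R'E : R' = R * D.
  apply: (dil_uniq s_nru); rewrite ?rev_poly0 // ?coef0M ?rev_poly0 ?mulr1 //.
  apply: (mulIf t'0); rewrite dilM -[LHS]mulrA -[dil s R * _ * _]mulrA -ladder_dil -/D.
  rewrite [dil s R * _]mulrA mulrA RR' -/D.
  by rewrite -!mulrA; congr (_ * _); rewrite mulrCA mulrA mulrC [lin t' * _]mulrC !mulrA.
have m0 : m = 0%N.
  apply/eqP; apply: contraNT nr => m0; rewrite -root_rev_poly; last first.
    by rewrite mulf_neq0 ?expf_neq0 // mulf_neq0 ?invr_neq0 ?expf_neq0.
  rewrite -/R' R'E rootM; apply/orP; right; rewrite root_rev_poly; last first.
    by rewrite mulf_neq0 ?expf_neq0 // mulf_neq0 ?invr_neq0 ?expf_neq0.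
  apply/mapP; exists m.-1; last by rewrite prednK // lt0n.
  by rewrite mem_iota /= add0n prednK // lt0n.
have szE : size gs = size gs'.
  by apply/eqP; rewrite eqn_leq sz -subn_eq0 -/m m0.
split; first by rewrite b'E m0 expr0 invr1 mulr1.
by split=> //; rewrite R'E /D m0 /ladder /= /rev_poly big_nil mulr1.
Qed.

(** Roots equal to 0 leave no trace in [rev_poly]; the equality of sizes recovers their number. *)
Lemma rev_poly_inj (gs gs' : seq C) : size gs = size gs' -> rev_poly gs = rev_poly gs' ->
  \prod_(g <- gs) ('X - g%:P) = \prod_(g <- gs') ('X - g%:P).
Proof.
move=> sz e; apply/polyP => i; have [le|lt] := leqP i (size gs).
  by rewrite !coef_rev_poly -?sz // e.
by rewrite !nth_default ?size_prod_XsubC -?sz.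
Qed.

Lemma prod_XsubC_rev (gs gs' : seq C) : \prod_(g <- gs) ('X - g%:P) = \prod_(g <- gs') ('X - g%:P) ->
  size gs = size gs' /\ rev_poly gs = rev_poly gs'.
Proof.
move=> e; have sz : size gs = size gs'.
  by have := congr1 (fun p : {poly C} => size p) e; rewrite !size_prod_XsubC => -[].
split=> //; apply/polyP => i; have [le|lt] := leqP i (size gs); last first.
  rewrite !nth_default // (leq_trans (size_rev_poly _)) //; by rewrite -sz.
have h (gs1 : seq C) : (i <= size gs1)%N ->
    (rev_poly gs1)`_i = (\prod_(g <- gs1) ('X - g%:P))`_(size gs1 - i).
  by move=> le1; rewrite coef_rev_poly ?leq_subr // subKn.
by rewrite !h -?sz // e.
Qed.

Lemma uQ_inj (phi psi : {poly C}) : phi \in CxQ Q -> psi \in CxQ Q ->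
  (uQ q Q phi).1 = (uQ q Q psi).1 ->
  (forall t, (0 < t)%N -> (uQ q Q phi).2 t = (uQ q Q psi).2 t) -> phi = psi.
Proof.
rewrite !CxQ_roots => /andP[p0 pr] /andP[p0' pr'].
have [-> h] := uQ_hw Q q0 q_nru p0; have [-> h'] := uQ_hw Q q0 q_nru p0' => e1 e2.
have l0 : lead_coef phi != 0 by rewrite lead_coef_eq0.
have l0' : lead_coef psi != 0 by rewrite lead_coef_eq0.
have e2' t : (0 < t)%N -> (hw_of q Q (lead_coef phi) (roots_of phi)).2 t
    = (hw_of q Q (lead_coef psi) (roots_of psi)).2 t by move=> t0; rewrite -h // -h' // e2.
suff [lE [sz rE]] : lead_coef phi = lead_coef psi /\ size (roots_of phi) = size (roots_of psi) /\
    rev_poly (roots_of phi) = rev_poly (roots_of psi).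
  by rewrite [LHS]roots_ofE [RHS]roots_ofE lE (rev_poly_inj sz rE).
have [le|/ltnW le] := leqP (size (roots_of phi)) (size (roots_of psi)).
  exact: (hw_of_inj_le le).
by have [-> [-> ->]] := hw_of_inj_le le l0' l0 pr (esym e1) (fun t t0 => esym (e2' t t0)).
Qed.

Lemma uQ_of_list b gs : b != 0 -> b ^- 2 * Q^-1 \notin gs ->
  exists2 phi, phi \in CxQ Q & (uQ q Q phi).1 = (hw_of q Q b gs).1 /\
    forall t, (0 < t)%N -> (uQ q Q phi).2 t = (hw_of q Q b gs).2 t.
Proof.
move=> b0 nr; pose phi := b *: \prod_(g <- gs) ('X - g%:P).
have lE : lead_coef phi = b by rewrite lead_coefZ (monicP (monic_prod_XsubC _ _ _)) mulr1.
have p0 : phi != 0 by rewrite -lead_coef_eq0 lE.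
have [|sz rE] := @prod_XsubC_rev (roots_of phi) gs.
  by apply: (scalerI b0); rewrite -[in LHS]lE -roots_ofE.
have [e1 e2] := uQ_hw Q q0 q_nru p0.
have hE n : hw_ser s (b ^- 2 * Q^-1) Q^-1 (roots_of phi) n = hw_ser s (b ^- 2 * Q^-1) Q^-1 gs n.
  by rewrite /hw_ser /hw_num /hw_den !rev_poly_dil rE.
exists phi; last first.
  split; first by rewrite e1 /= sz lE.
  by move=> t t0; rewrite e2 //= lE -/s hE.
rewrite CxQ_roots p0 lE /=.
have bt0 : b ^- 2 * Q^-1 != 0 by rewrite mulf_neq0 ?invr_neq0 ?expf_neq0.
by rewrite -root_rev_poly // rE root_rev_poly.
Qed.

Lemma hw_eqn_reduce Psi k (l : C) (A : {poly C}) : l != 0 -> A`_0 = 1 -> (size A <= k.+1)%N ->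
  (forall m, hw_eqn Psi m A ((l * q ^- k) ^- 2 * Q^-1)) ->
  exists b gs, [/\ b * q ^+ size gs = l, b != 0, b ^- 2 * Q^-1 \notin gs &
     forall m, hw_eqn Psi m (rev_poly gs) (b ^- 2 * Q^-1)].
Proof.
move=> l0; elim: k A => [|k IH] A A0 sA h.
all: have [gs sz AE] := rev_poly_split A0 sA.
  exists l, gs; rewrite (size0nil sz) expr0 invr1 mulr1 in h *; split=> // m.
  by have := h m; rewrite AE (size0nil sz).
set b := l * q ^- k.+1 in h; have b0 : b != 0 by rewrite mulf_neq0 // invr_neq0 ?expf_neq0.
have bE : b * q ^+ k.+1 = l by rewrite divfK // expf_neq0.
set t := b ^- 2 * Q^-1 in h.
have [tgs|ngs] := boolP (t \in gs); last first.
  by exists b, gs; rewrite sz; split=> // m; rewrite -AE.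
pose A1 := rev_poly (rem t gs).
have AE1 : A = lin t * A1.
  by rewrite AE /A1 -rev_poly_cons /rev_poly; apply: perm_big; apply: perm_to_rem.
apply: (IH A1); first exact: rev_poly0.
  by rewrite (leq_trans (size_rev_poly _)) // size_rem // sz.
move=> m; have -> : (l * q ^- k) ^- 2 * Q^-1 = s * t.
  have -> : l * q ^- k = b * q.
    by rewrite -bE exprS mulrA mulfK // expf_neq0.
  by rewrite exprMn invfM /t /s mulrA [q ^- 2 * _]mulrC.
(* The factor 1 - t z of A cancels the one on the right, while its dilation 1 - q^-2 t z becomes the
   new right-hand factor. *)
have := h m; rewrite /hw_eqn AE1 dilM dil_lin.
have -> : lin (s * t) * dil s A1 * lin t = lin t * (dil s A1 * lin (s * t)).
  by rewrite mulrC; congr (_ * _); rewrite mulrC.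
by rewrite -mulrA; apply: eqm_cancel; apply: coef0_lin.
Qed.

Section Surjectivity.
Variables (M : fdmod q Q) (u : C * (nat -> C)) (v : 'cV[C]_(fd_dim M)).
Hypothesis hv : hw_vector (M := M) u v.
Let l := u.1.
Let l0 : l != 0 := hw_weight_neq0 hv.
Let Psi n := if n == 0%N then 1 else (q - q^-1) * u.2 n.
Let N := (fd_dim M).-1.
Let bt j := (l * q ^- j) ^- 2 * Q^-1.

Let bt0 j : bt j != 0.
Proof. by rewrite mulf_neq0 ?invr_neq0 // expf_neq0 // mulf_neq0 // invr_neq0 ?expf_neq0. Qed.

(** Adding p X^r changes the defect in order r by p (1 - s^r), whose second factor is nonzero since
    r > 0. *)
Lemma hw_eqn_extend r (A : {poly C}) : (0 < r)%N -> A`_0 = 1 -> hw_eqn Psi r A (bt N) ->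
  exists p, hw_eqn Psi r.+1 (A + p *: 'X^r) (bt N).
Proof.
move=> r0 A0 h.
have s1 : 1 - s ^+ r != 0 by rewrite subr_eq0 eq_sym s_nru.
pose W := lin Q^-1 * \poly_(i < r.+1) Psi i.
have W0 : W`_0 = 1 by rewrite coef0M coef0_lin mul1r coef_poly.
exists (((dil s A * lin (bt N))`_r - (A * W)`_r) / (1 - s ^+ r)); set p := _ / _.
have dX : dil s (p *: 'X^r) = (p * s ^+ r) *: 'X^r.
  apply/polyP => i; rewrite coef_dil !coefZ coefXn mulrCA.
  by case: eqP => [->|]; rewrite ?mulr0 ?mulr1 // mulrC.
move=> i; rewrite ltnS leq_eqVlt -/W => ir.
have -> : dil s (A + p *: 'X^r) = dil s A + (p * s ^+ r) *: 'X^r by rewrite -dX /dil rmorphD.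
rewrite !mulrDl !coefD -!scalerAl !coefZ !coefXnM.
case/orP: ir => [/eqP ->|ir].
  rewrite ltnn subnn W0 coef0_lin !mulr1.
  have -> : (dil s A * lin (bt N))`_r = (A * W)`_r + p * (1 - s ^+ r).
    by rewrite /p divfK // [RHS]addrC subrK.
  by clear dX; move: p => p1; move: (_`_r) (s ^+ r) => x y; ring.
rewrite ir !mulr0 !addr0 -(h i ir); apply: (eqmM (m := r)) => // j jr.
apply: (eqmM (m := r)) => // j' jr'; by rewrite !coef_poly jr' ltnW.
Qed.

(* If [p <> 0], truncating at order [r] gives a weight of degree [r] whose module agrees
   with [M] up to order [r] but on which [E^r F^r] does not vanish. *)
Lemma hw_eqn_stop r (A : {poly C}) p : (N < r)%N -> A`_0 = 1 -> (size A <= N.+1)%N ->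
  hw_eqn Psi r.+1 (A + p *: 'X^r) (bt N) -> p = 0.
Proof.
move=> Nr A0 sA h; have r0 : (0 < r)%N by apply: leq_ltn_trans Nr.
pose m := (r - N)%N; pose D := rev_poly (ladder (bt N) m).
have btr : bt r = q ^+ (2 * m) * bt N.
  rewrite -bt_ladder; last by rewrite mulf_neq0 // invr_neq0 ?expf_neq0.
  by rewrite /bt; congr (_ ^- 2 * _); rewrite -mulrA -invfM -exprD subnKC // ltnW.
(* Passing from degree N to degree r multiplies A by the ladder [D]; modulo X^(r+1) this leaves p
   X^r unchanged. *)
pose B := A * D + p *: 'X^r.
have XD : eqm r.+1 ((p *: 'X^r) * D) (p *: 'X^r).
  move=> i ir; rewrite -scalerAl !coefZ coefXnM coefXn; congr (_ * _).
  case: (ltngtP i r) => [//|ri|->]; last by rewrite subnn rev_poly0.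
  by move: ir; rewrite ltnS leqNgt ri.
have BE : eqm r.+1 B ((A + p *: 'X^r) * D).
  by move=> i ir; rewrite mulrDl coefD [RHS]coefD (XD i ir).
have dil_eqm P P' : eqm r.+1 P P' -> eqm r.+1 (dil s P) (dil s P').
  by move=> e i ir; rewrite !coef_dil e.
have hB : hw_eqn Psi r.+1 B (bt r).
  rewrite /hw_eqn; set W := lin _ * _.
  apply: (@eqm_trans _ _ (D * ((A + p *: 'X^r) * W))).
    have -> : D * ((A + p *: 'X^r) * W) = ((A + p *: 'X^r) * D) * W.
      by rewrite mulrA [D * _]mulrC.
    exact: eqmM BE _.
  apply: (@eqm_trans _ _ (D * (dil s (A + p *: 'X^r) * lin (bt N)))); first exact: eqmMl _ h.
  have -> : D * (dil s (A + p *: 'X^r) * lin (bt N))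
      = dil s ((A + p *: 'X^r) * D) * lin (bt r).
    by rewrite dilM mulrCA -mulrA btr -ladder_dil [D * _]mulrC.
  by apply: eqmM => //; apply: dil_eqm; apply: eqm_sym.
have B0 : B`_0 = 1.
  by rewrite coefD coef0M A0 rev_poly0 coefZ coefXn eq_sym (gtn_eqF r0) mulr0 addr0 mulr1.
have sB : (size B <= r.+1)%N.
  rewrite (leq_trans (size_polyD _ _)) // geq_max; apply/andP; split; last first.
    by rewrite (leq_trans (size_scale_leq _ _)) // size_polyXn.
  rewrite (leq_trans (size_polyMleq _ _)) //.
  have sD : (size D <= m.+1)%N.
    by rewrite (leq_trans (size_rev_poly _)) // size_map size_iota.
  rewrite -subn1 leq_subLR; apply: leq_trans (leq_add sA sD) _.
  by rewrite addnS addSn subnKC // ltnW.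
have [gs sgs BE'] := rev_poly_split B0 sB.
pose b := l * q ^- r; have b0 : b != 0 by rewrite mulf_neq0 // invr_neq0 ?expf_neq0.
have [M' [v' [hv' top]]] := exists_hw_module gs q0 q_nru Q0 b0.
rewrite BE' in hB; have PsiE := hw_eqn_uniq hB.
have EF0 : iter r (mulmx (fd_Xp M' 0)) (iter r (mulmx (fd_Xm M' 0)) v') = 0.
  apply: (iter_Xp_Xm_eq0 q0 q_nru hv hv') => /=; first by rewrite sgs divfK // expf_neq0.
    move=> t /andP[t0 tr]; have := PsiE t; rewrite ltnS /Psi gtn_eqF // => /(_ tr).
    by rewrite -/s -/b => <-; rewrite mulrA mulVf // mul1r.
  apply: (iter_Xm_eq0 q0 q_nru hv); by move: Nr; rewrite /N; case: (fd_dim M).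
(* The product of the b - g_i must vanish, so 1/[bt r] is a root of [B]. It is also a root of [D],
   being the inverse of its top rung; evaluating [B] there leaves only the term in p. *)
have rB : root B (bt r)^-1.
  rewrite BE' root_rev_poly //; apply: contraPT EF0 => ngs; apply/eqP.
  rewrite -sgs; apply: top => g ggs; apply: contraNneq ngs => /eqP; rewrite subr_eq0 => /eqP gE.
  by rewrite /bt -/b gE mulrC mulKf.
move: rB; rewrite /root hornerD hornerM hornerZ hornerXn.
have -> : D.[(bt r)^-1] = 0.
  apply/rootP; rewrite root_rev_poly //; apply/mapP; exists m.-1.
    by rewrite mem_iota /= add0n prednK // subn_gt0.
  by rewrite prednK ?subn_gt0.
rewrite mulr0 add0r mulf_eq0 expf_eq0 invr_eq0 (negPf (bt0 r)) andbF orbF.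
by move/eqP.
Qed.

Lemma hw_eqn_exists : exists A : {poly C}, [/\ A`_0 = 1, (size A <= N.+1)%N
  & forall m, hw_eqn Psi m A (bt N)].
Proof.
have base : hw_eqn Psi 1 1 (bt N).
  move=> [|//] _; rewrite /dil rmorph1 !mul1r coef0M !coef0_lin mul1r coef_poly.
  by [].
have step r : (r <= N)%N -> exists A : {poly C}, [/\ A`_0 = 1, (size A <= N.+1)%N & hw_eqn Psi r.+1 A (bt N)].
  elim: r => [|r IH] rN.
    by exists 1; split=> //; [rewrite coef1|rewrite size_poly1].
  have [A [A0 sA h]] := IH (ltnW rN).
  have [p hp] := hw_eqn_extend (ltn0Sn r) A0 h.
  exists (A + p *: 'X^(r.+1)); split=> //.
    by rewrite coefD A0 coefZ coefXn mulr0 addr0.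
  rewrite (leq_trans (size_polyD _ _)) // geq_max sA /=.
  by rewrite (leq_trans (size_scale_leq _ _)) // size_polyXn.
have [A [A0 sA h]] := step N (leqnn N); exists A; split=> // m.
have hr r : hw_eqn Psi (N + r).+1 A (bt N).
  elim: r => [|r IH]; first by rewrite addn0.
  have [p hp] := hw_eqn_extend (ltn0Sn _) A0 IH.
  (* Beyond order N every extension coefficient is zero, so the polynomial found at order N solves
     all higher orders. *)
  have p0 : p = 0.
    by apply: hw_eqn_stop hp => //; rewrite ltnS leq_addr.
  by move: hp; rewrite p0 scale0r addr0 addnS.
move=> i im; have := hr i; rewrite /hw_eqn => /(_ i).
rewrite ltnS leq_addl => /(_ isT) <-.
apply: (@eqmMl _ i.+1) => //; apply: eqmMl => j ji.
rewrite !coef_poly ltnS (leq_trans ji) ?(leq_trans ji) //.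
by rewrite (leq_trans _ (leq_addl _ _)).
Qed.

Lemma hw_vector_uQ : exists2 phi, phi \in CxQ Q & hw_vector (M := M) (uQ q Q phi) v.
Proof.
have [A [A0 sA h]] := hw_eqn_exists.
have [b [gs [bE b0 nr hgs]]] := hw_eqn_reduce l0 A0 sA h.
have [phi phiC [e1 e2]] := uQ_of_list b0 nr; exists phi => //.
apply: hw_vector_ext hv _ _ => [|t t0]; first by rewrite e1 /= bE.
rewrite e2 //= -/s; have := hw_eqn_uniq (hgs t.+1) (ltnSn t).
by rewrite /Psi gtn_eqF // => <-; rewrite mulrA mulVf // mul1r.
Qed.
End Surjectivity.
End Classification.


Theorem mainTheorem6 (R : realType) (q Q : R[i]) :
  q != 0 -> not_root_of_unity q -> Q != 0 ->
  [/\ (* L(u^<Q>(phi)) is finite dimensional for phi in C[x]^<Q> *)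
      forall phi : {poly R[i]}, phi \in CxQ Q ->
        exists M : fdmod q Q, is_L M (uQ q Q phi),
      (* L(u) is well defined up to isomorphism *)
      forall (u : R[i] * (nat -> R[i])) (M N : fdmod q Q),
        is_L M u -> is_L N u -> iso M N,
      (* injectivity on isomorphism classes *)
      forall (phi psi : {poly R[i]}) (M N : fdmod q Q),
        phi \in CxQ Q -> psi \in CxQ Q ->
        is_L M (uQ q Q phi) -> is_L N (uQ q Q psi) -> iso M N -> phi = psi
    & (* surjectivity onto finite dimensional simple modules *)
      forall M : fdmod q Q, simple M ->
        exists2 phi : {poly R[i]}, phi \in CxQ Q & is_L M (uQ q Q phi)].
Proof.
move=> q0 q_nru Q0; split.
- move=> phi phiC; have /andP[p0 _] := phiC.
  have l0 : lead_coef phi != 0 by rewrite lead_coef_eq0.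
  have [M [v [hv _]]] := exists_hw_module (roots_of phi) q0 q_nru Q0 l0.
  have [e1 e2] := uQ_hw Q q0 q_nru p0.
  apply: (simple_of_hw (M := M) (v := v)).
  by apply: hw_vector_ext hv _ _ => // t t0; rewrite e2.
- by move=> u M N [Ms [v hv]] [Ns [w hw]]; apply: hw_iso Ms Ns hv hw.
- move=> phi psi M N phiC psiC [_ [v hv]] [Ns [w hw]] MN.
  have [w' hw'] := iso_hw MN hv.
  have [e1 e2] := hw_unique q0 q_nru Ns hw' hw.
  exact: uQ_inj phiC psiC e1 e2.
move=> M Ms; have [M0 _] := Ms.
have [u [v hv]] := exists_hw_vector q0 q_nru M0.
have [phi phiC hphi] := hw_vector_uQ q0 q_nru Q0 hv.
by exists phi => //; split=> //; exists v.
Qed.
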